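(* Let $n\ge1$ be an integer and let $\psi\in L^2(\mathbb{R}^{2n},\mathbb{H})$ be a nonzero admissible quaternion shearlet such that, for $u,v,t\in\mathbb{R}^n$, $$\mathcal{F}_Q(\psi)(u,v)e^{-2j\pi v\cdot t}=e^{-2j\pi v\cdot t}\mathcal{F}_Q(\psi)(u,v)\quad\text{and}\quad \mathcal{F}_Q(j\psi)(u,v)e^{-2j\pi v\cdot t}=j\,e^{-2j\pi v\cdot t}\mathcal{F}_Q(\psi)(u,v).$$ Then for every $f\in L^2(\mathbb{R}^{2n},\mathbb{H})$ with $f\ne0$, $$E\big(|\mathcal{SH}_\psi^Q(f)|^2\big)\ \ge\ C_\psi\,\|f\|_2^2\,\ln\!\Big(\frac{1}{\|f\|_2^2\,\|\psi\|_2^2}\Big).$$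
   Context: $\mathbb{H}$ is the real quaternion algebra with units $i,j,k$, conjugation $\overline{q}$ and modulus $|q|$. $\|f\|_2=(\int_{\mathbb{R}^{2n}}|f(x)|^2dx)^{1/2}$ for $f:\mathbb{R}^{2n}\to\mathbb{H}$. $\mathbb{R}^*=\mathbb{R}\setminus\{0\}$. The (two-sided) quaternion Fourier transform of $f\in L^1\cap L^2(\mathbb{R}^{2n},\mathbb{H})$ is $\mathcal{F}_Q(f)(u,v)=\int_{\mathbb{R}^{2n}}e^{-2i\pi u\cdot x}f(x,y)e^{-2j\pi v\cdot y}\,dx\,dy$ with $x,y,u,v\in\mathbb{R}^n$; it extends to a norm-preserving operator on $L^2(\mathbb{R}^{2n},\mathbb{H})$. For $a\in\mathbb{R}^*$, $s\in\mathbb{R}^{2n-1}$: $A_a=\begin{pmatrix} a & 0^T\\ 0 & \mathrm{sg}(a)|a|^{\frac1{2n}}I_{2n-1}\end{pmatrix}$ ($\mathrm{sg}$ is the sign) and $S_s=\begin{pmatrix}1 & s^T\\ 0 & I_{2n-1}\end{pmatrix}$, both $2n\times 2n$. For $t\in\mathbb{R}^{2n}$, $\psi_{a,s,t}(x)=|a|^{\frac1{4n}-1}\psi(A_a^{-1}S_s^{-1}(x-t))$. Put $\psi^*(x)=\overline{\psi(-x)}$. A function $\psi\in L^2(\mathbb{R}^{2n},\mathbb{H})$ is an admissible quaternion shearlet iff $C_\psi:=\int_{\mathbb{R}^{2n}}\frac{|\mathcal{F}_Q(\psi^* )(\lambda)|^2}{|\lambda_1|^{2n}}\,d\lambda<\infty$,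 where $\lambda=(\lambda_1,\dots,\lambda_{2n})$. The continuous quaternion shearlet transform is $\mathcal{SH}_\psi^Q(f)(a,s,t)=\int_{\mathbb{R}^{2n}}f(x)\overline{\psi_{a,s,t}(x)}\,dx$. $\mu$ is the measure $d\mu(a,s,t)=\frac{da\,ds\,dt}{|a|^{2n+1}}$ on $\mathbb{R}^*\times\mathbb{R}^{2n-1}\times\mathbb{R}^{2n}$. The entropy of a nonnegative measurable function $P$ on $\mathbb{R}^*\times\mathbb{R}^{2n-1}\times\mathbb{R}^{2n}$ is $E(P)=-\int \ln(P(a,s,t))\,P(a,s,t)\,d\mu(a,s,t)$ (with $0\ln 0=0$; the value $+\infty$ is allowed). *)

(* Defs.v *)
From HB Require Import structures.
From mathcomp Require Import all_boot all_order all_algebra.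
From mathcomp Require Import ring lra.
From mathcomp Require Import all_classical all_reals all_analysis.
From mathcomp Require Import measurable_realfun.

Set Implicit Arguments.
Unset Strict Implicit.
Unset Printing Implicit Defensive.

Import Order.TTheory GRing.Theory Num.Theory.
Import numFieldNormedType.Exports.

Local Open Scope classical_set_scope.
Local Open Scope ring_scope.

Record quat (R : Type) := Quat { qre : R; qim_i : R; qim_j : R; qim_k : R }.

Section quat_algebra.
Variable R : realType.
Implicit Types p q r : quat R.

Definition quat_to q := (qre q, qim_i q, qim_j q, qim_k q).
Definition quat_of (x : R * R * R * R) :=
  Quat x.1.1.1 x.1.1.2 x.1.2 x.2.

Lemma quat_toK : cancel quat_to quat_of. Proof. by case. Qed.

HB.instance Definition _ := Choice.copy (quat R) (can_type quat_toK).

Definition addq p q := Quat (qre p + qre q) (qim_i p + qim_i q)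
  (qim_j p + qim_j q) (qim_k p + qim_k q).

Definition oppq p := Quat (- qre p) (- qim_i p) (- qim_j p) (- qim_k p).

Definition mulq p q :=
  Quat (qre p * qre q - qim_i p * qim_i q - qim_j p * qim_j q
        - qim_k p * qim_k q)
       (qre p * qim_i q + qim_i p * qre q + qim_j p * qim_k q
        - qim_k p * qim_j q)
       (qre p * qim_j q - qim_i p * qim_k q + qim_j p * qre q
        + qim_k p * qim_i q)
       (qre p * qim_k q + qim_i p * qim_j q - qim_j p * qim_i q
        + qim_k p * qre q).

Definition scaleq (c : R) q :=
  Quat (c * qre q) (c * qim_i q) (c * qim_j q) (c * qim_k q).

Let zeroq : quat R := Quat 0 0 0 0.
Let oneq : quat R := Quat 1 0 0 0.

Fact addqA : associative addq.
Proof. by move=> p q r; congr Quat => /=; ring. Qed.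

Fact addqC : commutative addq.
Proof. by move=> p q; congr Quat => /=; ring. Qed.

Fact add0q : left_id zeroq addq.
Proof. by move=> [a b c d]; congr Quat => /=; ring. Qed.

Fact addNq : left_inverse zeroq oppq addq.
Proof. by move=> p; congr Quat => /=; ring. Qed.

HB.instance Definition _ :=
  GRing.isZmodule.Build (quat R) addqA addqC add0q addNq.

Fact mulqA : associative mulq.
Proof. by move=> p q r; congr Quat => /=; ring. Qed.

Fact mul1q : left_id oneq mulq.
Proof. by move=> [a b c d]; congr Quat => /=; ring. Qed.

Fact mulq1 : right_id oneq mulq.
Proof. by move=> [a b c d]; congr Quat => /=; ring. Qed.

Fact mulqDl : left_distributive mulq addq.
Proof. by move=> p q r; congr Quat => /=; ring. Qed.

Fact mulqDr : right_distributive mulq addq.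
Proof. by move=> p q r; congr Quat => /=; ring. Qed.

Fact oneq_neq0 : oneq != zeroq.
Proof. by apply/eqP => -[] /eqP; rewrite oner_eq0. Qed.

HB.instance Definition _ := GRing.Zmodule_isNzRing.Build (quat R)
  mulqA mul1q mulq1 mulqDl mulqDr oneq_neq0.

Fact scaleqA a b q : scaleq a (scaleq b q) = scaleq (a * b) q.
Proof. by congr Quat => /=; ring. Qed.

Fact scale1q : left_id 1 scaleq.
Proof. by move=> [a b c d]; congr Quat => /=; ring. Qed.

Fact scaleqDr : right_distributive scaleq +%R.
Proof. by move=> a p q; congr Quat => /=; ring. Qed.

Fact scaleqDl q : {morph scaleq^~ q : a b / a + b}.
Proof. by move=> a b; congr Quat => /=; ring. Qed.

HB.instance Definition _ := GRing.Zmodule_isLmodule.Build R (quat R)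
  scaleqA scale1q scaleqDr scaleqDl.

Definition unit_i : quat R := Quat 0 1 0 0.
Definition unit_j : quat R := Quat 0 0 1 0.

Definition conjq q := Quat (qre q) (- qim_i q) (- qim_j q) (- qim_k q).

Definition absq q : R :=
  Num.sqrt (qre q ^+ 2 + qim_i q ^+ 2 + qim_j q ^+ 2 + qim_k q ^+ 2).

(* [e^(theta e)] for a unit [e] with [e ^+ 2 = -1], by Euler's formula. *)
Definition expq (e : quat R) (theta : R) : quat R :=
  cos theta *: (1 : quat R) + sin theta *: e.

End quat_algebra.

Notation vec R m := (m.-tuple (measurableTypeR R)).

Section vectors.
Variable R : realType.

Definition oppv m (x : vec R m) : vec R m := [tuple - (tnth x i : R) | i < m].

Definition subv m (x y : vec R m) : vec R m :=
  [tuple (tnth x i : R) - tnth y i | i < m].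

Definition dotv m (x y : vec R m) : R :=
  \sum_(i < m) (tnth x i : R) * tnth y i.

Definition mulmxv m (A : 'M[R]_m) (x : vec R m) : vec R m :=
  [tuple (A *m \col_j (tnth x j : R)) i 0 | i < m].

(* The components of a point [(x, y)] of [R^n * R^n = R^(n + n)]. *)
Definition fstv n (z : vec R (n + n)) : vec R n :=
  [tuple tnth z (lshift n i) | i < n].
Definition sndv n (z : vec R (n + n)) : vec R n :=
  [tuple tnth z (rshift n i) | i < n].

End vectors.

(* On [m1 \x m2], canonical structure inference selects the instance for
   subprobabilities, which hides sigma-finiteness; hence this named copy. *)
Section sigma_finite_prod.
Local Open Scope ereal_scope.
Context d1 d2 (T1 : measurableType d1) (T2 : measurableType d2).
Context (R : realType).
Variable m1 : {sigma_finite_measure set T1 -> \bar R}.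
Variable m2 : {sigma_finite_measure set T2 -> \bar R}.

Definition sigma_finite_prod := m1 \x m2.

HB.instance Definition _ := Measure.on sigma_finite_prod.

Let prod_sigma_finite : sigma_finite setT sigma_finite_prod.
Proof.
have /sigma_finiteP[F [TF ndF Foo]] := sigma_finiteT m1.
have /sigma_finiteP[G [TG ndG Goo]] := sigma_finiteT m2.
exists (fun n => F n `*` G n).
  rewrite -setXTT TF TG predeqE => -[x y]; split.
    move=> [/= [n _ Fnx] [k _ Gky]]; exists (maxn n k) => //; split.
    - by move: x Fnx; exact/subsetPset/ndF/leq_maxl.
    - by move: y Gky; exact/subsetPset/ndG/leq_maxr.
  by move=> [n _ []/= ? ?]; split; exists n.
move=> k; have [? ?] := Foo k; have [? ?] := Goo k.
split; first exact: measurableX.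
by rewrite [ltLHS]product_measure1E// lte_mul_pinfty// ge0_fin_numE.
Qed.

HB.instance Definition _ :=
  Measure_isSigmaFinite.Build _ _ _ sigma_finite_prod prod_sigma_finite.

End sigma_finite_prod.

Section sigma_finite_image.
Local Open Scope ereal_scope.
Context d1 d2 (T1 : measurableType d1) (T2 : measurableType d2).
Context (R : realType) (mu : {sigma_finite_measure set T1 -> \bar R}).
Context (f : T1 -> T2) (g : T2 -> T1).

Definition sigma_finite_image of measurable_fun [set: T1] f &
    measurable_fun [set: T2] g & cancel f g : set T2 -> \bar R :=
  pushforward mu f.

Variables (mf : measurable_fun [set: T1] f) (mg : measurable_fun [set: T2] g).
Variable fK : cancel f g.

Local Notation image := (sigma_finite_image mf mg fK).

Let image0 : image set0 = 0.
Proof. by rewrite /image /pushforward preimage_set0 measure0. Qed.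

Let image_ge0 A : 0 <= image A.
Proof. exact: measure_ge0. Qed.

Let image_sigma_additive : semi_sigma_additive image.
Proof.
move=> F mF tF mUF; rewrite /image /pushforward preimage_bigcup.
apply: measure_semi_sigma_additive.
- by move=> n; rewrite -[X in measurable X]setTI; exact: mf.
- apply/trivIsetP => /= i j _ _ ij; rewrite -preimage_setI.
  by move/trivIsetP : tF => /(_ _ _ _ _ ij) ->//; rewrite preimage_set0.
- by rewrite -preimage_bigcup -[X in measurable X]setTI; exact: mf.
Qed.

HB.instance Definition _ :=
  isMeasure.Build _ _ _ image image0 image_ge0 image_sigma_additive.

Let image_sigma_finite : sigma_finite setT image.
Proof.
have [F FT mF] := sigma_finiteT mu.
exists (fun k => g @^-1` F k).
  by rewrite -preimage_bigcup -FT preimage_setT.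
move=> k; have [mFk Fk] := mF k; split.
  by rewrite -[X in measurable X]setTI; apply: mg.
rewrite /image /pushforward -comp_preimage (_ : g \o f = id) ?preimage_id//.
by apply/funext => x /=; rewrite fK.
Qed.

HB.instance Definition _ :=
  Measure_isSigmaFinite.Build _ _ _ image image_sigma_finite.

End sigma_finite_image.

Section lebesgue_measure_vec.
Variable R : realType.

Definition consv m (p : measurableTypeR R * vec R m) : vec R m.+1 :=
  [tuple of p.1 :: p.2].

Definition unconsv m (x : vec R m.+1) : measurableTypeR R * vec R m :=
  (thead x, [tuple of behead x]).

Lemma consvK m : cancel (@consv m) (@unconsv m).
Proof. by case=> a x; rewrite /unconsv theadE; congr pair; exact: val_inj. Qed.

Lemma measurable_consv m : measurable_fun setT (@consv m).
Proof. exact: measurable_cons. Qed.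

Lemma measurable_unconsv m : measurable_fun setT (@unconsv m).
Proof.
apply: measurable_fun_pair; last exact: measurable_behead.
exact: (@measurable_tnth _ _ m.+1 ord0).
Qed.

(* Built coordinate by coordinate, along [R * R^m = R^(m + 1)]. *)
Fixpoint leb m : {sigma_finite_measure set (vec R m) -> \bar R} :=
  match m with
  | 0 => \d_([tuple] : vec R 0)
  | m'.+1 =>
      sigma_finite_image
        (sigma_finite_prod lebesgue_measure (leb m'))
        (@measurable_consv m') (@measurable_unconsv m') (@consvK m')
  end.

End lebesgue_measure_vec.

Section quaternion_Fourier.
Variable R : realType.

Definition measurable_quat m (f : vec R m -> quat R) :=
  [/\ measurable_fun [set: vec R m] (fun x => qre (f x)),
      measurable_fun [set: vec R m] (fun x => qim_i (f x)),
      measurable_fun [set: vec R m] (fun x => qim_j (f x)) &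
      measurable_fun [set: vec R m] (fun x => qim_k (f x))].

Definition integralq m (f : vec R m -> quat R) : quat R :=
  Quat (\int[leb R m]_x qre (f x)) (\int[leb R m]_x qim_i (f x))
       (\int[leb R m]_x qim_j (f x)) (\int[leb R m]_x qim_k (f x)).

Definition normq m (p : \bar R) (f : vec R m -> quat R) : \bar R :=
  Lnorm (leb R m) p (fun x => (absq (f x))%:E).

Definition norm2 m (f : vec R m -> quat R) : R := fine (normq 2%:E f).

Definition inL m (p : \bar R) (f : vec R m -> quat R) :=
  measurable_quat f /\ (normq p f < +oo)%E.

(* [e^(-2 i pi u.x)], resp. [e^(-2 j pi v.y)], for [e] the unit [i],
   resp. [j]. *)
Definition charq (e : quat R) m (u x : vec R m) : quat R :=
  expq e (- (2 * pi * dotv u x)).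

(* The integral formula, meaningful for [f] in [L^1]. *)
Definition qft_integral n (f : vec R (n + n) -> quat R) (w : vec R (n + n)) :=
  integralq (fun z => charq (unit_i R) (fstv w) (fstv z) * f z
                      * charq (unit_j R) (sndv w) (sndv z)).

(* [g] is (a representative of) the extension to [L^2] by continuity of
   [qft_integral], evaluated at [f]. *)
Definition is_qft n (f g : vec R (n + n) -> quat R) :=
  inL 2%:E g /\
  exists F : nat -> vec R (n + n) -> quat R,
    [/\ forall k, inL 1%:E (F k) /\ inL 2%:E (F k),
        normq 2%:E (fun z => F k z - f z) @[k --> \oo] --> 0%E &
        normq 2%:E (fun w => qft_integral (F k) w - g w) @[k --> \oo] --> 0%E].

(* The value is a choice of representative in a class modulo a.e. equality. *)
Definition qft n (f : vec R (n + n) -> quat R) : vec R (n + n) -> quat R :=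
  xget (fun=> 0) [set g | is_qft f g].

End quaternion_Fourier.

Section shearlets.
Variables (R : realType) (n' : nat).

(* The half-dimension is positive, and [n + n] is convertible to
   [1 + (n + n).-1]. *)
Local Notation n := n'.+1.

Definition dilation_mx (a : R) : 'M[R]_(n + n) :=
  @block_mx R 1 (n + n).-1 1 (n + n).-1
    a%:M 0 0 (Num.sg a * `|a| `^ ((n + n)%:R^-1))%:M.

Definition shear_mx (s : vec R (n + n).-1) : 'M[R]_(n + n) :=
  @block_mx R 1 (n + n).-1 1 (n + n).-1
    1%:M (\row_j (tnth s j : R)) 0 1%:M.

Definition shearlet (psi : vec R (n + n) -> quat R)
    (a : R) (s : vec R (n + n).-1) (t : vec R (n + n)) :
    vec R (n + n) -> quat R :=
  fun x => `|a| `^ ((4 * n)%:R^-1 - 1) *: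
    psi (mulmxv (invmx (dilation_mx a))
          (mulmxv (invmx (shear_mx s)) (subv x t))).

Definition starq (psi : vec R (n + n) -> quat R) : vec R (n + n) -> quat R :=
  fun x => conjq (psi (oppv x)).

(* The hyperplane [l_1 = 0], where the division yields 0 by convention, is
   negligible. *)
Definition admissibility_constant (psi : vec R (n + n) -> quat R) : \bar R :=
  (\int[leb R (n + n)]_l
    (absq (qft (starq psi) l) ^+ 2 / `|thead l : R| ^+ (n + n))%:E)%E.

Definition admissible (psi : vec R (n + n) -> quat R) :=
  inL 2%:E psi /\ (admissibility_constant psi < +oo)%E.

Definition shearlet_transform (psi f : vec R (n + n) -> quat R)
    (a : R) (s : vec R (n + n).-1) (t : vec R (n + n)) : quat R :=
  integralq (fun x => f x * conjq (shearlet psi a s t x)).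

(* [R^*] is replaced with [R]; the points with [a = 0], where [mu_density] is
   0 by convention, are excluded in [entropy]. *)
Notation params := (measurableTypeR R * vec R (n + n).-1 * vec R (n + n))%type.

Definition leb_params : {sigma_finite_measure set params -> \bar R} :=
  sigma_finite_prod
    (sigma_finite_prod lebesgue_measure (leb R (n + n).-1)) (leb R (n + n)).

Definition mu_density (z : params) : R := (`|z.1.1 : R| ^+ (n + n).+1)^-1.

Definition shearlet_measure (A : set params) : \bar R :=
  (\int[leb_params]_(z in A) (mu_density z)%:E)%E.

Lemma mu_density_ge0 z : 0 <= mu_density z.
Proof. by rewrite invr_ge0 exprn_ge0. Qed.

Lemma measurable_mu_density : measurable_fun [set: params] mu_density.
Proof.
rewrite (_ : mu_density = (@powR R ^~ (-1))
    \o (fun x : R => `|x| ^+ (n + n).+1) \o (fun z : params => z.1.1)); last first.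
  by apply/funext => z /=; rewrite powR_inv1.
apply: measurableT_comp; last exact: measurableT_comp.
apply: measurableT_comp; first exact: measurable_powR.
apply: measurable_funX; exact: normr_measurable.
Qed.

Let mu0 : shearlet_measure set0 = 0%E.
Proof. exact: integral_set0. Qed.

Let mu_ge0 A : (0 <= shearlet_measure A)%E.
Proof. by apply: integral_ge0 => z _; rewrite lee_fin mu_density_ge0. Qed.

Let mu_sigma_additive : semi_sigma_additive shearlet_measure.
Proof.
move=> F mF tF mUF; rewrite /shearlet_measure ge0_integral_bigcup//.
- apply: is_cvg_ereal_nneg_natsum_cond => k _ _.
  by apply: integral_ge0 => z _; rewrite lee_fin mu_density_ge0.
- apply: measurable_funTS; apply/measurable_EFinP.
  exact: measurable_mu_density.
- by move=> z _; rewrite lee_fin mu_density_ge0.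
Qed.

HB.instance Definition _ :=
  isMeasure.Build _ _ _ shearlet_measure mu0 mu_ge0 mu_sigma_additive.

(* [ln 0 = 0], so that [0 ln 0 = 0]. *)
Definition entropy (P : R -> vec R (n + n).-1 -> vec R (n + n) -> R) : \bar R :=
  (- \int[shearlet_measure]_(z in [set z : params | (z.1.1 : R) != 0%R])
      (ln (P z.1.1 z.1.2 z.2) * P z.1.1 z.1.2 z.2)%:E)%E.

End shearlets.

(* Main.v *)
From HB Require Import structures.
Require Import Defs.
From mathcomp Require Import all_boot all_order all_algebra.
From mathcomp Require Import ring lra.
From mathcomp Require Import all_classical all_reals all_analysis.
From mathcomp Require Import measurable_realfun.

(** Why the inequality holds.  Let [P (a, s, t)] be the squared modulus of the
    shearlet coefficient and [K = |f|^2 |psi|^2], with L^2 norms.  By the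
    Cauchy-Schwarz inequality [P <= K] ([coefficient_le]), hence
    [P ln P <= P ln K] pointwise, and integrating against [mu],
    [E (P) >= - ln K * \int P dmu].  It remains to prove the Plancherel identity
    of the shearlet transform, [\int P dmu = C_psi |f|^2] ([total_energy]).

    The two-sided transform is linear over the quaternions on neither side, so
    most of the work is done with the right-sided one,
    [Rf (xi) = \int f (x) e^(- 2 pi j xi.x) dx], which is linear for the left
    multiplications.  It is related to the two-sided transform by the splitting
    of quaternions along [q -> i q j] ([qft_integral_twosided]): the two-sided
    transform of [f] is a combination [twosided (Rf)] of [Rf] and of its
    reflection in the first half of the frequencies.

    The commutation hypotheses on the window [psi] translate as follows.  The
    first one puts its two-sided transform in the plane spanned by [1] and [j];
    the second one, at [t = 0], makes it even in the first half of the
    frequencies.  Then [R psi] coincides with the two-sided transform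
    ([window_transform]), [psi] itself takes its values in that plane
    ([window_comm]), and on that plane quaternionic conjugation is conjugation
    by [i].  As a consequence the transform of [psi^*] has the modulus of
    [R psi], and [C_psi = \int |R psi (l)|^2 / |l_1|^(2n) dl]
    ([admissibility_constantE]).

    By Parseval's identity and the covariance of [R] under translations,
    dilations and shears, the coefficient at [(a, s, t)] is the transform at
    [- t] of the product of [Rf] and of the conjugate of a dilated and sheared
    [R psi]; commutation with [j] is what lets the character move to the right
    of that product ([coefficient_fourier]).  Plancherel's identity in [t],
    Tonelli's theorem and, for each frequency [xi] with [xi_1 <> 0], an affine
    change of the variables [(a, s)] then give [C_psi |f|^2]
    ([total_multiplier_energy], [total_coefficient_energy]).

    Plancherel's identity for [R] is obtained on the line from the Poisson
    kernel ([integral_cos_transform], [plancherel_real]), in every dimension by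
    induction on the number of coordinates ([plancherel]), and on L^2 by
    completeness ([riesz_fischer], [L2_rfourier_exists]). *)

Set Implicit Arguments.
Unset Strict Implicit.
Unset Printing Implicit Defensive.

Import Order.TTheory GRing.Theory Num.Theory.
Import numFieldNormedType.Exports.

Local Open Scope classical_set_scope.
Local Open Scope ring_scope.

(** * Quaternions and quaternion-valued integrals *)

Section quaternions.
Context {R : realType}.
Implicit Types p q r : quat R.

Definition normsq q : R :=
  qre q ^+ 2 + qim_i q ^+ 2 + qim_j q ^+ 2 + qim_k q ^+ 2.

Lemma quat_ext p q : qre p = qre q -> qim_i p = qim_i q ->
  qim_j p = qim_j q -> qim_k p = qim_k q -> p = q.
Proof. by case: p => ? ? ? ?; case: q => ? ? ? ? /= -> -> -> ->. Qed.

Lemma normsq_ge0 q : 0 <= normsq q.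
Proof. by rewrite /normsq !addr_ge0// sqr_ge0. Qed.

Lemma absq_sqr q : absq q ^+ 2 = normsq q.
Proof. by rewrite /absq sqr_sqrtr//; exact: normsq_ge0. Qed.

Lemma absqE q : absq q = Num.sqrt (normsq q). Proof. by []. Qed.

Lemma absq_ge0 q : 0 <= absq q. Proof. exact: sqrtr_ge0. Qed.

Lemma normsqM p q : normsq (p * q) = normsq p * normsq q.
Proof. by rewrite /normsq /=; ring. Qed.

Lemma normsqZ (a : R) q : normsq (a *: q) = a ^+ 2 * normsq q.
Proof. by rewrite /normsq /=; ring. Qed.

Lemma normsqN q : normsq (- q) = normsq q.
Proof. by rewrite /normsq /=; ring. Qed.

Lemma normsq_conj q : normsq (conjq q) = normsq q.
Proof. by rewrite /normsq /=; ring. Qed.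

Lemma normsq0 : normsq 0 = 0. Proof. by rewrite /normsq /=; ring. Qed.

Lemma normsq_eq0 q : normsq q = 0 -> q = 0.
Proof.
move=> q0; have : [/\ qre q ^+ 2 = 0, qim_i q ^+ 2 = 0, qim_j q ^+ 2 = 0 &
    qim_k q ^+ 2 = 0].
  move: q0; rewrite /normsq => q0.
  have := sqr_ge0 (qre q); have := sqr_ge0 (qim_i q).
  by have := sqr_ge0 (qim_j q); have := sqr_ge0 (qim_k q); split; lra.
move=> [/eqP + /eqP + /eqP + /eqP]; rewrite !sqrf_eq0.
by move=> /eqP ? /eqP ? /eqP ? /eqP ?; exact: quat_ext.
Qed.

Lemma normsqDle p q : normsq (p + q) <= 2 * normsq p + 2 * normsq q.
Proof.
rewrite -subr_ge0 (_ : _ - _ = normsq (p - q)); first exact: normsq_ge0.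
by rewrite /normsq /=; ring.
Qed.

Lemma normsqBle p q : normsq (p - q) <= 2 * normsq p + 2 * normsq q.
Proof. by rewrite -(normsqN q) normsqDle. Qed.

Lemma absqM p q : absq (p * q) = absq p * absq q.
Proof. by rewrite !absqE normsqM sqrtrM// normsq_ge0. Qed.

Lemma absq0 : absq (0 : quat R) = 0.
Proof. by rewrite absqE normsq0 sqrtr0. Qed.

Lemma absqM_le p q : absq (p * q) <= normsq p + normsq q.
Proof.
rewrite absqM -!absq_sqr -subr_ge0.
have -> : absq p ^+ 2 + absq q ^+ 2 - absq p * absq q =
  2^-1 * (absq p - absq q) ^+ 2 + 2^-1 * absq p ^+ 2 + 2^-1 * absq q ^+ 2.
  by field.
by rewrite !addr_ge0// mulr_ge0// ?invr_ge0// sqr_ge0.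
Qed.

Lemma normr_qre_le q : `|qre q| <= absq q.
Proof.
rewrite -sqrtr_sqr absqE ler_wsqrtr// /normsq -!addrA lerDl.
by rewrite !addr_ge0// sqr_ge0.
Qed.

Lemma absqD_le p q : absq (p + q) <= absq p + absq q.
Proof.
rewrite -(@ler_pXn2r _ 2)// ?nnegrE ?addr_ge0 ?absq_ge0//.
rewrite sqrrD !absq_sqr.
have -> : normsq (p + q) = normsq p + qre (p * conjq q) *+ 2 + normsq q.
  by rewrite /normsq /=; ring.
rewrite lerD2r lerD2l lerMn2r /=.
apply: (le_trans (ler_norm _)).
apply: (le_trans (normr_qre_le (p * conjq q))).
by rewrite absqM ler_wpM2l ?absq_ge0// !absqE normsq_conj.
Qed.

Lemma conjqM p q : conjq (p * q) = conjq q * conjq p.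
Proof. by apply: quat_ext => /=; ring. Qed.

Lemma qreM_cyc p q : qre (p * q) = qre (q * p).
Proof. by rewrite /=; ring. Qed.

Lemma qreD p q : qre (p + q) = qre p + qre q. Proof. by []. Qed.

(** A quaternion is determined by the real parts of its left multiples, so
    that identities between integrals reduce to real ones. *)
Lemma qreM_inj p q : (forall c, qre (c * p) = qre (c * q)) -> p = q.
Proof.
move=> pq; apply: quat_ext.
- by have := pq 1; rewrite !mul1r.
- by have := pq (Quat 0 (-1) 0 0) => /=; lra.
- by have := pq (Quat 0 0 (-1) 0) => /=; lra.
- by have := pq (Quat 0 0 0 (-1)) => /=; lra.
Qed.

Lemma normsqE p : normsq p = qre (p * conjq p).
Proof. by rewrite /normsq /=; ring. Qed.

Lemma mulq_conjl p : conjq p * p = (normsq p) *: (1 : quat R).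
Proof. by apply: quat_ext; rewrite /normsq /=; ring. Qed.

Lemma scaleqAl (a : R) p q : a *: (p * q) = (a *: p) * q.
Proof. by apply: quat_ext => /=; ring. Qed.

Lemma scaleqAr (a : R) p q : a *: (p * q) = p * (a *: q).
Proof. by apply: quat_ext => /=; ring. Qed.

End quaternions.

Section measurableq.
Context d (T : measurableType d) (R : realType).
Implicit Types f g : T -> quat R.

Definition measurableq f := [/\ measurable_fun [set: T] (fun x => qre (f x)),
  measurable_fun [set: T] (fun x => qim_i (f x)),
  measurable_fun [set: T] (fun x => qim_j (f x)) &
  measurable_fun [set: T] (fun x => qim_k (f x))].

Lemma measurableq_cst c : measurableq (fun=> c).
Proof. by split; exact: measurable_cst. Qed.

Lemma measurableqD f g : measurableq f -> measurableq g ->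
  measurableq (fun x => f x + g x).
Proof. by move=> [? ? ? ?] [? ? ? ?]; split; exact: measurable_funD. Qed.

Lemma measurableqN f : measurableq f -> measurableq (fun x => - f x).
Proof. by move=> [? ? ? ?]; split; exact: measurable_funN. Qed.

Lemma measurableqB f g : measurableq f -> measurableq g ->
  measurableq (fun x => f x - g x).
Proof. by move=> mf mg; apply: measurableqD => //; exact: measurableqN. Qed.

Lemma measurableqM f g : measurableq f -> measurableq g ->
  measurableq (fun x => f x * g x).
Proof.
move=> [? ? ? ?] [? ? ? ?]; split => /=.
- by do !(apply: measurable_funB || apply: measurable_funD
    || apply: measurable_funM).
- by do !(apply: measurable_funB || apply: measurable_funD
    || apply: measurable_funM).
- by do !(apply: measurable_funB || apply: measurable_funD
    || apply: measurable_funM).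
- by do !(apply: measurable_funB || apply: measurable_funD
    || apply: measurable_funM).
Qed.

Lemma measurableqZ (u : T -> R) f : measurable_fun [set: T] u ->
  measurableq f -> measurableq (fun x => u x *: f x).
Proof. by move=> ? [? ? ? ?]; split; exact: measurable_funM. Qed.

Lemma measurableq_conj f : measurableq f -> measurableq (fun x => conjq (f x)).
Proof. by move=> [? ? ? ?]; split => //=; exact: measurable_funN. Qed.

Lemma measurable_normsq f : measurableq f ->
  measurable_fun [set: T] (fun x => normsq (f x)).
Proof.
by move=> [? ? ? ?]; do !apply: measurable_funD; exact: measurable_funX.
Qed.

Lemma measurable_absq f : measurableq f ->
  measurable_fun [set: T] (fun x => absq (f x)).
Proof.
move=> mf; have sqrtE : (fun x => absq (f x)) = (@powR R ^~ 2^-1) \o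
    (fun x => normsq (f x)).
  by apply/funext => x /=; rewrite powR12_sqrt ?normsq_ge0.
rewrite sqrtE; apply: measurableT_comp; first exact: measurable_powR.
exact: measurable_normsq.
Qed.

Lemma measurableq_re f : measurableq f ->
  measurable_fun [set: T] (fun x => qre (f x)).
Proof. by case. Qed.

Lemma measurableq_if (b : T -> bool) f : measurable_fun [set: T] b ->
  measurableq f -> measurableq (fun x => if b x then f x else 0).
Proof.
move=> mb [? ? ? ?].
by split; [under eq_fun do rewrite (fun_if (@qre R))
  |under eq_fun do rewrite (fun_if (@qim_i R))
  |under eq_fun do rewrite (fun_if (@qim_j R))
  |under eq_fun do rewrite (fun_if (@qim_k R))]; exact: measurable_fun_ifT.
Qed.

End measurableq.

Lemma measurableq_comp d d' (T : measurableType d) (T' : measurableType d')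
    (R : realType) (f : T -> quat R) (h : T' -> T) :
  measurable_fun [set: T'] h -> measurableq f -> measurableq (fun x => f (h x)).
Proof.
move=> mh [mr mi mj mk].
by split; [exact: (measurableT_comp mr)|exact: (measurableT_comp mi)
  |exact: (measurableT_comp mj)|exact: (measurableT_comp mk)].
Qed.

Section quaternion_integral.
Context d (T : measurableType d) (R : realType)
  (mu : {measure set T -> \bar R}).
Implicit Types f g : T -> quat R.

Definition intq f : quat R :=
  Quat (\int[mu]_x qre (f x)) (\int[mu]_x qim_i (f x))
       (\int[mu]_x qim_j (f x)) (\int[mu]_x qim_k (f x)).

Definition integrableq f :=
  measurableq f /\ (\int[mu]_x (absq (f x))%:E < +oo)%E.

(** The square of the L^2 norm.  As an extended real it obeys Tonelli's theorem
    and monotone convergence without case distinctions on its finiteness. *)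
Definition energy f : \bar R := (\int[mu]_x (normsq (f x))%:E)%E.

Definition finite_energy f := measurableq f /\ (energy f < +oo)%E.

Lemma integrable_le (u v : T -> R) : measurable_fun [set: T] u ->
  measurable_fun [set: T] v ->
  (forall x, `|u x| <= v x) -> (\int[mu]_x (v x)%:E < +oo)%E ->
  mu.-integrable setT (EFin \o u).
Proof.
move=> mu_ mv uv vfin; apply/integrableP; split; first exact/measurable_EFinP.
apply: le_lt_trans vfin; apply: ge0_le_integral => //.
- by apply: measurableT_comp => //; exact/measurable_EFinP.
- exact/measurable_EFinP.
- by move=> x _ /=; rewrite lee_fin.
Qed.

Lemma integrableq_qre f c : integrableq f ->
  mu.-integrable setT (EFin \o (fun x => qre (c * f x))).
Proof.
move=> [mf ffin].
have mcf : measurableq (fun x => c * f x).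
  by apply: measurableqM => //; exact: measurableq_cst.
apply: (@integrable_le _ (fun x => absq c * absq (f x))).
- exact: measurableq_re.
- by apply: measurable_funM; [exact: measurable_cst|exact: measurable_absq].
- by move=> x; rewrite -absqM; exact: normr_qre_le.
- under eq_integral do rewrite EFinM.
  rewrite ge0_integralZl//.
  + by rewrite lte_mul_pinfty ?lee_fin ?absq_ge0.
  + by apply/measurable_EFinP; exact: measurable_absq.
  + by move=> x _; rewrite lee_fin absq_ge0.
  + by rewrite lee_fin absq_ge0.
Qed.

Lemma integrableq_comp f : integrableq f ->
  [/\ mu.-integrable setT (EFin \o (fun x => qre (f x))),
      mu.-integrable setT (EFin \o (fun x => qim_i (f x))),
      mu.-integrable setT (EFin \o (fun x => qim_j (f x))) &
      mu.-integrable setT (EFin \o (fun x => qim_k (f x)))].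
Proof.
move=> fi; split.
- have := integrableq_qre 1 fi.
  by apply: eq_integrable => //= x _; congr EFin; ring.
- have := integrableq_qre (Quat 0 (-1) 0 0) fi.
  by apply: eq_integrable => //= x _; congr EFin; ring.
- have := integrableq_qre (Quat 0 0 (-1) 0) fi.
  by apply: eq_integrable => //= x _; congr EFin; ring.
- have := integrableq_qre (Quat 0 0 0 (-1)) fi.
  by apply: eq_integrable => //= x _; congr EFin; ring.
Qed.

Lemma qreM_intq c f : integrableq f ->
  qre (c * intq f) = \int[mu]_x qre (c * f x).
Proof.
move=> fi; have [i0 i1 i2 i3] := integrableq_comp fi.
have iZ (a : R) (u : T -> R) : mu.-integrable setT (EFin \o u) ->
    mu.-integrable setT (EFin \o (fun x => a * u x)).
  move=> iu; have := integrableZl measurableT a iu.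
  by apply: eq_integrable => // x _ /=.
rewrite /=.
rewrite RintegralB//; first last.
- exact: iZ.
- have := integrableB measurableT (integrableB measurableT (iZ (qre c) _ i0)
    (iZ (qim_i c) _ i1)) (iZ (qim_j c) _ i2).
  by apply: eq_integrable => // x _ /=.
rewrite RintegralB//; [|exact: (integrableB measurableT (iZ (qre c) _ i0)
    (iZ (qim_i c) _ i1))|exact: iZ].
by rewrite RintegralB; [rewrite !RintegralZl|by []|exact: iZ|exact: iZ].
Qed.

Lemma integrableqM c f : integrableq f -> integrableq (fun x => c * f x).
Proof.
move=> [mf fi]; split.
  by apply: measurableqM => //; exact: measurableq_cst.
under eq_integral do rewrite absqM EFinM.
rewrite ge0_integralZl//.
- by rewrite lte_mul_pinfty// lee_fin absq_ge0.
- by apply/measurable_EFinP; exact: measurable_absq.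
- by move=> x _; rewrite lee_fin absq_ge0.
- by rewrite lee_fin absq_ge0.
Qed.

(** Bounded factors, such as characters, preserve integrability. *)
Lemma le_integrableq f g : measurableq f -> (forall x, absq (f x) <= absq (g x)) ->
  integrableq g -> integrableq f.
Proof.
move=> mf fg [mg gi]; split => //; apply: le_lt_trans gi.
apply: ge0_le_integral => //.
- by move=> x _; rewrite lee_fin absq_ge0.
- by apply/measurable_EFinP; exact: measurable_absq.
- by apply/measurable_EFinP; exact: measurable_absq.
- by move=> x _; rewrite lee_fin.
Qed.

Lemma integrableqD f g : integrableq f -> integrableq g ->
  integrableq (fun x => f x + g x).
Proof.
move=> [mf fi] [mg gi]; split; first exact: measurableqD.
apply: (@le_lt_trans _ _ (\int[mu]_x ((absq (f x))%:E + (absq (g x))%:E))%E).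
  apply: ge0_le_integral => //.
  - by move=> x _; rewrite lee_fin absq_ge0.
  - by apply/measurable_EFinP; apply: measurable_absq; exact: measurableqD.
  - by apply: emeasurable_funD; apply/measurable_EFinP; exact: measurable_absq.
  - by move=> x _; rewrite -EFinD lee_fin absqD_le.
rewrite ge0_integralD//; first exact: lte_add_pinfty.
- by move=> x _; rewrite lee_fin absq_ge0.
- by apply/measurable_EFinP; exact: measurable_absq.
- by move=> x _; rewrite lee_fin absq_ge0.
- by apply/measurable_EFinP; exact: measurable_absq.
Qed.

Lemma intqM c f : integrableq f -> intq (fun x => c * f x) = c * intq f.
Proof.
move=> fi; apply: qreM_inj => e; rewrite qreM_intq; last exact: integrableqM.
by rewrite mulrA qreM_intq//; apply: eq_Rintegral => x _; rewrite mulrA.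
Qed.

Lemma integrableqMr c f : integrableq f -> integrableq (fun x => f x * c).
Proof.
move=> [mf fi]; apply: (@le_integrableq _ (fun x => c * f x)).
- by apply: measurableqM => //; exact: measurableq_cst.
- by move=> x; rewrite !absqM mulrC.
- exact: integrableqM.
Qed.

Lemma intqMr c f : integrableq f -> intq (fun x => f x * c) = intq f * c.
Proof.
move=> fi; apply: qreM_inj => e; rewrite qreM_intq; last exact: integrableqMr.
rewrite mulrA [RHS]qreM_cyc mulrA qreM_intq//; apply: eq_Rintegral => x _.
by rewrite mulrA [LHS]qreM_cyc mulrA.
Qed.

Lemma intqD f g : integrableq f -> integrableq g ->
  intq (fun x => f x + g x) = intq f + intq g.
Proof.
move=> fi gi; apply: qreM_inj => e; rewrite qreM_intq; last exact: integrableqD.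
rewrite mulrDr qreD !qreM_intq// -RintegralD//; try exact: integrableq_qre.
by apply: eq_Rintegral => x _; rewrite mulrDr.
Qed.

Lemma integrableqB f g : integrableq f -> integrableq g ->
  integrableq (fun x => f x - g x).
Proof.
move=> fi gi; have := integrableqD fi (integrableqM (-1) gi).
by under eq_fun do rewrite mulN1r.
Qed.

Lemma intqB f g : integrableq f -> integrableq g ->
  intq (fun x => f x - g x) = intq f - intq g.
Proof.
move=> fi gi; rewrite -(mulN1r (intq g)) -intqM// -intqD//; last first.
  exact: integrableqM.
by congr intq; apply/funext => x; rewrite mulN1r.
Qed.

Lemma eq_intq f g : f =1 g -> intq f = intq g.
Proof. by move=> fg; congr intq; apply/funext. Qed.

Lemma ae_eq_intq f g : measurableq f -> measurableq g ->
  {ae mu, forall x, f x = g x} -> intq f = intq g.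
Proof.
move=> [? ? ? ?] [? ? ? ?] fg; rewrite /intq /Rintegral.
by congr Quat; congr fine; apply: ae_eq_integral => //;
  (try exact/measurable_EFinP); apply: filterS fg => x -> .
Qed.

(** Multiplied by the conjugate of the integral, the integrand has a real part
    whose integral is the square of the left-hand side. *)
Lemma absq_intq_le f : integrableq f ->
  ((absq (intq f))%:E <= \int[mu]_x (absq (f x))%:E)%E.
Proof.
move=> fi; have [fi1 fi2] := fi.
have ifin : (\int[mu]_x (absq (f x))%:E)%E \is a fin_num.
  by rewrite ge0_fin_numE// integral_ge0// => x _; rewrite lee_fin absq_ge0.
have [->|I0] := eqVneq (absq (intq f)) 0.
  by apply: integral_ge0 => x _; rewrite lee_fin absq_ge0.
have {}I0 : 0 < absq (intq f) by rewrite lt_neqAle eq_sym I0 absq_ge0.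
rewrite -(fineK ifin) lee_fin -(@ler_pM2l _ (absq (intq f)))//.
rewrite -expr2 absq_sqr normsqE qreM_cyc qreM_intq//.
have cI : absq (conjq (intq f)) = absq (intq f) by rewrite !absqE normsq_conj.
have iab : mu.-integrable setT (EFin \o (fun x => absq (f x))).
  apply: (@integrable_le _ (fun x => absq (f x))) => //.
  - exact: measurable_absq.
  - exact: measurable_absq.
  - by move=> x; rewrite ger0_norm ?absq_ge0.
rewrite -[X in _ <= X]RintegralZl//.
apply: le_Rintegral => //; first exact: integrableq_qre.
  have := integrableZl measurableT (absq (intq f)) iab.
  by apply: eq_integrable => // x _ /=; rewrite EFinM.
move=> x _; apply: (le_trans (ler_norm _)); apply: (le_trans (normr_qre_le _)).
by rewrite absqM cI.
Qed.

Lemma le_integral_EFin (u v : T -> R) : measurable_fun [set: T] u ->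
  measurable_fun [set: T] v -> (forall x, 0 <= u x) -> (forall x, u x <= v x) ->
  (\int[mu]_x (u x)%:E <= \int[mu]_x (v x)%:E)%E.
Proof.
move=> mu_ mv u0 uv; apply: ge0_le_integral => //.
- by move=> x _; rewrite lee_fin.
- exact/measurable_EFinP.
- exact/measurable_EFinP.
- by move=> x _; rewrite lee_fin.
Qed.

Lemma ge0_integralD_EFin (u v : T -> R) : measurable_fun [set: T] u ->
  measurable_fun [set: T] v -> (forall x, 0 <= u x) -> (forall x, 0 <= v x) ->
  (\int[mu]_x (u x + v x)%:E = \int[mu]_x (u x)%:E + \int[mu]_x (v x)%:E)%E.
Proof.
move=> mu_ mv u0 v0; under eq_integral do rewrite EFinD.
rewrite ge0_integralD//.
- by move=> x _; rewrite lee_fin.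
- exact/measurable_EFinP.
- by move=> x _; rewrite lee_fin.
- exact/measurable_EFinP.
Qed.

Lemma ge0_integralZ_EFin (c : R) (u : T -> R) : measurable_fun [set: T] u ->
  (forall x, 0 <= u x) -> 0 <= c ->
  (\int[mu]_x (c * u x)%:E = c%:E * \int[mu]_x (u x)%:E)%E.
Proof.
move=> mu_ u0 c0; under eq_integral do rewrite EFinM.
rewrite ge0_integralZl//.
- exact/measurable_EFinP.
- by move=> x _; rewrite lee_fin.
Qed.

Lemma energy_ge0 f : (0 <= energy f)%E.
Proof. by apply: integral_ge0 => x _; rewrite lee_fin normsq_ge0. Qed.

Lemma le_energy f g : measurableq f -> measurableq g ->
  (forall x, normsq (f x) <= normsq (g x)) -> (energy f <= energy g)%E.
Proof.
move=> mf mg fg; apply: le_integral_EFin => //; try exact: measurable_normsq.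
by move=> x; exact: normsq_ge0.
Qed.

Lemma ae_eq_energy f g : measurableq f -> measurableq g ->
  {ae mu, forall x, f x = g x} -> energy f = energy g.
Proof.
move=> mf mg fg; apply: ae_eq_integral => //.
- by apply/measurable_EFinP; exact: measurable_normsq.
- by apply/measurable_EFinP; exact: measurable_normsq.
- by apply: filterS fg => x ->.
Qed.

Lemma energy_eq0 f : measurableq f -> energy f = 0%E ->
  {ae mu, forall x, f x = 0}.
Proof.
move=> mf f0; have mE : measurable_fun [set: T] (fun x => (normsq (f x))%:E).
  by apply/measurable_EFinP; exact: measurable_normsq.
have /(ae_eq_integral_abs mu measurableT mE) :
    (\int[mu]_x `|(normsq (f x))%:E| = 0)%E.
  rewrite -[RHS]f0; apply: eq_integral => x _.
  by rewrite gee0_abs// lee_fin normsq_ge0.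
apply: filterS => x /(_ I) [] fx; exact: normsq_eq0.
Qed.

Lemma ae0_energy f : measurableq f -> {ae mu, forall x, f x = 0} ->
  energy f = 0%E.
Proof.
move=> mf f0; have -> : energy f = energy (fun=> 0).
  by apply: ae_eq_energy => //; exact: measurableq_cst.
by rewrite /energy; under eq_integral do rewrite normsq0; rewrite integral0.
Qed.

Lemma energyM c f : measurableq f ->
  energy (fun x => c * f x) = ((normsq c)%:E * energy f)%E.
Proof.
move=> mf; rewrite /energy; under eq_integral do rewrite normsqM.
rewrite ge0_integralZ_EFin ?normsq_ge0//; first exact: measurable_normsq.
by move=> x; exact: normsq_ge0.
Qed.

Lemma energyMr c f : measurableq f ->
  energy (fun x => f x * c) = ((normsq c)%:E * energy f)%E.
Proof.
move=> mf; rewrite -energyM//; apply: eq_integral => x _.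
by rewrite !normsqM mulrC.
Qed.

(** Weaker than the triangle inequality, but valid for infinite energies. *)
Lemma energyD_le f g : measurableq f -> measurableq g ->
  (energy (fun x => f x + g x)%R <= 2%:E * energy f + 2%:E * energy g)%E.
Proof.
move=> mf mg; have mf2 := measurable_normsq mf.
have mg2 := measurable_normsq mg.
rewrite /energy -!ge0_integralZ_EFin//; try by move=> x; exact: normsq_ge0.
rewrite -ge0_integralD_EFin//.
- apply: le_integral_EFin => //.
  + by apply: measurable_normsq; exact: measurableqD.
  + by apply: measurable_funD; exact: measurable_funM.
  + by move=> x; exact: normsq_ge0.
  + by move=> x; exact: normsqDle.
- exact: measurable_funM.
- exact: measurable_funM.
- by move=> x; rewrite mulr_ge0// normsq_ge0.
- by move=> x; rewrite mulr_ge0// normsq_ge0.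
Qed.

Lemma energyN f : energy (fun x => - f x) = energy f.
Proof. by apply: eq_integral => x _; rewrite normsqN. Qed.

Lemma energyB_le f g : measurableq f -> measurableq g ->
  (energy (fun x => f x - g x)%R <= 2%:E * energy f + 2%:E * energy g)%E.
Proof.
move=> mf mg; rewrite -(energyN g); apply: energyD_le => //.
exact: measurableqN.
Qed.

Lemma energyBC f g : energy (fun x => f x - g x) = energy (fun x => g x - f x).
Proof. by rewrite -energyN; apply: eq_integral => x _; rewrite opprB. Qed.

Lemma energy_fin f : finite_energy f -> energy f \is a fin_num.
Proof. by move=> [_ ?]; rewrite ge0_fin_numE// energy_ge0. Qed.

Lemma finite_energyD f g : finite_energy f -> finite_energy g ->
  finite_energy (fun x => f x + g x).
Proof.
move=> [mf ef] [mg eg]; split; first exact: measurableqD.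
apply: (le_lt_trans (energyD_le mf mg)).
by apply: lte_add_pinfty; rewrite lte_mul_pinfty// ?lee_fin.
Qed.

Lemma finite_energyM c f : finite_energy f -> finite_energy (fun x => c * f x).
Proof.
move=> [mf ef]; split.
  by apply: measurableqM => //; exact: measurableq_cst.
by rewrite energyM// lte_mul_pinfty// lee_fin normsq_ge0.
Qed.

Lemma finite_energyN f : finite_energy f -> finite_energy (fun x => - f x).
Proof. by move=> [mf ef]; split; [exact: measurableqN|rewrite energyN]. Qed.

Lemma finite_energyB f g : finite_energy f -> finite_energy g ->
  finite_energy (fun x => f x - g x).
Proof. by move=> ef eg; apply: finite_energyD => //; exact: finite_energyN. Qed.

Lemma le_finite_energy f g : measurableq f ->
  (forall x, normsq (f x) <= normsq (g x)) -> finite_energy g -> finite_energy f.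
Proof.
by move=> mf fg [mg eg]; split => //; apply: le_lt_trans eg; exact: le_energy.
Qed.

Lemma integrableq_mul f g : finite_energy f -> finite_energy g ->
  integrableq (fun x => f x * g x).
Proof.
move=> [mf ef] [mg eg]; split; first exact: measurableqM.
apply: (@le_lt_trans _ _ (energy f + energy g)%E); last exact: lte_add_pinfty.
rewrite /energy -ge0_integralD_EFin; try exact: measurable_normsq;
  try by move=> x; exact: normsq_ge0.
apply: le_integral_EFin.
- by apply: measurable_absq; exact: measurableqM.
- by apply: measurable_funD; exact: measurable_normsq.
- by move=> x; exact: absq_ge0.
- by move=> x; exact: absqM_le.
Qed.

Lemma finite_energy_conj f : finite_energy f ->
  finite_energy (fun x => conjq (f x)).
Proof.
move=> [mf ef]; apply: (@le_finite_energy _ f) => //.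
  exact: measurableq_conj.
by move=> x; rewrite normsq_conj.
Qed.

Definition innerq f g := intq (fun x => f x * conjq (g x)).

Lemma integrableq_inner f g : finite_energy f -> finite_energy g ->
  integrableq (fun x => f x * conjq (g x)).
Proof. by move=> ? ?; apply: integrableq_mul => //; exact: finite_energy_conj. Qed.

Lemma energy_inner f : finite_energy f -> fine (energy f) = qre (innerq f f).
Proof. by move=> ef; rewrite /innerq /= /Rintegral; under [in RHS]eq_integral do
  rewrite -[X in X%:E]/(qre (f _ * conjq (f _))) -normsqE. Qed.

Lemma fine_energyD f g : finite_energy f -> finite_energy g ->
  fine (energy (fun x => f x + g x)) =
  fine (energy f) + fine (energy g) + 2 * qre (innerq f g).
Proof.
move=> ef eg; have efg := finite_energyD ef eg.
rewrite !energy_inner//.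
have -> : innerq (fun x => f x + g x) (fun x => f x + g x) =
    (innerq f f + innerq f g) + (innerq g f + innerq g g).
  rewrite /innerq -!intqD; try exact: integrableq_inner;
    try by apply: integrableqD; exact: integrableq_inner.
  apply: eq_intq => x.
  by rewrite -!mulrDr -!mulrDl; congr (_ * _); apply: quat_ext => /=; ring.
have fgC : qre (innerq f g) = qre (innerq g f).
  by apply: eq_Rintegral => x _ /=; ring.
move: fgC.
by move: (innerq f f) (innerq f g) (innerq g f) (innerq g g) => a b c e /=; lra.
Qed.

(** Polarization: the quaternion-valued inner product is determined by the
    energies of sums with left multiples. *)
Lemma qreM_innerq c f g : finite_energy f -> finite_energy g ->
  qre (c * innerq f g) = 2^-1 * (fine (energy (fun x => c * f x + g x))
    - normsq c * fine (energy f) - fine (energy g)).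
Proof.
move=> ef eg; have ecf := finite_energyM c ef.
rewrite fine_energyD// energyM; last by case: ef.
rewrite fineM// ?energy_fin// {2}/innerq; under eq_intq do rewrite -mulrA.
by rewrite intqM; [rewrite -/(innerq f g) /=; field|exact: integrableq_inner].
Qed.

(** The energy of [t (conj I) f + g] is a nonnegative polynomial of degree at
    most two in [t]. *)
Lemma cauchy_schwarz f g : finite_energy f -> finite_energy g ->
  normsq (innerq f g) <= fine (energy f) * fine (energy g).
Proof.
move=> ef eg; set I := innerq f g; set F := fine _; set G := fine _.
have F0 : 0 <= F by rewrite fine_ge0 ?energy_ge0.
have G0 : 0 <= G by rewrite fine_ge0 ?energy_ge0.
have pol (t : R) : 0 <= t ^+ 2 * normsq I * F + G + 2 * t * normsq I.
  have := @qreM_innerq (t *: conjq I) f g ef eg.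
  rewrite -/I -/F -/G -scaleqAl mulq_conjl normsqZ normsq_conj.
  have -> : qre (t *: (normsq I *: (1 : quat R))) = t * normsq I.
    by rewrite /= mulr1.
  have : 0 <= fine (energy (fun x => t *: conjq I * f x + g x)).
    by rewrite fine_ge0 ?energy_ge0.
  lra.
have I0 := normsq_ge0 I.
have [FE|FN] := eqVneq F 0.
  (* For [F = 0] the polynomial is affine, and this [t] gives it the value [-1]
     unless its slope vanishes. *)
  rewrite FE mul0r; have := pol (- (G + 1) / (2 * normsq I)).
  rewrite FE mulr0 add0r.
  have [->//|NI] := eqVneq (normsq I) 0.
  have -> : 2 * (- (G + 1) / (2 * normsq I)) * normsq I = - (G + 1) by field.
  by lra.
(* The minimum of the polynomial. *)
have := pol (- F^-1).
have -> : (- F^-1) ^+ 2 * normsq I * F + G + 2 * - F^-1 * normsq I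
   = G - normsq I / F by field.
rewrite subr_ge0 ler_pdivrMr ?lt_neqAle 1?eq_sym ?FN//.
by rewrite mulrC.
Qed.

End quaternion_integral.
Arguments energy_ge0 {d T R mu}.

(** * Fubini's theorem for quaternion-valued functions *)

Section parameter_integral.
Context d1 d2 (T1 : measurableType d1) (T2 : measurableType d2) (R : realType).
Context (m2 : {sigma_finite_measure set T2 -> \bar R}).

Lemma measurable_Rintegral (u : T1 * T2 -> R) : measurable_fun [set: T1 * T2] u ->
  measurable_fun [set: T1] (fun x => \int[m2]_y u (x, y)).
Proof.
move=> mu_; apply: measurableT_comp => //.
under eq_fun do rewrite integralE.
have mE : measurable_fun [set: T1 * T2] (fun z => (u z)%:E).
  exact/measurable_EFinP.
apply: emeasurable_funB.
  have := @measurable_fun_fubini_tonelli_F _ _ _ _ _ m2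
    ((fun z => (u z)%:E)^\+)%E (measurable_funepos mE) (fun=> funepos_ge0 _ _).
  congr measurable_fun; apply/funext => x; apply: eq_integral => y _.
  by rewrite !funeposE.
have := @measurable_fun_fubini_tonelli_F _ _ _ _ _ m2
  ((fun z => (u z)%:E)^\-)%E (measurable_funeneg mE) (fun=> funeneg_ge0 _ _).
congr measurable_fun; apply/funext => x; apply: eq_integral => y _.
by rewrite !funenegE.
Qed.

Lemma measurableq_intq (f : T1 * T2 -> quat R) : measurableq f ->
  measurableq (fun x => intq m2 (fun y => f (x, y))).
Proof.
move=> [mr mi mj mk]; split.
- exact: (measurable_Rintegral mr).
- exact: (measurable_Rintegral mi).
- exact: (measurable_Rintegral mj).
- exact: (measurable_Rintegral mk).
Qed.

End parameter_integral.

Section fubini_quaternion.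
Context d1 d2 (T1 : measurableType d1) (T2 : measurableType d2) (R : realType).
Context (m1 : {sigma_finite_measure set T1 -> \bar R}).
Context (m2 : {sigma_finite_measure set T2 -> \bar R}).

Lemma Rintegral_swap (u : T1 * T2 -> R) :
  (m1 \x m2)%E.-integrable setT (EFin \o u) ->
  \int[m1]_x \int[m2]_y u (x, y) = \int[m2]_y \int[m1]_x u (x, y).
Proof.
move=> ui; have mE := measurable_int _ ui.
have mu_ : measurable_fun [set: T1 * T2] u by exact/measurable_EFinP.
have swapu : measurable_fun [set: T2 * T1] (fun z => u (z.2, z.1)).
  by apply: (measurableT_comp mu_); exact: measurable_swap.
have E1 : (\int[m1]_x (\int[m2]_y u (x, y))%:E =
    \int[m1]_x \int[m2]_y (u (x, y))%:E)%E.
  apply: ae_eq_integral => //.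
  - by apply/measurable_EFinP; exact: measurable_Rintegral.
  - exact: (measurable_fubini_F ui).
  - apply: filterS (ae_integrable1 ui) => x xi _.
    by rewrite fineK//; exact: (integrable_fin_num measurableT xi).
have E2 : (\int[m2]_y (\int[m1]_x u (x, y))%:E =
    \int[m2]_y \int[m1]_x (u (x, y))%:E)%E.
  apply: ae_eq_integral => //.
  - apply/measurable_EFinP.
    exact: (@measurable_Rintegral _ _ _ _ _ m1 _ swapu).
  - exact: (measurable_fubini_G ui).
  - apply: filterS (ae_integrable2 ui) => y yi _.
    by rewrite fineK//; exact: (integrable_fin_num measurableT yi).
by rewrite /Rintegral E1 E2; congr fine; exact: (Fubini ui).
Qed.

(** Integrability on the product, in the iterated form in which it comes out of
    Tonelli's theorem. *)
Definition integrableq2 (f : T1 * T2 -> quat R) := measurableq f /\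
  (\int[m1]_x \int[m2]_y (absq (f (x, y)))%:E < +oo)%E.

Lemma integrableq2_abs f : integrableq2 f ->
  (m1 \x m2)%E.-integrable setT (fun z => (absq (f z))%:E).
Proof.
move=> [mf fi]; have mE : measurable_fun [set: T1 * T2] (fun z => (absq (f z))%:E).
  by apply/measurable_EFinP; exact: measurable_absq.
apply: (proj2 (integrable12ltyP m1 m2 mE)).
apply: le_lt_trans fi; rewrite le_eqVlt; apply/orP; left; apply/eqP.
apply: eq_integral => x _; apply: eq_integral => y _.
by rewrite /= (ger0_norm (absq_ge0 _)).
Qed.

Lemma ae_integrableq1 f : integrableq2 f ->
  {ae m1, forall x, integrableq m2 (fun y => f (x, y))}.
Proof.
move=> fi; have [mf _] := fi.
apply: filterS (ae_integrable1 (integrableq2_abs fi)) => x /integrableP[_ xi].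
split.
  by apply: measurableq_comp mf; exact: pair1_measurable.
apply: le_lt_trans xi; rewrite le_eqVlt; apply/orP; left; apply/eqP.
apply: eq_integral => y _.
by rewrite gee0_abs// lee_fin absq_ge0.
Qed.

Lemma integrableq_intq f : integrableq2 f ->
  integrableq m1 (fun x => intq m2 (fun y => f (x, y))).
Proof.
move=> fi; have [mf fifin] := fi; split; first exact: measurableq_intq.
apply: le_lt_trans fifin.
apply: (@ae_ge0_le_integral _ _ _ m1 setT) => //.
- by move=> x _; rewrite lee_fin absq_ge0.
- by apply/measurable_EFinP/measurable_absq; exact: measurableq_intq.
- by move=> x _; apply: integral_ge0 => y _; rewrite lee_fin absq_ge0.
- apply: (@measurable_fun_fubini_tonelli_F _ _ _ _ _ m2
    (fun z => (absq (f z))%:E)).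
    by apply/measurable_EFinP; exact: measurable_absq.
  by move=> z; rewrite lee_fin absq_ge0.
- by apply: filterS (ae_integrableq1 fi) => x xi _; exact: absq_intq_le.
Qed.

End fubini_quaternion.

(** * Lebesgue measure: affine maps and coordinates *)

Lemma ge0_integral_image d1 d2 (T1 : measurableType d1) (T2 : measurableType d2)
    (R : realType) (mu : {sigma_finite_measure set T1 -> \bar R})
    (h : T1 -> T2) (g : T2 -> T1) (mh : measurable_fun setT h)
    (mg : measurable_fun setT g) (hK : cancel h g) (f : T2 -> \bar R) :
  measurable_fun setT f -> (forall y, 0 <= f y)%E ->
  (\int[sigma_finite_image mu mh mg hK]_y f y = \int[mu]_x f (h x))%E.
Proof.
move=> mf f0.
by rewrite [LHS](@ge0_integral_pushforward _ _ _ _ _ h mh mu setT f).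
Qed.

Section lebesgue_affine.
Context {R : realType}.
Local Notation leb1 := (@lebesgue_measure R).
Local Notation R' := (measurableTypeR R).
Local Open Scope ereal_scope.

Let affine (c b : R) : R' -> R' := fun x : R => (c * x + b)%R.

Let measurable_affine (c b : R) : measurable_fun [set: R'] (affine c b).
Proof.
apply: (@measurable_funD _ _ R); last exact: measurable_cst.
exact: (@mulrl_measurable R).
Qed.

Let affineK (c b : R) : (c != 0)%R ->
  cancel (affine c b) (affine c^-1 (- (b / c))).
Proof. by move=> c0 x; rewrite /affine; field. Qed.

Let lebesgue_measure_affine_gt0 (c b : R) (c0 : (0 < c)%R) (A : set R') :
  measurable A -> leb1 A = c%:E * leb1 (affine c b @^-1` A).
Proof.
move=> mA; have cN0 : (c != 0)%R by rewrite gt_eqF.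
pose nu := mscale (NngNum (ltW c0)) (sigma_finite_image leb1
  (measurable_affine c b) (measurable_affine c^-1 (- (b / c))) (affineK b cN0)).
have -> : leb1 A = nu A.
  apply: lebesgue_measure_unique => // _ [[u v] _ <-] /=.
  rewrite /nu /mscale /sigma_finite_image /pushforward /=.
  have -> : affine c b @^-1` `]u, v] = `]((u - b) / c)%R, ((v - b) / c)%R]%classic.
    by apply/seteqP; split => x /=; rewrite !in_itv /= /affine
      ltr_pdivrMr// ler_pdivlMr// ltrBlDr lerBrDr [(x * c)%R]mulrC.
  rewrite !lebesgue_measure_itv/= !lte_fin ltr_pM2r ?invr_gt0// ltrD2r.
  case: ifP => _; last by rewrite mule0.
  by rewrite -!EFinD -EFinM; congr EFin; field.
by [].
Qed.

Let lebesgue_measure_affine (c b : R) (A : set R') : (c != 0)%R ->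
  measurable A -> leb1 A = `|c|%:E * leb1 (affine c b @^-1` A).
Proof.
move=> c0 mA; have [cn|cp|cE] := ltgtP c 0%R.
- rewrite (@lebesgue_measure_affine_gt0 (- c) b) ?oppr_gt0//.
  rewrite ltr0_norm//; congr (_ * _).
  rewrite -[RHS]lebesgue_measureN; last first.
    by rewrite -[X in measurable X]setTI; exact: measurable_affine.
  rewrite /pushforward; congr leb1; apply/seteqP; split => x /=;
    by rewrite /affine mulrN mulNr.
- by rewrite gtr0_norm//; exact: lebesgue_measure_affine_gt0.
- by rewrite cE eqxx in c0.
Qed.

Lemma ge0_integral_affine (c b : R) (f : R' -> \bar R) : (c != 0)%R ->
  measurable_fun setT f -> (forall x, 0 <= f x) ->
  \int[leb1]_x f (c * x + b)%R = `|c^-1|%:E * \int[leb1]_x f x.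
Proof.
move=> c0 mf f0.
have c0' : (0 <= `|c|)%R by [].
transitivity (`|c^-1|%:E * (`|c|%:E * \int[leb1]_x f (affine c b x))).
  by rewrite muleA -EFinM -normrM mulVf// normr1 mul1e.
congr (_ * _).
pose nu := sigma_finite_image leb1
  (measurable_affine c b) (measurable_affine c^-1 (- (b / c))) (affineK b c0).
transitivity (`|c|%:E * \int[nu]_x f x); first by rewrite ge0_integral_image.
rewrite -(@ge0_integral_mscale _ _ _ nu setT measurableT (NngNum c0') f)//.
by apply: eq_measure_integral => A mA _; rewrite [RHS](lebesgue_measure_affine b c0).
Qed.

End lebesgue_affine.

Section leb_cons.
Context {R : realType} (m : nat).
Local Notation R' := (measurableTypeR R).
Local Notation leb1 := (@lebesgue_measure R).
Local Open Scope ereal_scope.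
Implicit Types F : vec R m.+1 -> \bar R.

Lemma ge0_integral_leb_cons F : measurable_fun setT F -> (forall z, 0 <= F z) ->
  \int[leb R m.+1]_z F z = \int[leb1]_a \int[leb R m]_x F (consv (a, x)).
Proof.
move=> mF F0; rewrite [LHS]ge0_integral_image//.
rewrite [LHS](@fubini_tonelli1 _ _ _ _ _ leb1 (leb R m) (fun z => F (consv z)))//.
exact: (measurableT_comp mF (@measurable_consv _ _)).
Qed.

Lemma ge0_integral_leb_cons_swap F : measurable_fun setT F ->
  (forall z, 0 <= F z) ->
  \int[leb R m.+1]_z F z = \int[leb R m]_x \int[leb1]_a F (consv (a, x)).
Proof.
move=> mF F0; rewrite [LHS]ge0_integral_image//.
rewrite [LHS](@fubini_tonelli2 _ _ _ _ _ leb1 (leb R m) (fun z => F (consv z)))//.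
exact: (measurableT_comp mF (@measurable_consv _ _)).
Qed.

End leb_cons.

Section integral_helpers.
Context d1 d2 (T1 : measurableType d1) (T2 : measurableType d2) (R : realType).
Context (m1 : {sigma_finite_measure set T1 -> \bar R}).
Context (m2 : {sigma_finite_measure set T2 -> \bar R}).

Lemma le_prod_integrable (u : T1 * T2 -> R) (a : T1 -> R) (b : T2 -> R) :
  measurable_fun setT u -> measurable_fun setT a -> measurable_fun setT b ->
  (forall x, 0 <= a x) -> (forall y, 0 <= b y) ->
  (forall x y, `|u (x, y)| <= a x * b y) ->
  (\int[m1]_x (a x)%:E < +oo)%E -> (\int[m2]_y (b y)%:E < +oo)%E ->
  (m1 \x m2)%E.-integrable setT (EFin \o u).
Proof.
move=> mu ma mb a0 b0 uab afin bfin.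
have mab : measurable_fun [set: T1 * T2] (fun z => (a z.1 * b z.2)%:E).
  apply/measurable_EFinP; apply: measurable_funM.
    exact: (measurableT_comp ma).
  exact: (measurableT_comp mb).
have mabs : measurable_fun [set: T1 * T2] (abse \o (EFin \o u)).
  by apply: measurableT_comp => //; exact/measurable_EFinP.
apply/integrableP; split; first exact/measurable_EFinP.
apply: (@le_lt_trans _ _ (\int[(m1 \x m2)%E]_z (a z.1 * b z.2)%:E)%E).
  apply: ge0_le_integral => //.
  by move=> [x y] _ /=; rewrite lee_fin.
rewrite (fubini_tonelli1 _ mab); last by move=> z; rewrite lee_fin mulr_ge0.
rewrite /fubini_F /=.
under eq_integral do rewrite ge0_integralZ_EFin//.
rewrite ge0_integralZr//.
- rewrite lte_mul_pinfty// ?integral_ge0// => [x _|]; first by rewrite lee_fin.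
  by rewrite ge0_fin_numE// integral_ge0// => x _; rewrite lee_fin.
- exact/measurable_EFinP.
- by move=> x _; rewrite lee_fin.
- by apply: integral_ge0 => y _; rewrite lee_fin.
Qed.

Lemma integrable_EFin_lty (u : T1 -> R) : m1.-integrable setT (EFin \o u) ->
  (\int[m1]_x (`|u x|)%:E < +oo)%E.
Proof. by case/integrableP. Qed.

Lemma EFin_Rintegral (u : T1 -> R) : m1.-integrable setT (EFin \o u) ->
  ((\int[m1]_x u x)%:E = \int[m1]_x (u x)%:E)%E.
Proof. by move=> iu; rewrite fineK//; exact: (integrable_fin_num measurableT iu). Qed.

End integral_helpers.

Section affine_integrable.
Context {R : realType}.
Local Notation leb1 := (@lebesgue_measure R).

Lemma integrable_affine (c b : R) (f : R -> R) : c != 0 ->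
  leb1.-integrable setT (EFin \o f) ->
  leb1.-integrable setT (EFin \o (fun x => f (c * x + b))).
Proof.
move=> c0 /integrableP[/measurable_EFinP mf fi]; apply/integrableP; split.
  apply/measurable_EFinP; apply: (measurableT_comp mf).
  apply: measurable_funD => //; exact: measurable_funM.
rewrite /= (@ge0_integral_affine _ c b (fun x => `|f x|%:E)%E)//.
  by rewrite lte_mul_pinfty// lee_fin.
by apply/measurable_EFinP; exact: measurableT_comp.
Qed.

Lemma integral_affine (c b : R) (f : R -> R) : c != 0 ->
  leb1.-integrable setT (EFin \o f) ->
  (\int[leb1]_x (f (c * x + b)%R)%:E = `|c^-1|%:E * \int[leb1]_x (f x)%:E)%E.
Proof.
move=> c0 fi; have mf := measurable_int _ fi.
rewrite integralE [in RHS]integralE muleBr//; last exact: integrable_add_def fi.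
congr (_ - _)%E.
- rewrite -(ge0_integral_affine b c0); last 2 first.
  + exact: measurable_funepos.
  + by move=> x; exact: funepos_ge0.
  by apply: eq_integral => x _; rewrite !funeposE.
- rewrite -(ge0_integral_affine b c0); last 2 first.
  + exact: measurable_funeneg.
  + by move=> x; exact: funeneg_ge0.
  by apply: eq_integral => x _; rewrite !funenegE.
Qed.

Lemma Rintegral_affine (c b : R) (f : R -> R) : c != 0 ->
  leb1.-integrable setT (EFin \o f) ->
  \int[leb1]_x f (c * x + b) = `|c^-1| * \int[leb1]_x f x.
Proof.
move=> c0 fi; rewrite {1}/Rintegral integral_affine// fineM//.
exact: (integrable_fin_num measurableT fi).
Qed.

End affine_integrable.

Section convergence_helpers.
Context d (T : measurableType d) (R : realType).
Context (mu : {measure set T -> \bar R}).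

Lemma dominated_cvg_EFin (u : nat -> T -> R) (v g : T -> R) :
  (forall n, measurable_fun setT (u n)) -> measurable_fun setT g ->
  (forall x, u n x @[n --> \oo] --> v x) -> (forall n x, `|u n x| <= g x) ->
  (\int[mu]_x (g x)%:E < +oo)%E ->
  (\int[mu]_x (u n x)%:E @[n --> \oo] --> \int[mu]_x (v x)%:E)%E.
Proof.
move=> mu_ mg uv ug gfin.
have g0 x : 0 <= g x by apply: le_trans (ug 0%N x).
apply: (@dominated_cvg _ _ _ mu setT measurableT (fun n x => (u n x)%:E)
  (fun x => (v x)%:E) (fun x => (g x)%:E)) => //.
- by move=> n; exact/measurable_EFinP.
- by move=> x _; apply: cvg_EFin; [exact: nearW|exact: uv].
- apply/integrableP; split; first exact/measurable_EFinP.
  by under eq_integral do rewrite /= ger0_norm//.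
- by move=> n x _; rewrite lee_fin.
Qed.

Lemma cvge0_near_lt (u : nat -> \bar R) (e : R) : 0 < e ->
  (u n @[n --> \oo] --> 0)%E -> \forall n \near \oo, (u n < e%:E)%E.
Proof.
move=> e0 /fine_cvgP[ufin uc].
have ue : \forall n \near \oo, fine (u n) < e by exact: (cvgr_lt _ uc).
near=> n; rewrite -(fineK (_ : u n \is a fin_num)); last by near: n.
by rewrite lte_fin; near: n.
Unshelve. all: by end_near. Qed.

Lemma cvge0_from_near_le (u : nat -> \bar R) : (forall n, 0 <= u n)%E ->
  (forall e : R, 0 < e -> \forall n \near \oo, (u n <= e%:E)%E) ->
  (u n @[n --> \oo] --> 0)%E.
Proof.
move=> u0 ue; have ufin : \forall n \near \oo, u n \is a fin_num.
  apply: filterS (ue 1 ltr01) => n un1; rewrite ge0_fin_numE//.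
  by apply: le_lt_trans un1 _; rewrite ltry.
apply/fine_cvgP; split=> //; apply/cvgrPdist_le => /= e e0.
near=> n; rewrite sub0r normrN ger0_norm ?fine_ge0//.
rewrite -lee_fin fineK; last by near: n.
by near: n; exact: ue.
Unshelve. all: by end_near. Qed.

End convergence_helpers.

(** * Poisson kernels and Abel summation *)

Section poisson.
Context {R : realType}.
Local Notation leb1 := (@lebesgue_measure R).

(** Twice the integral over the half-line, where [f] agrees with the derivative
    [g] of [F]; on the other half-line the even [f] need not do so. *)
Lemma ge0_integral_even (f g F : R -> R) (l : R) : (forall x, 0 <= f x) ->
  continuous f -> (forall x, f (- x) = f x) ->
  (forall x : R, is_derive x (1 : R) F (g x)) -> (forall x, 0 <= x -> f x = g x) ->
  F x @[x --> +oo] --> l ->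
  (\int[leb1]_x (f x)%:E = (2 * (l - F 0))%:E)%E.
Proof.
move=> f0 cf fN dF fg Fl.
rewrite ge0_symfun_integralT//; last by move=> x /=; rewrite fN.
rewrite (_ : [set x | _] = `[0, +oo[%classic); last first.
  by apply/seteqP; split => x/=; rewrite in_itv/= andbT.
rewrite (@ge0_continuous_FTC2y _ f F 0 l)//.
- exact: continuous_subspaceT.
- apply: cvg_at_right_filter; apply: differentiable_continuous.
  by apply/derivable1_diffP; have [] := dF 0.
- by move=> x; rewrite in_itv/= andbT => x0; rewrite derive1E fg ?ltW//;
  have [_ ->] := dF x.
Qed.

Lemma cvgy_expRNM (e : R) : 0 < e -> expR (- (e * x)) @[x --> +oo] --> (0 : R).
Proof.
move=> e0; rewrite (_ : (fun x => _) = (fun z => expR (- z)) \o (fun z => e * z))//.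
apply: (@cvg_comp _ _ _ _ _ _ (pinfty_nbhs R)); last exact: cvgr_expR.
exact: gt0_cvgMry.
Qed.

Lemma continuous_expNabs (e : R) : continuous (fun x : R => expR (- (e * `|x|))).
Proof.
move=> x; apply: continuous_comp; last exact: continuous_expR.
apply: (@continuousN _ R^o); apply: (@continuousM _ R^o); first exact: cst_continuous.
exact: norm_continuous.
Qed.

Lemma integral_expNabs (e : R) : 0 < e ->
  (\int[leb1]_x (expR (- (e * `|x|)))%:E = (2 / e)%:E)%E.
Proof.
move=> e0; have eN0 : e != 0 by rewrite gt_eqF.
have dF (x : R) : is_derive x (1 : R) (fun x : R => - e^-1 * expR (- (e * x)))
    (expR (- (e * x))).
  by apply: is_derive_eq; rewrite /GRing.scale /=; field.
have F0 : - e^-1 * expR (- (e * x)) @[x --> +oo] --> (0 : R).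
  by rewrite -[X in _ --> X](mulr0 (- e^-1)); apply: cvgMr; exact: cvgy_expRNM.
apply: (etrans (ge0_integral_even _ _ _ dF _ F0)).
- by move=> x; exact: expR_ge0.
- exact: continuous_expNabs.
- by move=> x; rewrite normrN.
- by move=> x x0; rewrite ger0_norm.
- by congr EFin; rewrite mulr0 oppr0 expR0; field.
Qed.

(** Adding 1 to the cosine makes the integrand nonnegative, so that its integral
    is a limit of values of a primitive. *)
Lemma integral_expNabs_cos1 (e b : R) : 0 < e ->
  (\int[leb1]_x (expR (- (e * `|x|)) * (1 + cos (b * x)))%:E =
    (2 / e + 2 * e / (e ^+ 2 + b ^+ 2))%:E)%E.
Proof.
move=> e0; have D0 : e ^+ 2 + b ^+ 2 != 0.
  by rewrite gt_eqF// ltr_wpDr ?sqr_ge0// exprn_gt0.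
have eN0 : e != 0 by rewrite gt_eqF.
pose F (x : R) := expR (- (e * x)) * (- e^-1 +
    (e ^+ 2 + b ^+ 2)^-1 * (b * sin (b * x) - e * cos (b * x))).
have dF (x : R) : is_derive x (1 : R) F (expR (- (e * x)) * (1 + cos (b * x))).
  apply: is_derive_eq; rewrite /GRing.scale /=; field.
  by rewrite D0 eN0.
have F0 : F x @[x --> +oo] --> (0 : R).
  set K := e^-1 + (e ^+ 2 + b ^+ 2)^-1 * (`|b| + e).
  apply/cvgrPdist_lt => d d0.
  have K0 : 0 < K.
    apply: ltr_pwDl; first by rewrite invr_gt0.
    by rewrite mulr_ge0 ?invr_ge0 ?addr_ge0 ?sqr_ge0// ltW.
  have dK : 0 < d / K by rewrite divr_gt0.
  have /cvgrPdist_lt/(_ _ dK) := cvgy_expRNM e0.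
  apply: filterS => x; rewrite !sub0r !normrN => xd.
  rewrite normrM; apply: (@le_lt_trans _ _ (`|expR (- (e * x))| * K)).
    rewrite ler_wpM2l// /K; apply: (le_trans (ler_normD _ _)); apply: lerD.
      by rewrite normrN ger0_norm// invr_ge0 ltW.
    rewrite normrM ger0_norm; last first.
      by rewrite invr_ge0 addr_ge0 ?sqr_ge0.
    rewrite ler_wpM2l ?invr_ge0 ?addr_ge0 ?sqr_ge0//.
    apply: (le_trans (ler_normB _ _)); apply: lerD; rewrite normrM.
      by rewrite ler_piMr// ler_norml sin_le1 sin_geN1.
    by rewrite (gtr0_norm e0) ler_piMr ?(ltW e0)// ler_norml cos_le1 cos_geN1.
  by rewrite -ltr_pdivlMr.
have cf : continuous (fun x : R => expR (- (e * `|x|)) * (1 + cos (b * x))).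
  move=> x; apply: (@continuousM _ R^o (fun x : R => expR (- (e * `|x|)))
    (fun x : R => 1 + cos (b * x))); first exact: continuous_expNabs.
  apply: (@continuousD _ R^o R^o (fun=> 1) (fun x : R => cos (b * x))).
    exact: cst_continuous.
  apply: continuous_comp; last exact: continuous_cos.
  by apply: (@continuousM _ R^o); [exact: cst_continuous|].
apply: (etrans (ge0_integral_even _ cf _ dF _ F0)).
- by move=> x; rewrite mulr_ge0 ?expR_ge0//; have := cos_geN1 (b * x); lra.
- by move=> x; rewrite normrN mulrN cosN.
- by move=> x x0; rewrite ger0_norm.
- congr EFin; rewrite /F !mulr0 oppr0 expR0 sin0 cos0; field.
  by rewrite D0 eN0.
Qed.

Lemma integrable_expNabs (e : R) : 0 < e ->
  leb1.-integrable setT (fun x => (expR (- (e * `|x|)))%:E).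
Proof.
move=> e0; apply/integrableP; split.
  by apply/measurable_EFinP; apply: continuous_measurable_fun;
    exact: continuous_expNabs.
under eq_integral do rewrite /= ger0_norm ?expR_ge0//.
by rewrite integral_expNabs// ltry.
Qed.

Lemma measurable_cosM (b : R) : measurable_fun [set: R] (fun x : R => cos (b * x)).
Proof.
apply: continuous_measurable_fun => x.
apply: continuous_comp; last exact: continuous_cos.
by apply: (@continuousM _ R^o); [exact: cst_continuous|].
Qed.

Lemma measurable_sinM (b : R) : measurable_fun [set: R] (fun x : R => sin (b * x)).
Proof.
apply: continuous_measurable_fun => x.
apply: continuous_comp; last exact: continuous_sin.
by apply: (@continuousM _ R^o); [exact: cst_continuous|].
Qed.

(** The Fourier transform of a two-sided exponential is a Poisson kernel. *)
Lemma Rintegral_expNabs_cos (e b : R) : 0 < e ->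
  \int[leb1]_x (expR (- (e * `|x|)) * cos (b * x)) = 2 * e / (e ^+ 2 + b ^+ 2).
Proof.
move=> e0.
have mexp : measurable_fun [set: R] (fun x : R => expR (- (e * `|x|))).
  by apply: continuous_measurable_fun; exact: continuous_expNabs.
have i1 := integrable_expNabs e0.
have i2 : leb1.-integrable setT
    (fun x => (expR (- (e * `|x|)) * (1 + cos (b * x)))%:E).
  apply/integrableP; split.
    apply/measurable_EFinP; apply: measurable_funM => //.
    by apply: measurable_funD => //; exact: measurable_cosM.
  under eq_integral => x _.
    rewrite /= ger0_norm; last first.
      by rewrite mulr_ge0 ?expR_ge0//; have := cos_geN1 (b * x); lra.
    over.
  by rewrite integral_expNabs_cos1// ltry.
transitivity (\int[leb1]_x
    (expR (- (e * `|x|)) * (1 + cos (b * x)) - expR (- (e * `|x|)))).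
  by apply: eq_Rintegral => x _; ring.
rewrite RintegralB//.
by rewrite /Rintegral integral_expNabs_cos1// integral_expNabs//=; ring.
Qed.

Lemma continuous_sqrD (a : R) (b c : R) : 0 < a ->
  continuous (fun x : R => c / (a + (b * x) ^+ 2)).
Proof.
move=> a0 x; apply: (@continuousM _ R^o (fun=> c)
    (fun x : R => (a + (b * x) ^+ 2)^-1)); first exact: cst_continuous.
apply: (@continuousV _ R^o (fun x : R => a + (b * x) ^+ 2)).
  by rewrite gt_eqF// ltr_pwDl// sqr_ge0.
apply: (@continuousD _ R^o R^o (fun=> a) (fun x : R => (b * x) ^+ 2)).
  exact: cst_continuous.
apply: (@continuous_comp _ R^o R^o (fun x : R => b * x) (fun x : R => x ^+ 2)).
  by apply: (@continuousM _ R^o); [exact: cst_continuous|].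
exact: exprn_continuous.
Qed.

Lemma continuous_cauchy : continuous (fun x : R => pi^-1 / (1 + x ^+ 2)).
Proof.
have := @continuous_sqrD 1 1 pi^-1 ltr01.
by under eq_fun do rewrite mul1r.
Qed.

Lemma integral_cauchy :
  (\int[leb1]_x (pi^-1 / (1 + x ^+ 2))%:E = 1%:E)%E.
Proof.
have D0 (x : R) : 1 + x ^+ 2 != 0 by rewrite gt_eqF// ltr_pwDl// sqr_ge0.
have p0 : (pi : R) != 0 by rewrite gt_eqF ?pi_gt0.
have dF (x : R) : is_derive x (1 : R) (fun x : R => pi^-1 * atan x)
    (pi^-1 / (1 + x ^+ 2)).
  by apply: is_derive_eq.
have F0 : pi^-1 * atan x @[x --> +oo] --> (2^-1 : R).
  rewrite (_ : 2^-1 = pi^-1 * (pi / 2)); last first.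
    by rewrite mulrA mulVf// mul1r.
  by apply: cvgMr; exact: cvgy_atan.
have cf := continuous_cauchy.
apply: (etrans (ge0_integral_even _ cf _ dF _ F0)) => //.
- move=> x; rewrite divr_ge0 ?invr_ge0 ?pi_ge0//.
  by rewrite addr_ge0// sqr_ge0.
- by move=> x; rewrite sqrrN.
- by congr EFin; rewrite atan0 mulr0; field.
Qed.

(** Abel summation of the cosine transform of [A]: integrating it against
    [expR (- e |x|)] averages [A] against a Poisson kernel, which concentrates
    at the origin as [e] tends to 0. *)
Lemma integral_cos_transform (A : R -> R) (M : R) :
  measurable_fun [set: R] A ->
  leb1.-integrable setT (EFin \o A) -> (forall x, `|A x| <= M) ->
  (forall u : R^nat, u @ \oo --> 0 -> A (u n) @[n --> \oo] --> A 0) ->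
  (forall xi, 0 <= \int[leb1]_x (A x * cos (2 * pi * xi * x))) ->
  (\int[leb1]_xi (\int[leb1]_x (A x * cos (2 * pi * xi * x)))%:E = (A 0)%:E)%E.
Proof.
move=> mA iA AM A0 CA0.
pose CA := fun xi : R => \int[leb1]_x (A x * cos (2 * pi * xi * x)).
have pi0 : (pi : R) != 0 by rewrite gt_eqF ?pi_gt0.
pose e_ (n : nat) : R := n.+1%:R^-1.
have e_gt0 n : 0 < e_ n by rewrite invr_gt0.
have mcos : measurable_fun [set: R * R] (fun z => cos (2 * pi * z.1 * z.2)).
  apply: (measurableT_comp (f := @cos R)).
    by apply: continuous_measurable_fun; exact: continuous_cos.
  by apply: measurable_funM => //; apply: measurable_funM.
have mexp (e : R) : measurable_fun [set: R] (fun x : R => expR (- (e * `|x|))).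
  by apply: continuous_measurable_fun; exact: continuous_expNabs.
have Afin : (\int[leb1]_x (`|A x|)%:E < +oo)%E by exact: integrable_EFin_lty.
have mA' : measurable_fun [set: R] (fun x => `|A x|) by exact: measurableT_comp.
have cosn (x : R) : `|cos x| <= 1 by rewrite ler_norml cos_le1 cos_geN1.
have iAcos xi : leb1.-integrable setT
    (EFin \o (fun x => A x * cos (2 * pi * xi * x))).
  apply: (@integrable_le _ _ _ leb1 _ (fun x => `|A x|)) => //.
  - apply: measurable_funM => //; exact: measurable_cosM.
  - by move=> x; rewrite normrM ler_piMr.
have mCA : measurable_fun [set: R] CA.
  apply: (@measurable_Rintegral _ _ _ _ _ leb1
    (fun z => A z.2 * cos (2 * pi * z.1 * z.2))).
  by apply: measurable_funM => //; exact: measurableT_comp.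
have iexp n : leb1.-integrable setT (EFin \o (fun x => expR (- (e_ n * `|x|)))).
  exact: integrable_expNabs.
have Abel n : \int[leb1]_xi (expR (- (e_ n * `|xi|)) * CA xi) =
    \int[leb1]_u (A (e_ n / (2 * pi) * u) * (pi^-1 / (1 + u ^+ 2))).
  transitivity (\int[leb1]_xi \int[leb1]_x
      (expR (- (e_ n * `|xi|)) * (A x * cos (2 * pi * xi * x)))).
    by apply: eq_Rintegral => xi _; rewrite RintegralZl.
  rewrite (@Rintegral_swap _ _ _ _ _ leb1 leb1 (fun z =>
    expR (- (e_ n * `|z.1|)) * (A z.2 * cos (2 * pi * z.1 * z.2)))); last first.
    apply: (@le_prod_integrable _ _ _ _ _ leb1 leb1 _
      (fun x => expR (- (e_ n * `|x|))) (fun y => `|A y|)) => //.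
    - apply: measurable_funM; first exact: (measurableT_comp (mexp _)).
      by apply: measurable_funM => //; exact: measurableT_comp.
    - exact: mexp.
    - move=> x y /=; rewrite normrM (ger0_norm (expR_ge0 _)).
      by rewrite ler_wpM2l ?expR_ge0// normrM ler_piMr.
    - by rewrite integral_expNabs// ltry.
  transitivity (\int[leb1]_x (A x * (2 * e_ n / (e_ n ^+ 2 + (2 * pi * x) ^+ 2)))).
    apply: eq_Rintegral => x _ /=; rewrite -Rintegral_expNabs_cos// -RintegralZl//.
      apply: eq_Rintegral => xi _; rewrite mulrCA; congr (_ * (_ * cos _)).
      by rewrite mulrAC.
    apply: (@integrable_le _ _ _ leb1 _ (fun x => expR (- (e_ n * `|x|)))) => //.
    - by apply: measurable_funM; [exact: mexp|exact: measurable_cosM].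
    - exact: mexp.
    - move=> y; rewrite normrM (ger0_norm (expR_ge0 _)) ler_piMr//.
    - by rewrite integral_expNabs// ltry.
  have c0 : e_ n / (2 * pi) != 0 by rewrite mulf_neq0 ?gt_eqF// invr_gt0
    mulr_gt0// pi_gt0.
  have D0 (x : R) : 1 + x ^+ 2 != 0 by rewrite gt_eqF// ltr_pwDl// sqr_ge0.
  have eN0 : e_ n != 0 by rewrite gt_eqF.
  have PD0 (x : R) : e_ n ^+ 2 + (2 * pi * x) ^+ 2 != 0.
    by rewrite gt_eqF// ltr_wpDr ?sqr_ge0// exprn_gt0.
  have iAP : leb1.-integrable setT (EFin \o (fun x =>
      A x * (2 * e_ n / (e_ n ^+ 2 + (2 * pi * x) ^+ 2)))).
    have PM (x : R) : `|2 * e_ n / (e_ n ^+ 2 + (2 * pi * x) ^+ 2)| <= 2 / e_ n.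
      rewrite ger0_norm; last first.
        by rewrite divr_ge0 ?addr_ge0 ?sqr_ge0 ?mulr_ge0// ltW.
      have := PD0 x; have := sqr_ge0 (2 * pi * x).
      move: ((2 * pi * x) ^+ 2) => S S0 SD; rewrite -subr_ge0.
      have -> : 2 / e_ n - 2 * e_ n / (e_ n ^+ 2 + S) =
        2 / e_ n * (S / (e_ n ^+ 2 + S)) by field; rewrite eN0 SD.
      by rewrite mulr_ge0 ?divr_ge0 ?addr_ge0 ?sqr_ge0// ltW.
    have mP : measurable_fun [set: R]
        (fun x : R => 2 * e_ n / (e_ n ^+ 2 + (2 * pi * x) ^+ 2)).
      apply: continuous_measurable_fun; apply: continuous_sqrD.
      by rewrite exprn_gt0.
    apply: (@integrable_le _ _ _ leb1 _ (fun x => 2 / e_ n * `|A x|)).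
    - exact: measurable_funM.
    - exact: measurable_funM.
    - by move=> x; rewrite normrM mulrC ler_wpM2r.
    - rewrite ge0_integralZ_EFin//; last by rewrite divr_ge0// ltW.
      by rewrite lte_mul_pinfty// lee_fin divr_ge0// ltW.
  have c1 : 0 < e_ n / (2 * pi) by rewrite divr_gt0// mulr_gt0// pi_gt0.
  have cN0 : `|(e_ n / (2 * pi))^-1| != 0 by rewrite normr_eq0 invr_eq0.
  rewrite -[LHS](mulKf cN0) -(Rintegral_affine 0 c0 iAP).
  rewrite normfV invrK gtr0_norm// -RintegralZl//; last exact: (integrable_affine 0 c0 iAP).
  apply: eq_Rintegral => u _; rewrite addr0 mulrCA; congr (_ * _).
  move: {u}(u : R) (D0 u) => u uD0.
  have -> : 2 * pi * (e_ n / (2 * pi) * u) = e_ n * u.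
    by rewrite mulrA mulrCA mulfV ?mulr1// mulf_neq0.
  have -> : e_ n ^+ 2 + (e_ n * u) ^+ 2 = e_ n ^+ 2 * (1 + u ^+ 2) by ring.
  by rewrite invfM; move: pi^-1 => ip; field; rewrite uD0 eN0.
have M0 : 0 <= M by apply: le_trans (AM 0).
have mK : measurable_fun [set: R] (fun u : R => pi^-1 / (1 + u ^+ 2)).
  apply: continuous_measurable_fun; exact: continuous_cauchy.
have K0 (u : R) : 0 <= pi^-1 / (1 + u ^+ 2).
  by rewrite divr_ge0 ?invr_ge0 ?pi_ge0// addr_ge0 ?sqr_ge0.
have iK : leb1.-integrable setT (EFin \o (fun u : R => M * (pi^-1 / (1 + u ^+ 2)))).
  apply: (@integrable_le _ _ _ leb1 _ (fun u : R => M * (pi^-1 / (1 + u ^+ 2)))).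
  - exact: measurable_funM.
  - exact: measurable_funM.
  - by move=> x; rewrite ger0_norm// mulr_ge0.
  - rewrite ge0_integralZ_EFin// integral_cauchy.
    by rewrite lte_mul_pinfty ?lee_fin ?ltry.
have Au n : measurable_fun [set: R] (fun u => A (e_ n / (2 * pi) * u)).
  by apply: (measurableT_comp mA); exact: measurable_funM.
have iAK n : leb1.-integrable setT
    (EFin \o (fun u => A (e_ n / (2 * pi) * u) * (pi^-1 / (1 + u ^+ 2)))).
  have /integrableP[_ iKfin] := iK.
  apply: (@integrable_le _ _ _ leb1 _ (fun u : R => M * (pi^-1 / (1 + u ^+ 2)))).
  - exact: (measurable_funM (Au n) mK).
  - exact: measurable_funM.
  - by move=> x; rewrite normrM (ger0_norm (K0 x)) ler_wpM2r.
  - rewrite ge0_integralZ_EFin// integral_cauchy.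
    by rewrite lte_mul_pinfty ?lee_fin ?ltry.
have e_cvg0 : e_ n @[n --> \oo] --> (0 : R) by exact: cvg_harmonic.
have RHScvg : (\int[leb1]_u (A (e_ n / (2 * pi) * u) * (pi^-1 / (1 + u ^+ 2)))%:E
    @[n --> \oo] --> (A 0)%:E)%E.
  have -> : (A 0)%:E = (\int[leb1]_u (A 0 * (pi^-1 / (1 + u ^+ 2)))%:E)%E.
    under eq_integral do rewrite EFinM.
    rewrite integralZl//; first by rewrite integral_cauchy mule1.
    apply: (@integrable_le _ _ _ leb1 _ (fun u : R => (pi^-1 / (1 + u ^+ 2)))) => //.
    - by move=> x; rewrite ger0_norm.
    - by rewrite integral_cauchy ltry.
  apply: (@dominated_cvg _ _ _ leb1 setT measurableT _ _
    (fun u : R => (M * (pi^-1 / (1 + u ^+ 2)))%:E)) => //.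
  - by move=> n; apply/measurable_EFinP; exact: (measurable_funM (Au n) mK).
  - move=> u _; apply: cvg_EFin; first exact: nearW.
    suff : A (e_ n / (2 * pi) * u) * (pi^-1 / (1 + u ^+ 2)) @[n --> \oo] -->
        A 0 * (pi^-1 / (1 + u ^+ 2)) by [].
    apply: cvgM; last exact: cvg_cst.
    apply: A0; rewrite -[X in _ --> X](mul0r u) -[X in X * u](mul0r (2 * pi)^-1).
    apply: cvgM; last exact: cvg_cst.
    by apply: cvgM; [exact: e_cvg0|exact: cvg_cst].
  - by move=> n u _; rewrite lee_fin normrM (ger0_norm (K0 u)) ler_wpM2r.
have LHScvg : (\int[leb1]_xi (expR (- (e_ n * `|xi|)) * CA xi)%:E
    @[n --> \oo] --> \int[leb1]_xi (CA xi)%:E)%E.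
  have lim xi : limn (fun n => (expR (- (e_ n * `|xi|)) * CA xi)%:E) = (CA xi)%:E.
    apply/cvg_lim => //; apply: cvg_EFin; first exact: nearW.
    suff : expR (- (e_ n * `|xi|)) * CA xi @[n --> \oo] --> CA xi by [].
    rewrite -[X in _ --> X]mul1r; apply: cvgM; last exact: cvg_cst.
    rewrite -expR0 -oppr0 -(mul0r `|xi|).
    apply: continuous_cvg; first exact: continuous_expR.
    by apply: cvgN; apply: cvgM; [exact: e_cvg0|exact: cvg_cst].
  have := @cvg_monotone_convergence _ _ _ leb1 setT measurableT
    (fun n xi => (expR (- (e_ n * `|xi|)) * CA xi)%:E).
  under [in X in _ -> _ -> _ -> _ --> X]eq_integral do rewrite lim.
  apply => //.
  - move=> n; apply/measurable_EFinP; apply: measurable_funM => //; exact: mexp.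
  - by move=> n xi _; rewrite lee_fin mulr_ge0 ?expR_ge0//; exact: CA0.
  - move=> xi _ m n mn; rewrite lee_fin; apply: ler_wpM2r; first exact: CA0.
    by rewrite ler_expR lerN2 ler_wpM2r// lef_pV2 ?posrE// ler_nat.
have seqE n : (\int[leb1]_xi (expR (- (e_ n * `|xi|)) * CA xi)%:E =
    \int[leb1]_u (A (e_ n / (2 * pi) * u) * (pi^-1 / (1 + u ^+ 2)))%:E)%E.
  rewrite -!EFin_Rintegral ?Abel//.
  pose B := fine (\int[leb1]_x (`|A x|)%:E)%E.
  have CAB xi : `|CA xi| <= B.
    rewrite /CA; apply: (le_trans (le_normr_Rintegral measurableT (iAcos xi))).
    rewrite /B; apply: (@le_Rintegral _ _ _ leb1 setT) => //.
    - exact: integrable_norm.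
    - exact: (integrable_norm iA).
    - by move=> x _; rewrite normrM ler_piMr.
  have B0 : 0 <= B by apply: le_trans (CAB 0).
  apply: (@integrable_le _ _ _ leb1 _ (fun x => B * expR (- (e_ n * `|x|)))).
  - by apply: measurable_funM => //; exact: mexp.
  - by apply: measurable_funM => //; exact: mexp.
  - move=> x; rewrite normrM (ger0_norm (expR_ge0 _)) mulrC.
    by rewrite ler_wpM2r ?expR_ge0.
  - rewrite ge0_integralZ_EFin//; last exact: mexp.
    by rewrite integral_expNabs// lte_mul_pinfty ?lee_fin ?ltry.
have {}RHScvg := cvg_lim (@ereal_hausdorff R) RHScvg.
rewrite -RHScvg; apply/esym/cvg_lim; first exact: ereal_hausdorff.
by under eq_fun do rewrite -seqE.
Qed.

End poisson.

(** * Plancherel's identity on the line *)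

Section translation_continuity.
Context {R : realType}.
Local Notation R' := (measurableTypeR R).
Local Notation leb1 := (@lebesgue_measure R).
Implicit Types p q : R' -> R.

Let sqdiff_le (a b : R) : (a + b) ^+ 2 <= 2 * a ^+ 2 + 2 * b ^+ 2.
Proof.
rewrite -subr_ge0 (_ : _ - _ = (a - b) ^+ 2) ?sqr_ge0//; ring.
Qed.

Lemma ge0_integral_translation (f : R' -> \bar R) (d : R) :
  measurable_fun setT f -> (forall x, 0 <= f x)%E ->
  (\int[leb1]_x f (x - d)%R = \int[leb1]_x f x)%E.
Proof.
move=> mf f0; have := @ge0_integral_affine R 1 (- d) f (oner_neq0 _) mf f0.
rewrite invr1 normr1 mul1e => <-.
by apply: eq_integral => x _; rewrite mul1r.
Qed.

Lemma measurable_translation (d : R) :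
  measurable_fun [set: R'] ((fun x : R => x - d) : R' -> R').
Proof.
apply: (@measurable_funD _ R' R setT (fun x => x) (fun=> - d)) => //.
Qed.

Lemma integral_sqD_le (u v : R' -> R) : measurable_fun setT u ->
  measurable_fun setT v ->
  (\int[leb1]_x ((u x + v x) ^+ 2)%:E <=
   2%:E * \int[leb1]_x (u x ^+ 2)%:E + 2%:E * \int[leb1]_x (v x ^+ 2)%:E)%E.
Proof.
move=> mu mv.
have mu2 : measurable_fun setT (fun x => u x ^+ 2) by exact: measurable_funX.
have mv2 : measurable_fun setT (fun x => v x ^+ 2) by exact: measurable_funX.
rewrite -!ge0_integralZ_EFin//; try by move=> x; exact: sqr_ge0.
rewrite -ge0_integralD_EFin//; last 4 first.
- exact: measurable_funM.
- exact: measurable_funM.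
- by move=> x; rewrite mulr_ge0// sqr_ge0.
- by move=> x; rewrite mulr_ge0// sqr_ge0.
apply: le_integral_EFin => //.
- by apply: measurable_funX; exact: measurable_funD.
- by apply: measurable_funD; exact: measurable_funM.
- by move=> x; exact: sqr_ge0.
Qed.

Lemma truncation_cvg p : measurable_fun setT p ->
  (\int[leb1]_x (p x ^+ 2)%:E < +oo)%E ->
  (\int[leb1]_x ((p x - (if (`|x| <= n%:R) && (`|p x| <= n%:R) then p x
    else 0)) ^+ 2)%:E @[n --> \oo] --> 0)%E.
Proof.
move=> mp pfin.
have -> : 0%E = (\int[leb1]_x (0:R)%:E)%E by rewrite integral0.
apply: (@dominated_cvg_EFin _ _ _ leb1 _ (fun=> 0) (fun x => p x ^+ 2)).
- move=> n; apply: measurable_funX; apply: measurable_funB => //.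
  apply: measurable_fun_ifT => //; apply: measurable_and;
    apply: measurable_fun_ler => //.
  exact: measurableT_comp.
- exact: measurable_funX.
- move=> x; apply: cvg_near_cst; near=> n.
  have -> : (`|x : R| <= n%:R) && (`|p x| <= n%:R).
    apply/andP; split; near: n; exact: nbhs_infty_ger.
  by rewrite subrr expr0n.
- move=> n x; rewrite ger0_norm ?sqr_ge0//.
  by case: ifP => _; rewrite ?subrr ?subr0// expr0n/= sqr_ge0.
- by [].
Unshelve. all: by end_near. Qed.

Lemma lebesgue_measure_ball_lty (K : R) :
  (leb1 (`[(- K)%R, K]%classic : set R') < +oo)%E.
Proof.
rewrite lebesgue_measure_itv /=; case: ifP => _; last exact: ltry.
by rewrite -EFinB ltry.
Qed.

(** Cut off the domain and the values of [p], approximate by a continuous function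
    in mean, and clip it: among functions bounded by [N], approximation in mean
    is approximation in square mean. *)
Lemma nice_approximation p (eta : R) : measurable_fun setT p ->
  (\int[leb1]_x (p x ^+ 2)%:E < +oo)%E -> 0 < eta ->
  exists (q : R' -> R) (N : R), [/\ measurable_fun setT q /\ 0 <= N,
    (forall x, `|q x| <= N),
    (forall x : R, N < `|x| -> q x = 0),
    (forall x : R, `|x| != N -> {for x, continuous (q : R -> R)}) &
    (\int[leb1]_x ((p x - q x) ^+ 2)%:E <= eta%:E)%E].
Proof.
move=> mp pfin eta0.
have eta40 : 0 < eta / 4 by rewrite divr_gt0.
have := cvge0_near_lt eta40 (truncation_cvg mp pfin).
move=> [n0 _ /(_ n0.+1 (leqnSn n0))] /=.
set N : R := n0.+1%:R => fN'.
pose f := fun x : R' => if (`|x : R| <= N) && (`|p x| <= N) then p x else 0.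
have fN : (\int[leb1]_x ((p x - f x) ^+ 2)%:E < (eta / 4)%:E)%E by exact: fN'.
move: fN' => _.
have N0 : 0 < N by rewrite /N.
have fle x : `|f x| <= N by rewrite /f; case: ifP => [/andP[]|_]//; rewrite normr0 ltW.
have f0 (x : R) : N < `|x| -> f x = 0 by rewrite /f leNgt => ->.
have mabs : measurable_fun [set: R'] (fun x : R => `|x|).
  exact: (@normr_measurable R).
have mf : measurable_fun setT f.
  apply: measurable_fun_ifT => //; apply: measurable_and;
    apply: measurable_fun_ler => //.
  exact: measurableT_comp.
pose E := `[- N, N]%classic : set R'.
have mE : measurable E by exact: measurable_itv.
have Efin : (leb1 E < +oo)%E by exact: lebesgue_measure_ball_lty.
have fE : leb1.-integrable E (EFin \o f).
  apply: measurable_bounded_integrable => //; first exact: measurable_funTS.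
  exists N; split; first exact: num_real.
  by move=> M NM x _ /=; apply: (le_trans (fle x)); exact: ltW.
have [g_ [cg ig gcvg]] := approximation_continuous_integrable mE Efin fE.
have d0 : 0 < eta / 4 / (2 * N) by rewrite !divr_gt0// mulr_gt0.
have := cvge0_near_lt d0 gcvg.
move=> [k _ /(_ k (leqnn k))] /=; set g := g_ k => gk.
(* Projecting onto [[- N, N]] brings [g] closer to [f], which is bounded by [N]. *)
pose clip (y : R) := Num.max (- N) (Num.min N y).
pose q := fun x : R' => if `|x : R| <= N then clip (g x) else 0.
have clipN y : `|clip y| <= N.
  rewrite ler_norml /clip le_max lexx /= ge_max ge_min lexx /=.
  by rewrite andbT; lra.
have clip1 (a b : R) : `|a| <= N -> `|a - clip b| <= `|a - b|.
  clear -N0.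
  rewrite ler_norml => /andP[aN1 aN2]; rewrite /clip.
  have [Nb|bN] := leP N b.
    rewrite max_r; last lra.
    by rewrite !ler0_norm; lra.
  have [Nb|bN'] := leP (- N) b; first by [].
  by rewrite !ger0_norm; lra.
have cclip : continuous clip.
  move=> y; apply: (@continuous_max _ _ (fun=> - N) (fun y => Num.min N y)).
    exact: cst_continuous.
  by apply: (@continuous_min _ _ (fun=> N) (fun y => y)); first exact: cst_continuous.
have mg : measurable_fun [set: R'] g by apply: continuous_measurable_fun; exact: cg.
have mq : measurable_fun setT q.
  apply: measurable_fun_ifT => //; first exact: measurable_fun_ler.
  apply: (measurableT_comp (f := clip)) => //.
  exact: continuous_measurable_fun.
exists q, N; split.
- by split => //; exact: ltW.
- by move=> x; rewrite /q; case: ifP => // _; rewrite normr0 ltW.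
- by move=> x; rewrite /q leNgt => ->.
- move=> x xN; have [xN'|xN'] := ltP `|x| N.
    have : {for x, continuous (clip \o g)}.
      by apply: continuous_comp; [exact: cg|exact: cclip].
    rewrite /prop_for /continuous_at /= /q ltW//.
    apply: cvg_trans; apply: near_eq_cvg; near=> z.
    rewrite ifT// ltW//; near: z.
    by apply: (cvgr_lt `|x|) => //; exact: norm_continuous.
  have {}xN : N < `|x| by rewrite lt_neqAle eq_sym xN.
  rewrite /prop_for /continuous_at /q leNgt xN /=.
  apply: cvg_near_cst; near=> z; rewrite leNgt ifF//; apply/negbTE; rewrite negbK.
  by near: z; apply: (cvgr_gt `|x|) => //; exact: norm_continuous.
- have fq : (\int[leb1]_x ((f x - q x) ^+ 2)%:E <= (eta / 4)%:E)%E.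
    have mfq : measurable_fun setT (fun x => f x - q x) by exact: measurable_funB.
    have mfg : measurable_fun setT (fun x => `|f x - g x|).
      by apply: measurableT_comp => //; exact: measurable_funB.
    have EP (x : R) : (x \in E) = (`|x| <= N).
      by rewrite /E mem_setE in_itv /= ler_norml.
    apply: (@le_trans _ _ (\int[leb1]_(x in E) (2 * N * `|f x - g x|)%:E)%E).
      rewrite [leRHS]integral_mkcond.
      have -> : (\int[leb1]_x ((fun x => (2 * N * `|f x - g x|)%:E) \_ E) x =
          \int[leb1]_x (if (`|x : R| <= N)%R then (2 * N * `|f x - g x|)%R else 0%R)%:E)%E.
        by apply: eq_integral => x _; rewrite patchE EP; case: ifP.
      apply: le_integral_EFin => //.
      - exact: measurable_funX.
      - apply: measurable_fun_ifT => //; first exact: measurable_fun_ler.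
        exact: measurable_funM.
      - by move=> x; exact: sqr_ge0.
      - move=> x; case: ifP => xN; last first.
          by rewrite f0 ?ltNge ?xN// /q xN subr0 expr0n.
        rewrite -real_normK ?num_real// expr2; apply: ler_pM => //.
          apply: (le_trans (ler_normB _ _)); rewrite mulr2n mulrDl mul1r.
          by rewrite lerD// /q xN.
        by rewrite /q xN; exact: clip1.
    have -> : (\int[leb1]_(x in E) (2 * N * `|f x - g x|)%:E =
        (2 * N)%:E * \int[leb1]_(x in E) `|(f x - g x)%:E|)%E.
      under eq_integral do rewrite EFinM.
      rewrite ge0_integralZl//; last by rewrite lee_fin mulr_ge0// ltW.
      by apply/measurable_EFinP; exact: measurable_funTS.
    apply: (@le_trans _ _ ((2 * N)%:E * (eta / 4 / (2 * N))%:E)%E).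
      by apply: lee_wpmul2l; [rewrite lee_fin mulr_ge0// ltW|exact: ltW].
    rewrite -EFinM lee_fin le_eqVlt; apply/orP; left; apply/eqP.
    by field; rewrite gt_eqF.
  have pf : measurable_fun setT (fun x => p x - f x) by exact: measurable_funB.
  have fq' : measurable_fun setT (fun x => f x - q x) by exact: measurable_funB.
  have := integral_sqD_le pf fq'.
  under eq_integral do rewrite addrA subrK.
  move=> /le_trans; apply.
  apply: (@le_trans _ _ (2%:E * (eta / 4)%:E + 2%:E * (eta / 4)%:E)%E).
    by apply: leeD; rewrite lee_pmul2l// ltW.
  by rewrite -!EFinM -EFinD lee_fin; lra.
Unshelve. all: by end_near. Qed.

(** Translations are continuous for the square norm: for the functions of
    [nice_approximation] by dominated convergence, and in general because the
    approximation error is invariant under translation. *)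
Lemma cvg_integral_translation p (d_ : R^nat) : measurable_fun setT p ->
  (\int[leb1]_x (p x ^+ 2)%:E < +oo)%E -> d_ n @[n --> \oo] --> 0 ->
  (\int[leb1]_x ((p x - p (x - d_ n)%R) ^+ 2)%:E @[n --> \oo] --> 0)%E.
Proof.
move=> mp pfin d0; apply: cvge0_from_near_le.
  by move=> n; apply: integral_ge0 => x _; rewrite lee_fin sqr_ge0.
move=> e e0; have e16 : 0 < e / 16 by rewrite divr_gt0.
have [q [N [[mq N0] qN q0 cq pq]]] := nice_approximation mp pfin e16.
have mtr (f : R' -> R) (d : R) : measurable_fun setT f ->
    measurable_fun [set: R'] (fun x => f (x - d)) :> Prop.
  by move=> mf; exact: (measurableT_comp mf (measurable_translation d)).
have qcvg : (\int[leb1]_x ((q x - q (x - d_ n)%R) ^+ 2)%:E @[n --> \oo] --> 0)%E.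
  have [D [_ dD]] : bounded_fun d_ by apply: cvg_seq_bounded; apply: cvgP d0.
  have {}dD n : `|d_ n| <= `|D| + 1.
    by apply: dD => //; rewrite (le_lt_trans (ler_norm D))// ltrDl.
  pose K := N + (`|D| + 1).
  have Ncst : (\int[leb1]_x (if (`|x : R| <= K)%R then ((2 * N) ^+ 2)%R else 0)%:E
      < +oo)%E.
    pose E := `[- K, K]%classic : set R'.
    have EP (x : R) : (x \in E) = (`|x| <= K).
      by rewrite /E mem_setE in_itv /= ler_norml.
    apply: (@le_lt_trans _ _ (\int[leb1]_(x in E) (cst ((2 * N) ^+ 2)%:E) x)%E).
      rewrite [leRHS]integral_mkcond le_eqVlt; apply/orP; left; apply/eqP.
      by apply: eq_integral => x _; rewrite patchE EP; case: ifP.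
    rewrite integral_cst; last exact: measurable_itv.
    rewrite lte_mul_pinfty ?lee_fin ?sqr_ge0//.
    exact: lebesgue_measure_ball_lty.
  have -> : 0%E = (\int[leb1]_x (0:R)%:E)%E by rewrite integral0.
  have /dominated_convergence : forall n : nat, measurable_fun [set: R']
      (fun x => ((q x - q (x - d_ n)) ^+ 2)%:E).
    move=> n; apply/measurable_EFinP; apply: measurable_funX.
    by apply: measurable_funB => //; exact: mtr.
  move=> /(_ leb1 measurableT (fun=> 0%:E)
    (fun x => (if (`|x : R| <= K)%R then ((2 * N) ^+ 2)%R else 0)%:E)).
  case=> //.
  - have N2 : leb1 ([set N; - N] : set R') = 0%E.
      by apply: countable_lebesgue_measure0; apply: finite_set_countable;
        exact: finite_set2.
    exists [set N; - N]; split => //.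
      by apply: measurableU; exact: measurable_set1.
    move=> x /=; apply: contra_notP => xN _.
    have {}xN : `|x : R| != N.
      apply/eqP => xE; apply: xN; rewrite -xE.
      have [x0|x0] := leP 0 (x : R).
        by left; rewrite ger0_norm.
      by right; rewrite ltr0_norm// opprK.
    apply: cvg_EFin; first exact: nearW.
    suff : (q x - q (x - d_ n)) ^+ 2 @[n --> \oo] --> (0 : R) by [].
    rewrite -[X in _ --> X](_ : (q x - q x) * (q x - q x) = _); last first.
      by rewrite subrr mul0r.
    have qx : q x - q (x - d_ n) @[n --> \oo] --> q x - q x.
      apply: cvgB; first exact: cvg_cst.
      have xd : (x : R) - d_ n @[n --> \oo] --> (x : R).
        rewrite -[X in _ --> X](subr0 (x : R)); apply: cvgB => //.
        exact: cvg_cst.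
      exact: (cvg_comp _ _ xd (cq x xN)).
    by under eq_fun do rewrite expr2; exact: cvgM.
  - have mK : measurable_fun [set: R'] (fun x : R =>
        if `|x| <= K then (2 * N) ^+ 2 else 0 : R).
      by apply: measurable_fun_ifT => //; exact: measurable_fun_ler.
    apply/integrableP; split; first exact/measurable_EFinP.
    by under eq_integral do
      rewrite /= ger0_norm ?(fun_if (fun x : R => 0 <= x)) ?sqr_ge0 ?lexx ?if_same//.
  - apply: aeW => x n _; rewrite lee_fin ger0_norm ?sqr_ge0//.
    case: ifP => xK.
      rewrite -real_normK ?num_real// ler_pXn2r ?nnegrE ?mulr_ge0//.
      apply: (le_trans (ler_normB _ _)); rewrite mulr2n mulrDl mul1r.
      exact: lerD.
    have Kx : K < `|x : R| by rewrite ltNge xK.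
    have Dn := dD n.
    rewrite q0; last by apply: le_lt_trans Kx; rewrite /K lerDl addr_ge0.
    rewrite q0 ?subrr ?expr0n//.
    have := lerB_dist (x : R) (d_ n); move: Kx; rewrite /K; lra.
have := cvge0_near_lt e16 qcvg; apply: filterS => n qn.
pose r := fun x => p x - q x.
have mr : measurable_fun setT r by exact: measurable_funB.
have rr : (\int[leb1]_x ((r x - r (x - d_ n)%R) ^+ 2)%:E <= (e / 4)%:E)%E.
  have := integral_sqD_le mr (measurable_funN (mtr r (d_ n) mr)).
  move=> /le_trans; apply.
  under [X in (_ + _ * X <= _)%E]eq_integral do rewrite /= sqrrN.
  have mr2 : measurable_fun setT (fun x => (r x ^+ 2)%:E).
    by apply/measurable_EFinP; exact: measurable_funX.
  have r20 x : (0 <= (r x ^+ 2)%:E)%E by rewrite lee_fin sqr_ge0.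
  rewrite (@ge0_integral_translation (fun x => (r x ^+ 2)%:E) (d_ n) mr2 r20).
  apply: (@le_trans _ _ (2%:E * (e / 16)%:E + 2%:E * (e / 16)%:E)%E).
    by apply: leeD; rewrite lee_pmul2l.
  by rewrite -!EFinM -EFinD lee_fin; lra.
have mqt : measurable_fun setT (fun x => q x - q (x - d_ n)).
  by apply: measurable_funB => //; exact: mtr.
have mrt : measurable_fun setT (fun x => r x - r (x - d_ n)).
  by apply: measurable_funB => //; exact: mtr.
apply: (@le_trans _ _ (2%:E * (e / 16)%:E + 2%:E * (e / 4)%:E)%E); last first.
  by rewrite -!EFinM -EFinD lee_fin; lra.
have := integral_sqD_le mqt mrt.
have -> : (\int[leb1]_x ((q x - q (x - d_ n) + (r x - r (x - d_ n))) ^+ 2)%:E =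
    \int[leb1]_x ((p x - p (x - d_ n)) ^+ 2)%:E)%E.
  by apply: eq_integral => x _; congr (_ ^+ 2)%:E; rewrite /r; ring.
by move=> /le_trans; apply; apply: leeD; rewrite lee_pmul2l// ltW.
Qed.

End translation_continuity.

Section plancherel_real.
Context {R : realType}.
Local Notation R' := (measurableTypeR R).
Local Notation leb1 := (@lebesgue_measure R).
Context (p : R' -> R) (mp : measurable_fun setT p).
Hypothesis p1 : (\int[leb1]_x (`|p x|)%:E < +oo)%E.
Hypothesis p2 : (\int[leb1]_x (p x ^+ 2)%:E < +oo)%E.

(** The autocorrelation of [p]. *)
Let A (d : R') : R := \int[leb1]_x (p x * p (x - d)).

Let mpt (d : R) : measurable_fun [set: R'] (fun x => p (x - d)).
Proof. exact: (measurableT_comp mp (measurable_translation d)). Qed.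

Let mpp : measurable_fun [set: R' * R'] (fun z => p z.2 * p (z.2 - z.1)).
Proof.
apply: measurable_funM; first exact: (measurableT_comp mp).
apply: (measurableT_comp mp).
apply: (@measurable_funB _ (R' * R')%type R setT snd fst) => //.
Qed.

Let mabs (f : R' -> R) : measurable_fun setT f ->
  measurable_fun setT (fun x => `|f x|).
Proof. by move=> mf; exact: measurableT_comp. Qed.

Let int_p_translation (x : R) : (\int[leb1]_d `|p (x - d)%R|%:E =
  \int[leb1]_x (`|p x|)%:E)%E.
Proof.
have mE : measurable_fun [set: R'] (fun x => (`|p x|)%:E).
  by apply/measurable_EFinP; exact: mabs.
have N1 : (-1 : R) != 0 by rewrite oppr_eq0 oner_eq0.
have := @ge0_integral_affine R (-1) x (fun x => (`|p x|)%:E) N1 mE.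
rewrite invrN1 normrN normr1 mul1e => <-; last by move=> y; rewrite lee_fin.
by apply: eq_integral => d _; rewrite mulN1r addrC.
Qed.

Let ipp : (leb1 \x leb1)%E.-integrable setT
  (EFin \o (fun z : R' * R' => p z.2 * p (z.2 - z.1))).
Proof.
apply: (proj2 (integrable21ltyP leb1 leb1 _)); first exact/measurable_EFinP.
have -> : (\int[leb1]_y \int[leb1]_x `|(p y * p (y - x))%:E| =
    \int[leb1]_y (`|p y|%:E * \int[leb1]_x (`|p x|)%:E))%E.
  apply: eq_integral => y _; rewrite -(int_p_translation y).
  have mpy : measurable_fun [set: R'] (fun x => p (y - x)).
    apply: (measurableT_comp mp).
    by apply: (@measurable_funB _ R' R setT (fun=> y) (fun x => x)).
  rewrite -ge0_integralZ_EFin//; last exact: mabs.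
  by apply: eq_integral => x _; rewrite /= normrM.
have I0 : (0 <= \int[leb1]_x (`|p x|)%:E)%E.
  by apply: integral_ge0 => x _; rewrite lee_fin.
rewrite ge0_integralZr//.
- by rewrite lte_mul_pinfty// ge0_fin_numE.
- by apply/measurable_EFinP; exact: mabs.
Qed.

Let int_p2_translation (d : R) : (\int[leb1]_x (p (x - d)%R ^+ 2)%:E =
  \int[leb1]_x (p x ^+ 2)%:E)%E.
Proof.
apply: (@ge0_integral_translation _ (fun x => (p x ^+ 2)%:E)).
  by apply/measurable_EFinP; exact: measurable_funX.
by move=> x; rewrite lee_fin sqr_ge0.
Qed.

Let ippd (d : R) : leb1.-integrable setT (EFin \o (fun x => p x * p (x - d))).
Proof.
apply: (@integrable_le _ _ _ leb1 _ (fun x => p x ^+ 2 + p (x - d) ^+ 2)).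
- exact: measurable_funM.
- by apply: measurable_funD; exact: measurable_funX.
- move=> x; have := sqr_ge0 (p x - p (x - d)); have := sqr_ge0 (p x + p (x - d)).
  have := sqr_ge0 (p x); have := sqr_ge0 (p (x - d)); rewrite ler_norml.
  by move: (p x) (p (x - d)) => a b; nra.
- rewrite ge0_integralD_EFin//; try exact: measurable_funX;
    try by move=> x; exact: sqr_ge0.
  by rewrite int_p2_translation; exact: lte_add_pinfty.
Qed.

Let mA : measurable_fun [set: R'] A.
Proof. exact: (@measurable_Rintegral _ _ _ _ _ leb1 _ mpp). Qed.

Let iA : leb1.-integrable setT (EFin \o A).
Proof.
have := integrable_fubini_F ipp; apply: eq_integrable => // d _.
by rewrite /= EFin_Rintegral.
Qed.

Let A0E : A 0 = fine (\int[leb1]_x (p x ^+ 2)%:E).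
Proof.
by rewrite /A /Rintegral; congr fine; apply: eq_integral => x _; rewrite subr0.
Qed.

Let ip2 : leb1.-integrable setT (EFin \o (fun x => p x ^+ 2)).
Proof.
apply: (@integrable_le _ _ _ leb1 _ (fun x => p x ^+ 2)) => //.
- exact: measurable_funX.
- exact: measurable_funX.
- by move=> x; rewrite ger0_norm// sqr_ge0.
Qed.

Let ip2t (d : R) : leb1.-integrable setT (EFin \o (fun x => p (x - d) ^+ 2)).
Proof.
apply: (@integrable_le _ _ _ leb1 _ (fun x => p (x - d) ^+ 2)) => //.
- exact: measurable_funX.
- exact: measurable_funX.
- by move=> x; rewrite ger0_norm// sqr_ge0.
- by rewrite int_p2_translation.
Qed.

(** Continuity of the autocorrelation at the origin is thus continuity of
    translations. *)
Let Adiff (d : R) :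
  (2 * (A 0 - A d))%:E = (\int[leb1]_x ((p x - p (x - d)%R) ^+ 2)%:E)%E.
Proof.
have i2 : leb1.-integrable setT
    (EFin \o (fun x => 2 * (p x * p (x - d)))).
  have := integrableZl measurableT 2 (ippd d).
  by apply: eq_integrable => // x _ /=.
have i12 := integrableB measurableT ip2 i2.
have iD := integrableD measurableT i12 (ip2t d).
rewrite -EFin_Rintegral; last first.
  have := iD; apply: eq_integrable => // x _ /=.
  by rewrite -EFinB -EFinD; congr EFin; ring.
congr EFin.
transitivity (\int[leb1]_x ((p x ^+ 2 - 2 * (p x * p (x - d))) + p (x - d) ^+ 2)).
  rewrite RintegralD// RintegralB// RintegralZl// -/(A d).
  have -> : \int[leb1]_x (p (x - d) ^+ 2) = A 0.
    by rewrite A0E /Rintegral int_p2_translation.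
  have -> : \int[leb1]_x (p x ^+ 2) = A 0 by rewrite A0E.
  ring.
by apply: eq_Rintegral => x _; ring.
Qed.

Let A_le (d : R) : `|A d| <= 2 * A 0.
Proof.
apply: (le_trans (le_normr_Rintegral measurableT (ippd d))).
have -> : 2 * A 0 = \int[leb1]_x (p x ^+ 2 + p (x - d) ^+ 2).
  rewrite RintegralD//.
  have -> : \int[leb1]_x (p (x - d) ^+ 2) = A 0.
    by rewrite A0E /Rintegral int_p2_translation.
  have -> : \int[leb1]_x (p x ^+ 2) = A 0 by rewrite A0E.
  by rewrite mulr2n mulrDl mul1r.
apply: le_Rintegral => //.
- exact: (integrable_norm (ippd d)).
- have := integrableD measurableT ip2 (ip2t d).
  by apply: eq_integrable => // x _ /=; rewrite EFinD.
- move=> x _; have := sqr_ge0 (p x - p (x - d)).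
  have := sqr_ge0 (p x + p (x - d)).
  have := sqr_ge0 (p x); have := sqr_ge0 (p (x - d)); rewrite ler_norml.
  by move: (p x) (p (x - d)) => a b; nra.
Qed.

Let A_cvg (u : R^nat) : u @ \oo --> 0 -> A (u n) @[n --> \oo] --> A 0.
Proof.
move=> u0; have /fine_cvgP[_ /= Dcvg] := cvg_integral_translation mp p2 u0.
have -> : (fun n => A (u n)) = (fun n => A 0 - 2^-1 *
    fine (\int[leb1]_x ((p x - p (x - u n)%R) ^+ 2)%:E)%E).
  by apply/funext => n; rewrite -Adiff /=; field.
rewrite -[X in _ --> X]subr0 -[X in _ --> _ - X](mulr0 2^-1).
by apply: cvgB; [exact: cvg_cst|apply: cvgM => //; exact: cvg_cst].
Qed.

Let Cp (b : R) := \int[leb1]_x (p x * cos (b * x)).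
Let Sp (b : R) := \int[leb1]_x (p x * sin (b * x)).

Let ip : leb1.-integrable setT (EFin \o p).
Proof. by apply/integrableP; split; [exact/measurable_EFinP|]. Qed.

Let ipb (h : R -> R) : measurable_fun [set: R] h -> (forall x, `|h x| <= 1) ->
  leb1.-integrable setT (EFin \o (fun x => p x * h x)).
Proof.
move=> mh h1; apply: (@integrable_le _ _ _ leb1 _ (fun x => `|p x|)) => //.
- exact: measurable_funM.
- exact: mabs.
- by move=> x; rewrite normrM ler_piMr.
Qed.

Let cosn (x : R) : `|cos x| <= 1. Proof. by rewrite ler_norml cos_le1 cos_geN1. Qed.
Let sinn (x : R) : `|sin x| <= 1. Proof. by rewrite ler_norml sin_le1 sin_geN1. Qed.

(** The power spectrum of [p]: Fubini's theorem and the addition formula for the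
    cosine. *)
Let CA (b : R) : \int[leb1]_d (A d * cos (b * d)) = Cp b ^+ 2 + Sp b ^+ 2.
Proof.
have mcos : measurable_fun [set: R] (@cos R).
  by apply: continuous_measurable_fun; exact: continuous_cos.
have ipc : leb1.-integrable setT (EFin \o (fun x => p x * cos (b * x))).
  by apply: ipb => //; exact: measurable_cosM.
have ips : leb1.-integrable setT (EFin \o (fun x => p x * sin (b * x))).
  by apply: ipb => //; exact: measurable_sinM.
transitivity (\int[leb1]_d \int[leb1]_x (p x * p (x - d) * cos (b * d))).
  by apply: eq_Rintegral => d _; rewrite RintegralZr.
rewrite (@Rintegral_swap _ _ _ _ _ leb1 leb1
  (fun z => p z.2 * p (z.2 - z.1) * cos (b * z.1))); last first.
  apply: (le_integrable measurableT _ _ ipp).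
    apply/measurable_EFinP; apply: measurable_funM => //.
    by apply: (measurableT_comp mcos); exact: measurable_funM.
  by move=> z _ /=; rewrite lee_fin normrM ler_piMr.
transitivity (\int[leb1]_x (p x * cos (b * x) * Cp b + p x * sin (b * x) * Sp b)).
  apply: eq_Rintegral => x _ /=.
  pose f (y : R) := p y * cos (b * (x - y)).
  have mbx : measurable_fun [set: R] (fun y => cos (b * (x - y))).
    apply: (measurableT_comp mcos); apply: measurable_funM => //.
    exact: measurable_funB.
  have fi : leb1.-integrable setT (EFin \o f) by exact: ipb.
  have N1 : (-1 : R) != 0 by rewrite oppr_eq0 oner_eq0.
  transitivity (p x * \int[leb1]_y f y).
    have := Rintegral_affine x N1 fi; rewrite invrN1 normrN normr1 mul1r => <-.
    rewrite -RintegralZl//; last exact: (integrable_affine x N1 fi).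
    apply: eq_Rintegral => d _; rewrite /f mulN1r -mulrA; congr (_ * (p _ * cos _)).
      by rewrite addrC.
    by rewrite opprD opprK addrCA subrr addr0.
  have -> : \int[leb1]_y f y = cos (b * x) * Cp b + sin (b * x) * Sp b.
    rewrite /Cp /Sp -!RintegralZl// -RintegralD//; first last.
    - have := integrableZl measurableT (sin (b * x)) ips.
      by apply: eq_integrable => // y _ /=; rewrite EFinM.
    - have := integrableZl measurableT (cos (b * x)) ipc.
      by apply: eq_integrable => // y _ /=; rewrite EFinM.
    apply: eq_Rintegral => y _; rewrite /f mulrBr cosB; ring.
  by ring.
rewrite RintegralD//.
- by rewrite !RintegralZr// ?expr2.
- have := integrableZr measurableT (Cp b) ipc.
  by apply: eq_integrable => // y _ /=; rewrite EFinM.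
- have := integrableZr measurableT (Sp b) ips.
  by apply: eq_integrable => // y _ /=; rewrite EFinM.
Qed.

(** Plancherel's identity on the line, for the cosine and sine transforms of
    an integrable and square-integrable function: by [CA] it is Abel summation
    of the cosine transform of the autocorrelation of [p], whose value at the
    origin is the square norm of [p]. *)
Lemma plancherel_real :
  (\int[leb1]_xi ((\int[leb1]_x (p x * cos (2 * pi * xi * x))) ^+ 2 +
    (\int[leb1]_x (p x * sin (2 * pi * xi * x))) ^+ 2)%:E =
   \int[leb1]_x (p x ^+ 2)%:E)%E.
Proof.
transitivity (\int[leb1]_xi (\int[leb1]_x (A x * cos (2 * pi * xi * x)))%:E)%E.
  by apply: eq_integral => xi _; rewrite CA.
rewrite (@integral_cos_transform _ A (2 * A 0))//.
- by rewrite A0E fineK// ge0_fin_numE// integral_ge0// => x _; rewrite lee_fin sqr_ge0.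
- by move=> xi; rewrite CA addr_ge0// sqr_ge0.
Qed.

End plancherel_real.

(** * The right-sided Fourier transform *)

Section characters.
Context {R : realType}.

(** [e^(- theta j)]; the sign is that of the Fourier kernel. *)
Definition chj (theta : R) : quat R := expq (unit_j R) (- theta).

Lemma chjE theta : chj theta = Quat (cos theta) 0 (- sin theta) 0.
Proof. by apply: quat_ext; rewrite /chj /expq /= cosN sinN; ring. Qed.

Lemma normsq_chj theta : normsq (chj theta) = 1.
Proof.
rewrite chjE /normsq /= sqrrN !expr0n /= !addr0.
by rewrite cos2Dsin2.
Qed.

Lemma absq_chj theta : absq (chj theta) = 1.
Proof. by rewrite absqE normsq_chj sqrtr1. Qed.

Lemma chjD a b : chj (a + b) = chj a * chj b.
Proof. by apply: quat_ext; rewrite !chjE /= ?cosD ?sinD; ring. Qed.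

Lemma chj0 : chj 0 = 1.
Proof. by apply: quat_ext; rewrite chjE /= ?cos0 ?sin0 ?oppr0. Qed.

Lemma chjN a : chj (- a) = conjq (chj a).
Proof. by apply: quat_ext; rewrite !chjE /= ?cosN ?sinN ?oppr0. Qed.

Lemma charq_jE m (u x : vec R m) :
  charq (unit_j R) u x = chj (2 * pi * dotv u x).
Proof. by []. Qed.

Lemma measurable_chj d (T : measurableType d) (h : T -> R) :
  measurable_fun setT h -> measurableq (fun t => chj (h t)).
Proof.
move=> mh; under eq_fun do rewrite chjE; split => //=.
- apply: (measurableT_comp _ mh).
  by apply: continuous_measurable_fun; exact: continuous_cos.
- apply: measurable_funN; apply: (measurableT_comp _ mh).
  by apply: continuous_measurable_fun; exact: continuous_sin.
Qed.

Lemma measurable_dotv d (T : measurableType d) m (h1 h2 : T -> vec R m) :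
  measurable_fun setT h1 -> measurable_fun setT h2 ->
  measurable_fun setT (fun t => dotv (h1 t) (h2 t)).
Proof.
move=> m1 m2; rewrite /dotv.
apply: measurable_sum => i; apply: measurable_funM.
  exact: (measurableT_comp (measurable_tnth i) m1).
exact: (measurableT_comp (measurable_tnth i) m2).
Qed.

Lemma measurableq_charj d (T : measurableType d) m (h1 h2 : T -> vec R m) :
  measurable_fun setT h1 -> measurable_fun setT h2 ->
  measurableq (fun t => charq (unit_j R) (h1 t) (h2 t)).
Proof.
move=> m1 m2; apply: measurable_chj; apply: measurable_funM => //.
exact: measurable_dotv.
Qed.

Lemma dotv_consv m (a b : R) (x y : vec R m) :
  dotv (consv (a : measurableTypeR R, x)) (consv (b : measurableTypeR R, y)) =
  a * b + dotv x y.
Proof.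
rewrite /dotv big_ord_recl; congr (_ + _); apply: eq_bigr => i _.
by rewrite !tnthS.
Qed.

End characters.

Lemma ge0_integralD4_EFin d (T : measurableType d) (R : realType)
    (mu : {measure set T -> \bar R}) (u1 u2 u3 u4 : T -> R) :
  measurable_fun setT u1 -> measurable_fun setT u2 ->
  measurable_fun setT u3 -> measurable_fun setT u4 ->
  (forall x, 0 <= u1 x) -> (forall x, 0 <= u2 x) ->
  (forall x, 0 <= u3 x) -> (forall x, 0 <= u4 x) ->
  (\int[mu]_x (u1 x + u2 x + u3 x + u4 x)%:E = \int[mu]_x (u1 x)%:E +
   \int[mu]_x (u2 x)%:E + \int[mu]_x (u3 x)%:E + \int[mu]_x (u4 x)%:E)%E.
Proof.
move=> m1 m2 m3 m4 p1 p2 p3 p4.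
have m12 : measurable_fun setT (fun x => u1 x + u2 x) by exact: measurable_funD.
have m123 : measurable_fun setT (fun x => u1 x + u2 x + u3 x).
  exact: measurable_funD.
rewrite (ge0_integralD_EFin mu m123 m4)//; last by move=> x; rewrite !addr_ge0.
rewrite (ge0_integralD_EFin mu m12 m3)//; last by move=> x; rewrite !addr_ge0.
by rewrite (ge0_integralD_EFin mu m1 m2).
Qed.

Section plancherel_line.
Context {R : realType}.
Local Notation R' := (measurableTypeR R).
Local Notation leb1 := (@lebesgue_measure R).

Let C (p : R' -> R) (xi : R) := \int[leb1]_x (p x * cos (2 * pi * xi * x)).
Let S (p : R' -> R) (xi : R) := \int[leb1]_x (p x * sin (2 * pi * xi * x)).

Definition fourier1 (f : R' -> quat R) (xi : R') : quat R :=
  intq leb1 (fun x => f x * chj (2 * pi * ((xi : R) * x))).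

Let CN p xi : C p (- xi) = C p xi.
Proof. by apply: eq_Rintegral => x _; rewrite mulrN mulNr cosN. Qed.

Let SN p xi : leb1.-integrable setT (EFin \o p) -> S p (- xi) = - S p xi.
Proof.
move=> ip; have -> : - S p xi = -1 * S p xi by rewrite mulN1r.
rewrite /S -RintegralZl//.
  by apply: eq_Rintegral => x _; rewrite mulrN mulNr sinN mulrN mulN1r.
have /integrableP[/measurable_EFinP mp pfin] := ip.
apply: (@integrable_le _ _ _ leb1 _ (fun x => `|p x|)) => //.
- by apply: measurable_funM => //; exact: measurable_sinM.
- exact: measurableT_comp.
- by move=> x; rewrite normrM ler_piMr// ler_norml sin_le1 sin_geN1.
Qed.

Let mCS (p : R' -> R) : measurable_fun setT p ->
  measurable_fun [set: R'] (C p) /\ measurable_fun [set: R'] (S p).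
Proof.
move=> mp; have mxx : measurable_fun [set: R' * R'] (fun z => 2 * pi * z.1 * z.2).
  by apply: measurable_funM => //; exact: measurable_funM.
split.
- apply: (@measurable_Rintegral _ _ _ _ _ leb1
    (fun z => p z.2 * cos (2 * pi * z.1 * z.2))).
  apply: measurable_funM; first exact: (measurableT_comp mp).
  apply: (measurableT_comp _ mxx).
  by apply: continuous_measurable_fun; exact: continuous_cos.
- apply: (@measurable_Rintegral _ _ _ _ _ leb1
    (fun z => p z.2 * sin (2 * pi * z.1 * z.2))).
  apply: measurable_funM; first exact: (measurableT_comp mp).
  apply: (measurableT_comp _ mxx).
  by apply: continuous_measurable_fun; exact: continuous_sin.
Qed.

Lemma measurableq_fourier1 f : measurableq f -> measurableq (fourier1 f).
Proof.
move=> mf; apply: (@measurableq_intq _ _ _ _ _ leb1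
  (fun z : R' * R' => f z.2 * chj (2 * pi * ((z.1 : R) * z.2)))).
apply: measurableqM.
  by apply: (measurableq_comp _ mf); exact: measurable_snd.
by apply: measurable_chj; do 2 apply: measurable_funM => //.
Qed.

(** The integral of [N] is also that of its even part. *)
Let integral_even_part (N Sg : R' -> R) : measurable_fun setT N ->
  measurable_fun setT Sg -> (forall xi, 0 <= N xi) -> (forall xi, 0 <= Sg xi) ->
  (forall xi : R, N xi + N (- xi) = 2 * Sg xi) ->
  (\int[leb1]_xi (Sg xi)%:E < +oo)%E ->
  (\int[leb1]_xi (N xi)%:E = \int[leb1]_xi (Sg xi)%:E)%E.
Proof.
move=> mN mSg N0 Sg0 sum2 Sgfin.
have N1 : (-1 : R) != 0 by rewrite oppr_eq0 oner_eq0.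
have mNE : measurable_fun setT (fun xi => (N xi)%:E) by exact/measurable_EFinP.
have NE0 xi : (0 <= (N xi)%:E)%E by rewrite lee_fin.
have mNN : measurable_fun setT (fun xi : R' => N (- (xi : R))).
  by apply: (measurableT_comp mN); exact: (@oppr_measurable R).
have refl : (\int[leb1]_xi (N (- (xi : R))%R)%:E = \int[leb1]_xi (N xi)%:E)%E.
  have := ge0_integral_affine 0 N1 mNE NE0.
  rewrite invrN1 normrN normr1 mul1e => <-.
  by apply: eq_integral => x _; rewrite addr0 mulN1r.
have dbl : (\int[leb1]_xi (N xi)%:E + \int[leb1]_xi (N xi)%:E =
    \int[leb1]_xi (Sg xi)%:E + \int[leb1]_xi (Sg xi)%:E)%E.
  rewrite -{2}refl -(ge0_integralD_EFin leb1 mN mNN)//.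
  rewrite -(ge0_integralD_EFin leb1 mSg mSg)//.
  by apply: eq_integral => xi _; rewrite sum2 mulr2n mulrDl mul1r.
have Sgfn : (\int[leb1]_xi (Sg xi)%:E)%E \is a fin_num.
  by rewrite ge0_fin_numE// integral_ge0// => x _; rewrite lee_fin.
have N00 : (0 <= \int[leb1]_xi (N xi)%:E)%E.
  by apply: integral_ge0 => x _; rewrite lee_fin.
have Nfn : (\int[leb1]_xi (N xi)%:E)%E \is a fin_num.
  rewrite ge0_fin_numE//.
  apply: (@le_lt_trans _ _ (\int[leb1]_xi (Sg xi)%:E + \int[leb1]_xi (Sg xi)%:E)%E).
    by rewrite -dbl leeDl.
  exact: lte_add_pinfty.
move: dbl; rewrite -(fineK Sgfn) -(fineK Nfn) -!EFinD => -[h]; congr EFin; lra.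
Qed.

(** Each component of the transform mixes the cosine transform of a component of
    [f] with the sine transform of another one.  The cross terms are odd in the
    frequency, hence cancel in [integral_even_part], and [plancherel_real]
    applies to each component. *)
Lemma plancherel1 f : integrableq leb1 f -> finite_energy leb1 f ->
  energy leb1 (fourier1 f) = energy leb1 f.
Proof.
move=> fi [mf ef]; have [ia ib ic id] := integrableq_comp fi.
set a := fun x => qre (f x) in ia; set b := fun x => qim_i (f x) in ib.
set c := fun x => qim_j (f x) in ic; set e := fun x => qim_k (f x) in id.
have [ma mb mc me] := mf.
have int_cos p xi : leb1.-integrable setT (EFin \o p) ->
    leb1.-integrable setT (EFin \o (fun x => p x * cos (2 * pi * xi * x))).
  move=> /integrableP[/measurable_EFinP mp pfin].
  apply: (@integrable_le _ _ _ leb1 _ (fun x => `|p x|)) => //.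
  - by apply: measurable_funM => //; exact: measurable_cosM.
  - exact: measurableT_comp.
  - by move=> x; rewrite normrM ler_piMr// ler_norml cos_le1 cos_geN1.
have int_sin p xi : leb1.-integrable setT (EFin \o p) ->
    leb1.-integrable setT (EFin \o (fun x => p x * sin (2 * pi * xi * x))).
  move=> /integrableP[/measurable_EFinP mp pfin].
  apply: (@integrable_le _ _ _ leb1 _ (fun x => `|p x|)) => //.
  - by apply: measurable_funM => //; exact: measurable_sinM.
  - exact: measurableT_comp.
  - by move=> x; rewrite normrM ler_piMr// ler_norml sin_le1 sin_geN1.
have FE xi : fourier1 f xi = Quat (C a xi + S c xi) (C b xi + S e xi)
    (C c xi - S a xi) (C e xi - S b xi).
  rewrite /fourier1 /intq /C /S.
  rewrite -!RintegralD//; try exact: int_cos; try exact: int_sin.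
  rewrite -!RintegralB//; try exact: int_cos; try exact: int_sin.
  by congr Quat; apply: eq_Rintegral => x _; rewrite chjE /= !mulrA /a /b /c /e; ring.
pose Sg xi := (C a xi ^+ 2 + S a xi ^+ 2) + (C b xi ^+ 2 + S b xi ^+ 2) +
  (C c xi ^+ 2 + S c xi ^+ 2) + (C e xi ^+ 2 + S e xi ^+ 2).
have sum2 xi : normsq (fourier1 f xi) + normsq (fourier1 f (- xi)) = 2 * Sg xi.
  by rewrite !FE /normsq /= !CN !SN// /Sg; ring.
have comp2 (p : R' -> R) : measurable_fun setT p ->
    (forall x, p x ^+ 2 <= normsq (f x)) -> (\int[leb1]_x (p x ^+ 2)%:E < +oo)%E.
  move=> mp pf; apply: le_lt_trans ef; apply: le_integral_EFin => //.
  - exact: measurable_funX.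
  - exact: measurable_normsq.
  - by move=> x; exact: sqr_ge0.
have comp1 (p : R' -> R) : leb1.-integrable setT (EFin \o p) ->
    (\int[leb1]_x (`|p x|)%:E < +oo)%E by case/integrableP.
have sq (x : R') : [/\ a x ^+ 2 <= normsq (f x), b x ^+ 2 <= normsq (f x),
    c x ^+ 2 <= normsq (f x) & e x ^+ 2 <= normsq (f x)].
  rewrite /normsq -/(a x) -/(b x) -/(c x) -/(e x).
  have := sqr_ge0 (a x); have := sqr_ge0 (b x); have := sqr_ge0 (c x).
  by have := sqr_ge0 (e x); split; lra.
have mCS2 (p : R' -> R) : measurable_fun setT p ->
    measurable_fun [set: R'] (fun xi => C p xi ^+ 2 + S p xi ^+ 2).
  by move=> /mCS[mC mS]; apply: measurable_funD; exact: measurable_funX.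
have ISg : (\int[leb1]_xi (Sg xi)%:E = energy leb1 f)%E.
  have ge0 (p : R' -> R) xi : 0 <= C p xi ^+ 2 + S p xi ^+ 2.
    by rewrite addr_ge0 ?sqr_ge0.
  have ma' : measurable_fun setT a by [].
  have mb' : measurable_fun setT b by [].
  have mc' : measurable_fun setT c by [].
  have me' : measurable_fun setT e by [].
  rewrite (ge0_integralD4_EFin leb1 (mCS2 _ ma') (mCS2 _ mb') (mCS2 _ mc')
    (mCS2 _ me'))//.
  have -> : energy leb1 f = (\int[leb1]_x (a x ^+ 2)%:E +
      \int[leb1]_x (b x ^+ 2)%:E + \int[leb1]_x (c x ^+ 2)%:E +
      \int[leb1]_x (e x ^+ 2)%:E)%E.
    by apply: ge0_integralD4_EFin; try exact: measurable_funX;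
      move=> x; exact: sqr_ge0.
  have pl (p : R' -> R) : measurable_fun setT p ->
      leb1.-integrable setT (EFin \o p) -> (forall x, p x ^+ 2 <= normsq (f x)) ->
      (\int[leb1]_xi (C p xi ^+ 2 + S p xi ^+ 2)%:E =
       \int[leb1]_x (p x ^+ 2)%:E)%E.
    by move=> mp ip pf; apply: plancherel_real => //; [exact: comp1|exact: comp2].
  by rewrite !pl//; move=> x; have [] := sq x.
have mF := measurable_normsq (measurableq_fourier1 mf).
have N0 xi : 0 <= normsq (fourier1 f xi) by exact: normsq_ge0.
have mSg : measurable_fun [set: R'] Sg.
  have m1 := measurable_funD (mCS2 _ ma) (mCS2 _ mb).
  have m2 := measurable_funD m1 (mCS2 _ mc).
  exact: (measurable_funD m2 (mCS2 _ me)).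
rewrite /energy -[RHS]ISg; apply: integral_even_part => //.
- by move=> xi; rewrite !addr_ge0// sqr_ge0.
- by rewrite ISg.
Qed.

End plancherel_line.

Section fubini_extra.
Context d1 d2 (T1 : measurableType d1) (T2 : measurableType d2) (R : realType).
Context (m1 : {sigma_finite_measure set T1 -> \bar R}).
Context (m2 : {sigma_finite_measure set T2 -> \bar R}).
Context (u : T1 * T2 -> R) (mu : measurable_fun setT u) (u0 : forall z, 0 <= u z).

Let muE : measurable_fun [set: T1 * T2] (fun z => (u z)%:E).
Proof. exact/measurable_EFinP. Qed.

Let u0E z : (0 <= (u z)%:E)%E. Proof. by rewrite lee_fin. Qed.

Lemma tonelli_EFin : (\int[m1]_x \int[m2]_y (u (x, y))%:E =
  \int[m2]_y \int[m1]_x (u (x, y))%:E)%E.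
Proof. by have := @fubini_tonelli _ _ _ _ _ m1 m2 _ muE u0E; rewrite /fubini_F /fubini_G. Qed.

Lemma measurable_integral1 :
  measurable_fun setT (fun x => \int[m2]_y (u (x, y))%:E)%E.
Proof. exact: (@measurable_fun_fubini_tonelli_F _ _ _ _ _ m2 _ muE u0E). Qed.

Lemma measurable_integral2 :
  measurable_fun setT (fun y => \int[m1]_x (u (x, y))%:E)%E.
Proof. exact: (@measurable_fun_fubini_tonelli_G _ _ _ _ _ m1 _ muE u0E). Qed.

Hypothesis ufin : (\int[m1]_x \int[m2]_y (u (x, y))%:E < +oo)%E.

Let ui : (m1 \x m2)%E.-integrable setT (fun z => (u z)%:E).
Proof.
apply: (proj2 (integrable12ltyP m1 m2 muE)).
apply: le_lt_trans ufin; rewrite le_eqVlt; apply/orP; left; apply/eqP.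
by apply: eq_integral => x _; apply: eq_integral => y _; rewrite /= ger0_norm.
Qed.

Lemma ae_integral_lty1 : {ae m1, forall x, (\int[m2]_y (u (x, y))%:E < +oo)%E}.
Proof.
apply: filterS (ae_integrable1 ui) => x /integrableP[_].
by under eq_integral do rewrite /= ger0_norm//.
Qed.

Lemma ae_integral_lty2 : {ae m2, forall y, (\int[m1]_x (u (x, y))%:E < +oo)%E}.
Proof.
apply: filterS (ae_integrable2 ui) => y /integrableP[_].
by under eq_integral do rewrite /= ger0_norm//.
Qed.

End fubini_extra.

Section intq_leb_cons.
Context {R : realType} (m : nat).
Local Notation R' := (measurableTypeR R).
Local Notation leb1 := (@lebesgue_measure R).

Lemma integrableq2_cons (g : vec R m.+1 -> quat R) :
  integrableq (leb R m.+1) g ->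
  integrableq2 leb1 (leb R m) (fun z => g (consv z)).
Proof.
move=> [mg gfin]; split.
  by apply: (measurableq_comp _ mg); exact: measurable_consv.
rewrite -(@ge0_integral_leb_cons R m (fun z => (absq (g z))%:E))//.
- by apply/measurable_EFinP; exact: measurable_absq.
- by move=> z; rewrite lee_fin absq_ge0.
Qed.

Let ge0_integral_leb_prod (F : vec R m.+1 -> \bar R) :
  measurable_fun setT F -> (forall z, 0 <= F z)%E ->
  (\int[leb R m.+1]_z F z = \int[(leb1 \x leb R m)%E]_z F (consv z))%E.
Proof. by move=> mF F0; rewrite [LHS]ge0_integral_image. Qed.

Let Rintegral_cons (u : vec R m.+1 -> R) :
  (leb R m.+1).-integrable setT (EFin \o u) ->
  \int[leb R m.+1]_z u z = \int[leb1]_a \int[leb R m]_x u (consv (a, x)).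
Proof.
move=> iu; have /integrableP[mu ufin] := iu.
have iuc : (leb1 \x leb R m)%E.-integrable setT (EFin \o (u \o @consv R m)).
  have mc := @measurable_consv R m.
  apply: (proj2 (integrable12ltyP leb1 (leb R m) _)).
    exact: (measurableT_comp mu mc).
  move: ufin; rewrite (@ge0_integral_leb_cons R m (fun z => `|(u z)%:E|%E))//.
  exact: measurableT_comp.
rewrite {1}/Rintegral.
have -> : (\int[leb R m.+1]_z (u z)%:E =
    \int[(leb1 \x leb R m)%E]_z (u (consv z))%:E)%E.
  rewrite integralE [RHS]integralE; congr (_ - _)%E.
  - rewrite (ge0_integral_leb_prod (measurable_funepos mu)); last first.
      by move=> y; exact: funepos_ge0.
    by apply: eq_integral => z _; rewrite !funeposE.
  - rewrite (ge0_integral_leb_prod (measurable_funeneg mu)); last first.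
      by move=> y; exact: funeneg_ge0.
    by apply: eq_integral => z _; rewrite !funenegE.
rewrite -(integral12_prod_meas1 iuc) /Rintegral; congr fine.
apply: ae_eq_integral => //.
- exact: (measurable_fubini_F iuc).
- apply/measurable_EFinP.
  apply: (@measurable_Rintegral _ _ _ _ _ (leb R m) (fun z => u (consv z))).
  by apply/measurable_EFinP; exact: (measurable_int _ iuc).
- apply: filterS (ae_integrable1 iuc) => x ix _.
  by rewrite /fubini_F /= fineK//; exact: (integrable_fin_num measurableT ix).
Qed.

Lemma intq_cons (g : vec R m.+1 -> quat R) : integrableq (leb R m.+1) g ->
  intq (leb R m.+1) g =
  intq leb1 (fun a => intq (leb R m) (fun x => g (consv (a, x)))).
Proof.
by move=> /integrableq_comp[? ? ? ?]; congr Quat; exact: Rintegral_cons.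
Qed.

End intq_leb_cons.

Section right_fourier.
Context {R : realType}.
Local Notation R' := (measurableTypeR R).
Local Notation leb1 := (@lebesgue_measure R).

Definition rfourier m (f : vec R m -> quat R) (w : vec R m) : quat R :=
  intq (leb R m) (fun z => f z * charq (unit_j R) w z).

Lemma measurableq_rfourier m (f : vec R m -> quat R) :
  measurableq f -> measurableq (rfourier f).
Proof.
move=> mf; apply: (@measurableq_intq _ _ _ _ _ (leb R m)
  (fun z => f z.2 * charq (unit_j R) z.1 z.2)).
apply: measurableqM; first exact: (measurableq_comp measurable_snd mf).
by apply: measurableq_charj.
Qed.

Lemma absq_charj m (w z : vec R m) : absq (charq (unit_j R) w z) = 1.
Proof. by rewrite charq_jE absq_chj. Qed.

Lemma integrableq_charj m (f : vec R m -> quat R) w :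
  integrableq (leb R m) f ->
  integrableq (leb R m) (fun z => f z * charq (unit_j R) w z).
Proof.
move=> fi; have [mf _] := fi; apply: (le_integrableq _ _ fi).
  by apply: measurableqM => //; exact: measurableq_charj.
by move=> z; rewrite absqM absq_charj mulr1.
Qed.

Let energy_cons m (f : vec R m.+1 -> quat R) : measurableq f ->
  energy (leb R m.+1) f =
  (\int[leb1]_a energy (leb R m) (fun x => f (consv (a, x))))%E.
Proof.
move=> mf; rewrite /energy ge0_integral_leb_cons//.
- by apply/measurable_EFinP; exact: measurable_normsq.
- by move=> z; rewrite lee_fin normsq_ge0.
Qed.

Let energy_cons_swap m (f : vec R m.+1 -> quat R) : measurableq f ->
  energy (leb R m.+1) f =
  (\int[leb R m]_x energy leb1 (fun a => f (consv (a, x))))%E.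
Proof.
move=> mf; rewrite /energy ge0_integral_leb_cons_swap//.
- by apply/measurable_EFinP; exact: measurable_normsq.
- by move=> z; rewrite lee_fin normsq_ge0.
Qed.

Lemma rfourierE m (f : vec R m -> quat R) w :
  rfourier f w = intq (leb R m) (fun z => f z * charq (unit_j R) w z).
Proof. by []. Qed.

Lemma fourier1E (f : R' -> quat R) xi :
  fourier1 f xi = intq leb1 (fun x => f x * chj (2 * pi * ((xi : R) * x))).
Proof. by []. Qed.

Let plancherel0 (f : vec R 0 -> quat R) : measurableq f ->
  energy (leb R 0) (rfourier f) = energy (leb R 0) f.
Proof.
move=> mf; rewrite /energy /= !integral_dirac//; last 2 first.
- by apply/measurable_EFinP; exact: measurable_normsq.
- by apply/measurable_EFinP/measurable_normsq; exact: measurableq_rfourier.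
rewrite !diracT !mul1e; congr EFin.
have intE (u : vec R 0 -> R) : measurable_fun setT u ->
    \int[leb R 0]_z u z = u [tuple].
  move=> mu; rewrite /Rintegral /= integral_dirac//; last exact/measurable_EFinP.
  by rewrite diracT mul1e.
have [m1 m2 m3 m4] : measurableq (fun z => f z * charq (unit_j R) [tuple] z).
  by apply: measurableqM => //; exact: measurableq_charj.
have -> : rfourier f [tuple] = f [tuple] * charq (unit_j R) [tuple] [tuple].
  by apply: quat_ext; rewrite /rfourier [LHS]intE.
by rewrite normsqM charq_jE normsq_chj mulr1.
Qed.

(** One step of the induction on the dimension: [G] is the transform of [F] in
    the last variables, and its transform in the first variable is the full
    transform of [F]. *)
Section induction_step.
Context (m : nat) (F : R' * vec R m -> quat R).
Hypothesis mF : measurableq F.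
Hypothesis Fi : integrableq2 leb1 (leb R m) F.
Hypothesis Fe : (\int[leb1]_a energy (leb R m) (fun x => F (a, x))%R < +oo)%E.
Hypothesis IH : forall f : vec R m -> quat R, integrableq (leb R m) f ->
  finite_energy (leb R m) f ->
  energy (leb R m) (rfourier f) = energy (leb R m) f.

Let G (z : R' * vec R m) := rfourier (fun x => F (z.1, x)) z.2.

Lemma measurableq_partial_fourier : measurableq G.
Proof.
apply: (@measurableq_intq _ _ _ _ _ (leb R m)
  (fun z => F (z.1.1, z.2) * charq (unit_j R) z.1.2 z.2)).
apply: measurableqM.
  apply: (measurableq_comp _ mF); apply: measurable_fun_pair => //.
  exact: (measurableT_comp measurable_fst measurable_fst).
apply: measurableq_charj => //.
exact: (measurableT_comp measurable_snd measurable_fst).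
Qed.

Let mG := measurableq_partial_fourier.

Opaque rfourier fourier1 intq energy.

Let mGn : measurable_fun setT (fun z => normsq (G z)).
Proof. exact: measurable_normsq. Qed.
Let Gn0 z : 0 <= normsq (G z). Proof. exact: normsq_ge0. Qed.
Let mFn : measurable_fun setT (fun z => normsq (F z)).
Proof. exact: measurable_normsq. Qed.
Let Fn0 z : 0 <= normsq (F z). Proof. exact: normsq_ge0. Qed.

Let energy_eq d (T : measurableType d) (mu : {measure set T -> \bar R})
  (f : T -> quat R) : energy mu f = (\int[mu]_x (normsq (f x))%:E)%E.
Proof. by []. Qed.

Let Fae : {ae leb1, forall a, finite_energy (leb R m) (fun x => F (a, x))}.
Proof.
apply: filterS (ae_integral_lty1 mFn Fn0 Fe) => a Fa; split.
  by apply: (measurableq_comp _ mF); exact: pair1_measurable.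
by rewrite energy_eq.
Qed.

Let EG : (\int[leb1]_a energy (leb R m) (fun w => G (a, w))%R =
  \int[leb1]_a energy (leb R m) (fun x => F (a, x))%R)%E.
Proof.
apply: ae_eq_integral => //.
- exact: (measurable_integral1 (leb R m) mGn Gn0).
- exact: (measurable_integral1 (leb R m) mFn Fn0).
- apply: filterS2 (ae_integrableq1 Fi) Fae => a Fai Fae' _.
  exact: (IH Fai Fae').
Qed.

Let Gae : {ae leb R m, forall w, finite_energy leb1 (fun a => G (a, w))}.
Proof.
have Gfin : (\int[leb1]_a \int[leb R m]_w (normsq (G (a, w)))%:E < +oo)%E.
  by rewrite [X in (X < _)%E]EG.
apply: filterS (ae_integral_lty2 mGn Gn0 Gfin) => w Gw; split.
  by apply: (measurableq_comp _ mG); exact: pair2_measurable.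
by rewrite energy_eq.
Qed.

Let Gi w : integrableq leb1 (fun a => G (a, w)).
Proof.
have h : integrableq2 leb1 (leb R m) (fun z => F z * charq (unit_j R) w z.2).
  have [_ Ffin] := Fi; split.
    apply: (measurableqM mF).
    by apply: (@measurableq_charj _ _ _ _ (fun=> w)) => //; exact: measurable_cst.
  apply: le_lt_trans Ffin; rewrite le_eqVlt; apply/orP; left; apply/eqP.
  apply: eq_integral => a _; apply: eq_integral => x _.
  by rewrite absqM absq_charj mulr1.
exact: (integrableq_intq h).
Qed.

Let mK : measurableq (fun z : vec R m * R' => fourier1 (fun a => G (a, z.1)) z.2).
Proof.
apply: (@measurableq_intq _ _ _ _ _ leb1
  (fun z => G (z.2, z.1.1) * chj (2 * pi * ((z.1.2 : R) * z.2)))).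
apply: measurableqM.
  apply: (measurableq_comp _ mG); apply: measurable_fun_pair => //.
  exact: (measurableT_comp measurable_fst measurable_fst).
apply: measurable_chj; do 2 apply: measurable_funM => //.
exact: (measurableT_comp measurable_snd measurable_fst).
Qed.

(** The energy is preserved by the transform in the last variables, by induction,
    and, after an exchange of integrals, by that in the first one. *)
Lemma plancherel_step :
  (\int[leb R m]_w energy leb1 (fourier1 (fun a => G (a, w))) =
   \int[leb1]_a energy (leb R m) (fun x => F (a, x))%R)%E.
Proof.
transitivity (\int[leb R m]_w \int[leb1]_a (normsq (G (a, w)))%:E)%E; last first.
  by rewrite -(tonelli_EFin leb1 (leb R m) mGn Gn0); exact: EG.
apply: ae_eq_integral => //.
- apply: (@measurable_integral1 _ _ _ _ _ leb1
    (fun z => normsq (fourier1 (fun a => G (a, z.1)) z.2))).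
    exact: (measurable_normsq mK).
  by move=> z; exact: normsq_ge0.
- exact: (measurable_integral2 leb1 mGn Gn0).
- apply: filterS Gae => w Gw _.
  exact: (plancherel1 (Gi w) Gw).
Qed.

End induction_step.

Lemma plancherel m (f : vec R m -> quat R) : integrableq (leb R m) f ->
  finite_energy (leb R m) f ->
  energy (leb R m) (rfourier f) = energy (leb R m) f.
Proof.
elim: m f => [f fi [mf _]|m IH f fi [mf ef]]; first exact: plancherel0.
pose F (z : R' * vec R m) := f (consv z).
have mF : measurableq F by apply: (measurableq_comp _ mf); exact: measurable_consv.
have Fi : integrableq2 leb1 (leb R m) F by exact: integrableq2_cons.
have Fe : (\int[leb1]_a energy (leb R m) (fun x => F (a, x))%R < +oo)%E.
  by rewrite -(energy_cons mf).
pose G (z : R' * vec R m) := rfourier (fun x => F (z.1, x)) z.2.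
have rE al w : rfourier f (consv (al, w)) = fourier1 (fun a => G (a, w)) al.
  rewrite rfourierE intq_cons; last exact: integrableq_charj.
  rewrite fourier1E; apply: ae_eq_intq.
  - apply: (@measurableq_intq _ _ _ _ _ (leb R m)
      (fun z => F z * charq (unit_j R) (consv (al, w)) (consv z))).
    apply: (measurableqM mF).
    apply: (@measurableq_charj _ _ _ _ (fun=> consv (al, w)) (@consv R m)).
      exact: measurable_cst.
    exact: measurable_consv.
  - apply: measurableqM.
      apply: (measurableq_comp _ (measurableq_partial_fourier mF)).
      exact: pair2_measurable.
    by apply: measurable_chj; do 2 apply: measurable_funM => //.
  apply: filterS (ae_integrableq1 Fi) => a Fai.
  rewrite /G /= rfourierE -intqMr; last exact: integrableq_charj.
  apply: eq_intq => x; rewrite -mulrA; congr (_ * _).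
  by rewrite !charq_jE -chjD dotv_consv mulrDr addrC.
rewrite (energy_cons_swap (measurableq_rfourier mf)) (energy_cons mf).
rewrite -(plancherel_step mF Fi Fe IH); apply: eq_integral => w _.
by congr energy; apply/funext => al; exact: rE.
Qed.

End right_fourier.

(** * Completeness for the square norm *)

Section riesz_fischer.
Context d (T : measurableType d) (R : realType).
Context (mu : {measure set T -> \bar R}).

(** The weights come from iterating [|p + q|^2 <= 2 |p|^2 + 2 |q|^2] on the
    telescoping sum. *)
Lemma normsq_telescope (G : nat -> quat R) I j :
  normsq (G (I + j)%N - G I) <=
  2 * \sum_(i < j) 2 ^+ i * normsq (G (I + i).+1 - G (I + i)%N).
Proof.
elim: j I => [|j IH] I.
  by rewrite addn0 subrr normsq0 big_ord0 mulr0.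
have -> : G (I + j.+1)%N - G I = (G I.+1 - G I) + (G (I.+1 + j)%N - G I.+1).
  by rewrite addnS -addSn [RHS]addrC addrA subrK.
apply: (le_trans (normsqDle _ _)).
rewrite big_ord_recl expr0 mul1r addn0 [leRHS]mulrDr.
rewrite lerD2l// ler_pM2l//; apply: (le_trans (IH I.+1)).
rewrite big_distrr/= le_eqVlt; apply/orP; left; apply/eqP.
by apply: eq_bigr => i _; rewrite mulrA exprS /bump /= !addSn !addnS.
Qed.

Section limit.
Variable G : nat -> T -> quat R.
Hypothesis mG : forall k, measurableq (G k).
Hypothesis Gsum : forall k,
  ((2 ^+ k)%:E * energy mu (fun x => G k.+1 x - G k x)%R <=
   (1 / (2 ^ k.+1)%:R)%:E)%E.

Let D k x := 2 ^+ k * normsq (G k.+1 x - G k x).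

Let D0 k x : 0 <= D k x. Proof. by rewrite mulr_ge0 ?exprn_ge0 ?normsq_ge0. Qed.

Let mD k : measurable_fun setT (D k).
Proof.
apply: measurable_funM; first exact: measurable_cst.
by apply: measurable_normsq; exact: measurableqB.
Qed.

Let h x := (\sum_(k <oo) (D k x)%:E)%E.

Let mh : measurable_fun setT h.
Proof.
apply: ge0_emeasurable_sum => //; first by move=> k x _ _; rewrite lee_fin.
by move=> k _; apply/measurable_EFinP.
Qed.

Let h0 x : (0 <= h x)%E.
Proof. by apply: nneseries_ge0 => k _ _; rewrite lee_fin. Qed.

Let hint : (\int[mu]_x h x <= 1%:E)%E.
Proof.
rewrite integral_nneseries//.
- apply: le_trans (epsilon_trick0 xpredT (@ler01 R)).
  apply: lee_nneseries => k _.
    by move=> _; apply: integral_ge0 => x _; rewrite lee_fin.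
  have mn : measurable_fun setT (fun x => normsq (G k.+1 x - G k x)).
    by apply: measurable_normsq; exact: measurableqB.
  have c0 : 0 <= 2 ^+ k :> R by rewrite exprn_ge0.
  have n0 x : 0 <= normsq (G k.+1 x - G k x) by exact: normsq_ge0.
  by rewrite (ge0_integralZ_EFin mu mn n0 c0); exact: Gsum.
- by move=> k; apply/measurable_EFinP.
- by move=> k x _; rewrite lee_fin.
Qed.

Let b x := (h x < +oo)%E.

Let mb : measurable_fun setT b.
Proof. by apply: measurable_fun_lte => //; exact: measurable_cst. Qed.

Let aeb : {ae mu, forall x, b x}.
Proof.
have : mu.-integrable setT h.
  apply/integrableP; split=> //; under eq_integral do rewrite gee0_abs//.
  by apply: le_lt_trans hint _; rewrite ltry.
move/(integrable_ae measurableT); apply: filterS => x /(_ Logic.I).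
by rewrite /b ge0_fin_numE.
Qed.

Let K k x := if b x then G k x else 0.

Let mK k : measurableq (K k). Proof. exact: measurableq_if. Qed.

Let K_le I j x : normsq (K (I + j)%N x - K I x) <= 2 * 2^-1 ^+ I * fine (h x).
Proof.
rewrite /K; case: ifPn => bx; last first.
  rewrite subrr normsq0; apply: mulr_ge0; last exact: fine_ge0.
  by rewrite mulr_ge0// exprn_ge0.
apply: (le_trans (normsq_telescope (fun k => G k x) I j)).
rewrite -mulrA ler_pM2l// -ler_pdivrMl ?exprn_gt0 ?invr_gt0//.
rewrite -exprVn invrK -lee_fin fineK ?ge0_fin_numE// big_distrr/=.
apply: le_trans (nneseries_lim_ge (P := xpredT) (m := 0) (I + j)%N _); last first.
  by move=> k _ _; rewrite lee_fin.
rewrite sumEFin lee_fin big_mkord [leRHS]big_split_ord/=.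
rewrite -[leLHS]add0r lerD ?sumr_ge0// le_eqVlt; apply/orP; left; apply/eqP.
by apply: eq_bigr => i _; rewrite mulrA -exprD.
Qed.

Let small (H e : R) : 0 < e -> \forall k \near \oo, 2 * 2^-1 ^+ k * H < e.
Proof.
move=> e0; have c : geometric (2 * H) (2^-1 : R) @ \oo --> (0 : R).
  by apply: cvg_geometric; rewrite ger0_norm// invf_lt1// ltr1n.
have ce : \forall k \near \oo, geometric (2 * H) (2^-1 : R) k < e.
  by apply: (cvgr_lt _ c).
apply: filterS ce => k.
by rewrite /geometric /= mulrAC.
Qed.

Let K_cvg (c : quat R -> R) : (forall q, c q ^+ 2 <= normsq q) ->
  (forall p q, c (p - q) = c p - c q) -> forall x, cvgn (fun k => c (K k x)).
Proof.
move=> c2 cB x; apply/cauchy_cvgP; apply: cauchy_exP => e e0.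
have [I _ /(_ I (leqnn I)) I2] := small (fine (h x)) (exprn_gt0 2 e0).
exists (c (K I x)); exists I => //= k /= Ik.
rewrite /ball /= distrC -cB -(@ltr_pXn2r _ 2)// ?nnegrE ?(ltW e0)//.
rewrite real_normK ?num_real//; apply: le_lt_trans (c2 _) _.
by apply: le_lt_trans I2; rewrite -(subnKC Ik); exact: K_le.
Qed.

(** The steps decrease so fast that [h], the sum of the [2 ^ k |G (k+1) - G k|^2],
    is integrable.  Where [h] is finite, that is almost everywhere, [K_le] makes
    [G] a Cauchy sequence, and it bounds the distance to the limit by a small
    multiple of [h]. *)
Lemma riesz_fischer : exists g, measurableq g /\
  (energy mu (fun x => G k x - g x)%R @[k --> \oo] --> 0)%E.
Proof.
pose l (c : quat R -> R) x := limn (fun k => c (K k x)).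
pose g x := Quat (l (@qre R) x) (l (@qim_i R) x) (l (@qim_j R) x) (l (@qim_k R) x).
have sq (q : quat R) : [/\ qre q ^+ 2 <= normsq q, qim_i q ^+ 2 <= normsq q,
    qim_j q ^+ 2 <= normsq q & qim_k q ^+ 2 <= normsq q].
  have := sqr_ge0 (qre q); have := sqr_ge0 (qim_i q).
  have := sqr_ge0 (qim_j q); have := sqr_ge0 (qim_k q).
  by rewrite /normsq; split; lra.
have c1 x : cvgn (fun k => qre (K k x)).
  by apply: K_cvg => // q; have [] := sq q.
have c2 x : cvgn (fun k => qim_i (K k x)).
  by apply: K_cvg => // q; have [] := sq q.
have c3 x : cvgn (fun k => qim_j (K k x)).
  by apply: K_cvg => // q; have [] := sq q.
have c4 x : cvgn (fun k => qim_k (K k x)).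
  by apply: K_cvg => // q; have [] := sq q.
have mg : measurableq g.
  split; apply: measurable_fun_cvg.
  - by move=> k; have [m _ _ _] := mK k; exact: m.
  - by move=> x _; exact: c1.
  - by move=> k; have [_ m _ _] := mK k; exact: m.
  - by move=> x _; exact: c2.
  - by move=> k; have [_ _ m _] := mK k; exact: m.
  - by move=> x _; exact: c3.
  - by move=> k; have [_ _ _ m] := mK k; exact: m.
  - by move=> x _; exact: c4.
have Kg I x : normsq (K I x - g x) <= 2 * 2^-1 ^+ I * fine (h x).
  rewrite -normsqN opprB.
  have sqc (c : quat R -> R) : cvgn (fun k => c (K k x)) ->
      (c (K (k + I)%N x) - c (K I x)) ^+ 2 @[k --> \oo] -->
      (l c x - c (K I x)) ^+ 2.
    move=> cc; under eq_fun do rewrite expr2.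
    have dc : c (K (k + I)%N x) - c (K I x) @[k --> \oo] --> l c x - c (K I x).
      apply: cvgB; last exact: cvg_cst.
      by move: cc; rewrite -(cvg_shiftn I).
    exact: (cvgM dc dc).
  have nc : (fun k => normsq (K (k + I)%N x - K I x)) @ \oo --> normsq (g x - K I x).
    by apply: cvgD; [apply: cvgD; [apply: cvgD|]|]; exact: sqc.
  rewrite -(cvg_lim _ nc)//; apply: limr_le; first by apply/cvg_ex; eexists; exact: nc.
  by near=> k; rewrite addnC; exact: K_le.
exists g; split=> //; apply: cvge0_from_near_le => [k|e e0]; first exact: energy_ge0.
near=> I.
have -> : energy mu (fun x => G I x - g x) = energy mu (fun x => K I x - g x).
  apply: ae_eq_energy; try exact: measurableqB.
  by apply: filterS aeb => x bx; rewrite /K bx.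
apply: (@le_trans _ _ (\int[mu]_x ((2 * 2^-1 ^+ I)%:E * h x))%E).
  apply: ge0_le_integral => //.
  - by move=> x _; rewrite lee_fin normsq_ge0.
  - by apply/measurable_EFinP/measurable_normsq; exact: measurableqB.
  - by apply: emeasurable_funM => //; exact: measurable_cst.
  - move=> x _; have := Kg I x; rewrite -lee_fin => /le_trans; apply.
    rewrite EFinM lee_wpmul2l ?lee_fin ?mulr_ge0 ?exprn_ge0//.
    by case: (h x) (h0 x) => [r|_|]//; rewrite leey.
rewrite ge0_integralZl ?lee_fin ?mulr_ge0 ?exprn_ge0//.
apply: (@le_trans _ _ ((2 * 2^-1 ^+ I)%:E * 1%:E)%E).
  by apply: lee_wpmul2l; [rewrite lee_fin mulr_ge0 ?exprn_ge0|exact: hint].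
rewrite -EFinM lee_fin ltW//.
by near: I; exact: small.
Unshelve. all: by end_near. Qed.

End limit.
End riesz_fischer.

Section energy_limits.
Context d (T : measurableType d) (R : realType).
Context (mu : {measure set T -> \bar R}).
Implicit Types f g : T -> quat R.

Definition energy_cvg (F : nat -> T -> quat R) f :=
  (energy mu (fun x => F k x - f x)%R @[k --> \oo] --> 0)%E.

Lemma cvge0_le (u v : nat -> \bar R) : (forall k, 0 <= v k)%E ->
  (forall k, v k <= u k)%E -> (u k @[k --> \oo] --> 0)%E ->
  (v k @[k --> \oo] --> 0)%E.
Proof.
move=> v0 vu u0; apply: cvge0_from_near_le => // e e0.
apply: filterS (cvge0_near_lt e0 u0) => k uk.
exact: (le_trans (vu k) (ltW uk)).
Qed.

Lemma cvge0Z (c : R) (u : nat -> \bar R) : (u k @[k --> \oo] --> 0)%E ->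
  (c%:E * u k @[k --> \oo] --> 0)%E.
Proof. by move=> u0; rewrite -[X in (_ --> X)%E](mule0 c%:E); exact: cvgeZl. Qed.

Lemma cvge0D (u v : nat -> \bar R) : (u k @[k --> \oo] --> 0)%E ->
  (v k @[k --> \oo] --> 0)%E -> (u k + v k @[k --> \oo] --> 0)%E.
Proof. by move=> u0 v0; rewrite -[X in (_ --> X)%E](adde0 0%E); exact: cvgeD. Qed.

Lemma energy_cvgD F f G g : (forall k, measurableq (F k)) -> measurableq f ->
  (forall k, measurableq (G k)) -> measurableq g ->
  energy_cvg F f -> energy_cvg G g ->
  energy_cvg (fun k x => F k x + G k x) (fun x => f x + g x).
Proof.
move=> mF mf mG mg Ff Gg.
apply: (cvge0_le _ _ (cvge0D (cvge0Z 2 Ff) (cvge0Z 2 Gg))) => k.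
  exact: energy_ge0.
apply: le_trans (energyD_le _ _ _); try exact: measurableqB.
rewrite le_eqVlt; apply/orP; left; apply/eqP.
by congr energy; apply/funext => x; rewrite addrACA opprD.
Qed.

(** Minkowski's inequality: expand the square and use [cauchy_schwarz]. *)
Lemma energy_sqrtD_le f g : finite_energy mu f -> finite_energy mu g ->
  Num.sqrt (fine (energy mu (fun x => f x + g x))) <=
  Num.sqrt (fine (energy mu f)) + Num.sqrt (fine (energy mu g)).
Proof.
move=> ef eg; have cs := cauchy_schwarz ef eg.
have F0 : 0 <= fine (energy mu f) by rewrite fine_ge0 ?energy_ge0.
have G0 : 0 <= fine (energy mu g) by rewrite fine_ge0 ?energy_ge0.
have D0 : 0 <= fine (energy mu (fun x => f x + g x)).
  by rewrite fine_ge0 ?energy_ge0.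
rewrite -(@ler_pXn2r _ 2)// ?nnegrE ?addr_ge0 ?sqrtr_ge0//.
rewrite sqr_sqrtr// fine_energyD// sqrrD !sqr_sqrtr// addrAC lerD2r lerD2l.
rewrite -[leRHS]mulr_natl ler_pM2l// (le_trans (ler_norm _))//.
rewrite (le_trans (normr_qre_le _))// absqE -sqrtrM//.
by rewrite ler_sqrt// mulr_ge0.
Qed.

Lemma energy_sqrtB_le f g : finite_energy mu f -> finite_energy mu g ->
  Num.sqrt (fine (energy mu f)) <= Num.sqrt (fine (energy mu g)) +
  Num.sqrt (fine (energy mu (fun x => f x - g x))).
Proof.
move=> ef eg; apply: le_trans (energy_sqrtD_le eg (finite_energyB ef eg)).
rewrite le_eqVlt; apply/orP; left; apply/eqP; congr (Num.sqrt (fine _)).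
by congr energy; apply/funext => x; rewrite addrC subrK.
Qed.

Lemma energy_cvg_sqrt F f (e : R) : 0 < e -> energy_cvg F f ->
  \forall k \near \oo, Num.sqrt (fine (energy mu (fun x => F k x - f x))) < e.
Proof.
move=> e0 /(cvge0_near_lt (exprn_gt0 2 e0)); apply: filterS => k ek.
have E0 : (0 <= energy mu (fun x => F k x - f x)%R)%E by exact: energy_ge0.
rewrite -[ltRHS](ger0_norm (ltW e0)) -sqrtr_sqr ltr_sqrt ?exprn_gt0//.
rewrite -lte_fin fineK// ge0_fin_numE//; apply: lt_trans ek _; exact: ltry.
Qed.

End energy_limits.

(** The square root of the energy satisfies the triangle inequality, so that it
    passes to the limit. *)
Lemma energy_cvg_le d d' (T : measurableType d) (T' : measurableType d')
    (R : realType) (mu : {measure set T -> \bar R}) (nu : {measure set T' -> \bar R})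
    (F : nat -> T -> quat R) f (G : nat -> T' -> quat R) g :
  (forall k, finite_energy mu (F k)) -> finite_energy mu f ->
  (forall k, finite_energy nu (G k)) -> finite_energy nu g ->
  energy_cvg mu F f -> energy_cvg nu G g ->
  (forall k, energy mu (F k) = energy nu (G k)) ->
  (energy mu f <= energy nu g)%E.
Proof.
move=> eF ef eG eg Ff Gg FG.
rewrite -(fineK (energy_fin ef)) -(fineK (energy_fin eg)) lee_fin.
rewrite -ler_sqrt ?fine_ge0 ?energy_ge0//; apply/ler_addgt0Pr => e e0.
have e2 : 0 < e / 2 by rewrite divr_gt0.
have := filterI (energy_cvg_sqrt e2 Ff) (energy_cvg_sqrt e2 Gg).
case=> N _ /(_ N (leqnn N))[a b].
have h1 := energy_sqrtB_le ef (eF N); rewrite energyBC in h1.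
have h2 := energy_sqrtB_le (eG N) eg.
rewrite (FG N) in h1; lra.
Qed.

Lemma energy_cvg_eq d d' (T : measurableType d) (T' : measurableType d')
    (R : realType) (mu : {measure set T -> \bar R}) (nu : {measure set T' -> \bar R})
    (F : nat -> T -> quat R) f (G : nat -> T' -> quat R) g :
  (forall k, finite_energy mu (F k)) -> finite_energy mu f ->
  (forall k, finite_energy nu (G k)) -> finite_energy nu g ->
  energy_cvg mu F f -> energy_cvg nu G g ->
  (forall k, energy mu (F k) = energy nu (G k)) ->
  energy mu f = energy nu g.
Proof.
move=> eF ef eG eg Ff Gg FG; apply/eqP; rewrite eq_le; apply/andP; split.
  exact: (energy_cvg_le eF ef eG eg Ff Gg FG).
by apply: (energy_cvg_le eG eg eF ef Gg Ff) => k; rewrite FG.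
Qed.

Section truncation.
Context d (T : measurableType d) (R : realType).
Context (mu : {measure set T -> \bar R}).

(** Dropping the small values of [f] makes it integrable, as
    [|f| <= k |f|^2] where [|f| > 1/k]. *)
Lemma L1_approximation (f : T -> quat R) : finite_energy mu f ->
  forall e : R, 0 < e -> exists F,
  [/\ integrableq mu F, finite_energy mu F &
      (energy mu (fun x => F x - f x)%R <= e%:E)%E].
Proof.
move=> ef e e0; have [mf efin] := ef.
pose F (k : nat) x := if k.+1%:R^-1 < absq (f x) then f x else 0.
have mF k : measurableq (F k).
  apply: measurableq_if => //; apply: measurable_fun_ltr => //.
  exact: measurable_absq.
have nF k x : normsq (F k x) <= normsq (f x).
  by rewrite /F; case: ifP => // _; rewrite normsq0 normsq_ge0.
have eF k : finite_energy mu (F k) by exact: (le_finite_energy _ (nF k)).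
have iF k : integrableq mu (F k).
  split; first exact: mF.
  apply: (@le_lt_trans _ _ (\int[mu]_x (k.+1%:R * normsq (f x))%:E)%E).
    apply: le_integral_EFin.
    - exact: measurable_absq.
    - by apply: measurable_funM; [exact: measurable_cst|exact: measurable_normsq].
    - by move=> x; exact: absq_ge0.
    - move=> x; rewrite /F; case: ifPn => [kf|_].
        rewrite -absq_sqr expr2 mulrA ler_peMl ?absq_ge0//.
        by rewrite -ler_pdivrMl// mulr1 ltW.
      by rewrite absq0 mulr_ge0// normsq_ge0.
  rewrite ge0_integralZ_EFin//; last by move=> x; exact: normsq_ge0.
    by apply: lte_mul_pinfty => //; rewrite -[X in X \is _]/(energy mu f) energy_fin.
  exact: measurable_normsq.
have c0 : (energy mu (fun x => F k x - f x)%R @[k --> \oo] --> 0)%E.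
  have -> : 0%E = (\int[mu]_x (0 : R)%:E)%E by rewrite integral0.
  apply: (dominated_cvg_EFin (g := fun x => normsq (f x))) => //.
  - by move=> k; apply: measurable_normsq; exact: measurableqB.
  - exact: measurable_normsq.
  - move=> x; have [fx0|fx0] := eqVneq (f x) 0.
      apply: cvg_near_cst; apply: nearW => k.
      by rewrite /F fx0 if_same subr0 normsq0.
    have ax : 0 < absq (f x).
      rewrite lt_neqAle absq_ge0 andbT eq_sym; apply: contra fx0 => /eqP a0.
      by apply/eqP; apply: normsq_eq0; rewrite -absq_sqr a0 expr0n.
    apply: cvg_near_cst; near=> k.
    have -> : F k x = f x.
      rewrite /F ifT//; near: k.
      have h : \forall k \near \oo, harmonic k < absq (f x).
        by apply: (cvgr_lt _ (@cvg_harmonic R)).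
      by apply: filterS h.
    by rewrite subrr normsq0.
  - move=> k x; rewrite ger0_norm ?normsq_ge0// /F; case: ifP => _.
      by rewrite subrr normsq0 normsq_ge0.
    by rewrite sub0r normsqN.
have [N _ /(_ N (leqnn N)) EN] := cvge0_near_lt e0 c0.
exists (F N); split => //; exact: ltW.
Unshelve. all: by end_near. Qed.

End truncation.

(** * The right-sided Fourier transform of finite-energy functions *)

Section L2_fourier.
Context {R : realType} {m : nat}.
Local Notation L := (leb R m).
Implicit Types f g : vec R m -> quat R.

(** A relation, as the transform of a class of functions modulo null sets is such
    a class: its graph is the closure of that of [rfourier] on the intersection
    of L^1 and L^2. *)
Definition L2_rfourier f g := [/\ finite_energy L f, finite_energy L g &
  exists F : nat -> vec R m -> quat R,
  [/\ forall k, integrableq L (F k) /\ finite_energy L (F k),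
      energy_cvg L F f & energy_cvg L (fun k => rfourier (F k)) g]].

Lemma rfourierD f g w : integrableq L f -> integrableq L g ->
  rfourier (fun x => f x + g x) w = rfourier f w + rfourier g w.
Proof.
move=> fi gi; rewrite !rfourierE -intqD; try exact: integrableq_charj.
by apply: eq_intq => x; rewrite mulrDl.
Qed.

Lemma rfourierN f w : integrableq L f ->
  rfourier (fun x => - f x) w = - rfourier f w.
Proof.
move=> fi; rewrite !rfourierE -[RHS]mulN1r -intqM; last exact: integrableq_charj.
by apply: eq_intq => x; rewrite mulN1r mulNr.
Qed.

Lemma integrableqN f : integrableq L f -> integrableq L (fun x => - f x).
Proof.
by move=> fi; rewrite (_ : (fun x => _) = (fun x => -1 * f x));
  [exact: integrableqM|apply/funext => x; rewrite mulN1r].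
Qed.

Lemma rfourierB f g w : integrableq L f -> integrableq L g ->
  rfourier (fun x => f x - g x) w = rfourier f w - rfourier g w.
Proof.
move=> fi gi; rewrite (rfourierD w fi (integrableqN gi)); congr (_ + _).
exact: rfourierN.
Qed.

Lemma finite_energy_rfourier f : integrableq L f -> finite_energy L f ->
  finite_energy L (rfourier f).
Proof.
move=> fi ef; split; last by rewrite plancherel//; case: ef.
by apply: measurableq_rfourier; case: ef.
Qed.

Lemma L2_rfourier_integrable f : integrableq L f -> finite_energy L f ->
  L2_rfourier f (rfourier f).
Proof.
move=> fi ef; split=> //; first exact: finite_energy_rfourier.
have c0 (h : vec R m -> quat R) : energy_cvg L (fun _ : nat => h) h.
  apply: cvg_near_cst; apply: nearW => _.
  rewrite /energy; under eq_integral do rewrite subrr normsq0.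
  by rewrite integral0.
by exists (fun _ => f); split=> //; exact: c0.
Qed.

(** By Plancherel's identity the transforms of approximants converge as fast as
    the approximants do; the rate [8^-k] is fast enough for [riesz_fischer]. *)
Lemma L2_rfourier_exists f : finite_energy L f -> exists g, L2_rfourier f g.
Proof.
move=> ef; pose e (k : nat) : R := 8^-1 ^+ k / 8.
have e0 k : 0 < e k by rewrite divr_gt0// exprn_gt0// invr_gt0.
have /choice[F FP] := fun k => L1_approximation ef (e0 k).
have iF k : integrableq L (F k) by have [] := FP k.
have eF k : finite_energy L (F k) by have [] := FP k.
have mF k : measurableq (F k) by have [] := eF k.
have [mf _] := ef.
have mr k : measurableq (rfourier (F k)) by exact: measurableq_rfourier.
have dF k : energy L (fun x => rfourier (F k.+1) x - rfourier (F k) x) =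
    energy L (fun x => F k.+1 x - F k x).
  rewrite -[RHS]plancherel.
  - by congr energy; apply/funext => w; rewrite rfourierB.
  - exact: integrableqB.
  - exact: finite_energyB.
have dFe k : (energy L (fun x => F k.+1 x - F k x)%R <= (4 * e k)%:E)%E.
  have -> : energy L (fun x => F k.+1 x - F k x) =
      energy L (fun x => (F k.+1 x - f x) - (F k x - f x)).
    by congr energy; apply/funext => x; rewrite opprB addrA subrK.
  apply: le_trans (energyB_le _ _ _) _; try exact: measurableqB.
  have [_ _ E1] := FP k.+1; have [_ _ E2] := FP k.
  have ek : e k.+1 <= e k.
    rewrite /e exprS ler_pM2r ?invr_gt0// ler_piMl ?exprn_ge0//.
    by rewrite invf_le1// ler1n.
  apply: (@le_trans _ _ (2%:E * (e k.+1)%:E + 2%:E * (e k)%:E)%E).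
    by apply: leeD; apply: lee_wpmul2l.
  by rewrite -!EFinM -EFinD lee_fin; move: ek; lra.
have small_steps k : ((2 ^+ k)%:E *
    energy L (fun w => rfourier (F k.+1) w - rfourier (F k) w)%R <=
    (1 / (2 ^ k.+1)%:R)%:E)%E.
  rewrite dF; apply: (@le_trans _ _ ((2 ^+ k)%:E * (4 * e k)%:E)%E).
    by apply: lee_wpmul2l; rewrite ?lee_fin ?exprn_ge0.
  rewrite -EFinM lee_fin /e natrX exprS.
  have -> : (8^-1 : R) ^+ k = (2 ^+ k)^-1 * (4 ^+ k)^-1.
    by rewrite -invfM -exprMn -natrM exprVn.
  have a0 : 0 < (2 ^+ k : R) by rewrite exprn_gt0.
  have b0 : (2 ^+ k : R) <= 4 ^+ k.
    by rewrite lerXn2r ?nnegrE// ler_nat.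
  have b1 : 0 < (4 ^+ k : R) by rewrite exprn_gt0.
  move: (2 ^+ k : R) (4 ^+ k : R) a0 b0 b1 => a b a0 ab b0.
  rewrite (_ : a * _ = (2 * b)^-1); last first.
    by field; rewrite !gt_eqF.
  by rewrite div1r lef_pV2 ?posrE ?mulr_gt0// ler_pM2l.
have [g [mg Fg]] := riesz_fischer mr small_steps.
exists g; split => //.
  have [N _ /(_ N (leqnn N)) EN] := cvge0_near_lt ltr01 Fg.
  have ed : finite_energy L (fun w => rfourier (F N) w - g w).
    by split; [exact: measurableqB|exact: lt_trans EN (ltry _)].
  have := finite_energyB (finite_energy_rfourier (iF N) (eF N)) ed.
  by congr finite_energy; apply/funext => w; rewrite opprB addrC subrK.
exists F; split=> //; apply: cvge0_from_near_le => [k|r r0].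
  exact: energy_ge0.
near=> k; have [_ _ Ek] := FP k; apply: (le_trans Ek); rewrite lee_fin.
rewrite /e ltW//; near: k.
have c : geometric (8^-1 : R) (8^-1 : R) @ \oo --> (0 : R).
  by apply: cvg_geometric; rewrite ger0_norm// invf_lt1// ltr1n.
have h : \forall k \near \oo, geometric (8^-1 : R) (8^-1 : R) k < r.
  by apply: (cvgr_lt _ c).
apply: filterS h => k.
by rewrite /geometric /= mulrC.
Unshelve. all: by end_near. Qed.

Lemma L2_rfourier_isometry f g : L2_rfourier f g -> energy L g = energy L f.
Proof.
move=> [ef eg [F [iF Ff Fg]]].
apply: (energy_cvg_eq _ _ _ _ Fg Ff) => // [k|k|k].
- by have [? ?] := iF k; exact: finite_energy_rfourier.
- by have [] := iF k.
- by have [? ?] := iF k; exact: plancherel.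
Qed.

Lemma L2_rfourierD f g f' g' : L2_rfourier f g -> L2_rfourier f' g' ->
  L2_rfourier (fun x => f x + f' x) (fun w => g w + g' w).
Proof.
move=> [ef eg [F [iF Ff Fg]]] [ef' eg' [F' [iF' Ff' Fg']]].
split; try exact: finite_energyD.
have mF k : measurableq (F k) by have [_ []] := iF k.
have mF' k : measurableq (F' k) by have [_ []] := iF' k.
exists (fun k x => F k x + F' k x); split.
- move=> k; have [? ?] := iF k; have [? ?] := iF' k.
  by split; [exact: integrableqD|exact: finite_energyD].
- by apply: energy_cvgD => //; [case: ef|case: ef'].
- rewrite (_ : (fun k => rfourier _) =
      (fun k w => rfourier (F k) w + rfourier (F' k) w)); last first.
    apply/funext => k; apply/funext => w.
    by have [? _] := iF k; have [? _] := iF' k; exact: rfourierD.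
  have [[mg _] [mg' _]] := (eg, eg').
  exact: (energy_cvgD (fun k => measurableq_rfourier (mF k)) mg
    (fun k => measurableq_rfourier (mF' k)) mg' Fg Fg').
Qed.

(** [U] and [V] range over the affine changes of variables and the
    multiplications that the Fourier transform exchanges. *)
Lemma L2_rfourier_transfer (U V : (vec R m -> quat R) -> vec R m -> quat R)
    (b c : R) f g :
  (forall h, measurableq h -> measurableq (U h)) ->
  (forall h, measurableq h -> measurableq (V h)) ->
  (forall h h' x, U h x - U h' x = U (fun y => h y - h' y) x) ->
  (forall h h' x, V h x - V h' x = V (fun y => h y - h' y) x) ->
  (forall h, measurableq h -> energy L (U h) = (b%:E * energy L h)%E) ->
  (forall h, measurableq h -> energy L (V h) = (c%:E * energy L h)%E) ->
  (forall h, integrableq L h -> integrableq L (U h)) ->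
  (forall h w, integrableq L h -> finite_energy L h ->
     rfourier (U h) w = V (rfourier h) w) ->
  0 <= b -> 0 <= c -> L2_rfourier f g -> L2_rfourier (U f) (V g).
Proof.
move=> mU mV UB VB eU eV iU UV b0 c0 [ef eg [F [iF Ff Fg]]].
have fU h : finite_energy L h -> finite_energy L (U h).
  move=> [mh eh]; split; first exact: mU.
  by rewrite eU//; apply: lte_mul_pinfty.
have fV h : finite_energy L h -> finite_energy L (V h).
  move=> [mh eh]; split; first exact: mV.
  by rewrite eV//; apply: lte_mul_pinfty.
have mF k : measurableq (F k) by have [_ []] := iF k.
have [[mf _] [mg _]] := (ef, eg).
split; [exact: fU|exact: fV|].
exists (fun k => U (F k)); split.
- by move=> k; have [? ?] := iF k; split; [exact: iU|exact: fU].
- rewrite /energy_cvg.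
  rewrite (_ : (fun k => _) = (fun k => b%:E * energy L (fun x => F k x - f x)%R)%E).
    exact: cvge0Z.
  apply/funext => k; rewrite -eU; last exact: measurableqB.
  by congr energy; apply/funext => x; exact: UB.
- rewrite /energy_cvg.
  rewrite (_ : (fun k => _) =
      (fun k => c%:E * energy L (fun w => rfourier (F k) w - g w)%R)%E).
    exact: cvge0Z.
  apply/funext => k; rewrite -eV; last first.
    exact: (measurableqB (measurableq_rfourier (mF k)) mg).
  congr energy; apply/funext => w; rewrite -VB; congr (_ - _).
  by have [? ?] := iF k; exact: UV.
Qed.

Lemma L2_rfourierM c f g : L2_rfourier f g ->
  L2_rfourier (fun x => c * f x) (fun w => c * g w).
Proof.
apply: (@L2_rfourier_transfer (fun h x => c * h x) (fun h x => c * h x)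
  (normsq c) (normsq c)); rewrite ?normsq_ge0//.
- by move=> h mh; apply: measurableqM => //; exact: measurableq_cst.
- by move=> h mh; apply: measurableqM => //; exact: measurableq_cst.
- by move=> h h' x; rewrite mulrBr.
- by move=> h h' x; rewrite mulrBr.
- by move=> h mh; rewrite energyM.
- by move=> h mh; rewrite energyM.
- by move=> h hi; exact: integrableqM.
- move=> h w hi _; rewrite !rfourierE -intqM; last exact: integrableq_charj.
  by apply: eq_intq => x; rewrite mulrA.
Qed.

(** A right factor has to cross the kernel of the transform. *)
Lemma L2_rfourierMr c f g : (forall theta : R, c * chj theta = chj theta * c) ->
  L2_rfourier f g -> L2_rfourier (fun x => f x * c) (fun w => g w * c).
Proof.
move=> cc; apply: (@L2_rfourier_transfer (fun h x => h x * c) (fun h x => h x * c)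
  (normsq c) (normsq c)); rewrite ?normsq_ge0//.
- by move=> h mh; apply: measurableqM => //; exact: measurableq_cst.
- by move=> h mh; apply: measurableqM => //; exact: measurableq_cst.
- by move=> h h' x; rewrite mulrBl.
- by move=> h h' x; rewrite mulrBl.
- by move=> h mh; rewrite energyMr.
- by move=> h mh; rewrite energyMr.
- by move=> h hi; exact: integrableqMr.
- move=> h w hi _; rewrite !rfourierE -intqMr; last exact: integrableq_charj.
  by apply: eq_intq => x; rewrite -!mulrA charq_jE cc.
Qed.

Lemma L2_rfourierB f g f' g' : L2_rfourier f g -> L2_rfourier f' g' ->
  L2_rfourier (fun x => f x - f' x) (fun w => g w - g' w).
Proof.
move=> fg /(L2_rfourierM (-1)) f'g'; have := L2_rfourierD fg f'g'.
rewrite (_ : (fun x => f x + _) = (fun x => f x - f' x)); last first.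
  by apply/funext => x; rewrite mulN1r.
rewrite (_ : (fun x => g x + _) = (fun x => g x - g' x))//.
by apply/funext => x; rewrite mulN1r.
Qed.

Let ae_subr0 (f f' : vec R m -> quat R) : {ae L, forall x, f x - f' x = 0} ->
  {ae L, forall x, f x = f' x}.
Proof. by apply: filterS => x /eqP; rewrite subr_eq0 => /eqP. Qed.

Let ae_subrr (f f' : vec R m -> quat R) : {ae L, forall x, f x = f' x} ->
  {ae L, forall x, f x - f' x = 0}.
Proof. by apply: filterS => x ->; rewrite subrr. Qed.

(** By linearity and isometry. *)
Lemma L2_rfourier_inj f g f' g' : L2_rfourier f g -> L2_rfourier f' g' ->
  {ae L, forall w, g w = g' w} -> {ae L, forall x, f x = f' x}.
Proof.
move=> fg f'g' gg'; apply: ae_subr0.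
have B := L2_rfourierB fg f'g'; have [[mf _] [mg _] _] := B.
by apply: energy_eq0 => //; rewrite -(L2_rfourier_isometry B) ae0_energy//; exact: ae_subrr.
Qed.

Lemma L2_rfourier_ae f g f' g' : measurableq f' -> measurableq g' ->
  {ae L, forall x, f x = f' x} -> {ae L, forall w, g w = g' w} ->
  L2_rfourier f g -> L2_rfourier f' g'.
Proof.
move=> mf' mg' ff' gg' [[mf ef] [mg eg] [F [iF Ff Fg]]].
have mF k : measurableq (F k) by have [_ []] := iF k.
split.
- by split=> //; rewrite -(ae_eq_energy mf mf' ff').
- by split=> //; rewrite -(ae_eq_energy mg mg' gg').
exists F; split=> //.
- rewrite /energy_cvg.
  rewrite (_ : (fun k => _) = (fun k => energy L (fun x => F k x - f x)))//.
  apply/funext => k; apply: ae_eq_energy; try exact: measurableqB.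
  by apply: filterS ff' => x ->.
- rewrite /energy_cvg (_ : (fun k => _) =
    (fun k => energy L (fun x => rfourier (F k) x - g x)))//.
  apply/funext => k; have mr := measurableq_rfourier (mF k).
  apply: ae_eq_energy; try exact: measurableqB.
  by apply: filterS gg' => x ->.
Qed.

(** By polarization of [L2_rfourier_isometry]. *)
Lemma parseval f g f' g' : L2_rfourier f g -> L2_rfourier f' g' ->
  innerq L f f' = innerq L g g'.
Proof.
move=> fg f'g'; apply: qreM_inj => c.
have [ef eg _] := fg; have [ef' eg' _] := f'g'.
rewrite !qreM_innerq//.
rewrite (L2_rfourier_isometry fg) (L2_rfourier_isometry f'g').
by rewrite (L2_rfourier_isometry (L2_rfourierD (L2_rfourierM c fg) f'g')).
Qed.

End L2_fourier.

(** * Changes of variables of constant Jacobian *)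

Section dilations.
Context d (T : measurableType d) (R : realType) (mu : {measure set T -> \bar R}).
Implicit Types (tau : T -> T) (J : R).

(** The change of variables formula for a map of constant Jacobian determinant,
    [J] being the inverse of its modulus. *)
Definition dilates tau J := [/\ measurable_fun setT tau, 0 <= J &
  forall F : T -> \bar R, measurable_fun setT F -> (forall x, 0 <= F x)%E ->
    (\int[mu]_x F (tau x) = J%:E * \int[mu]_x F x)%E].

Lemma dilates_id : dilates id 1.
Proof. by split=> // F mF F0; rewrite mul1e. Qed.

Section transport.
Variables (tau : T -> T) (J : R).
Hypothesis tauJ : dilates tau J.

Let mtau : measurable_fun setT tau. Proof. by case: tauJ. Qed.

Lemma measurableq_dilates (f : T -> quat R) : measurableq f ->
  measurableq (fun x => f (tau x)).
Proof. by move=> mf; exact: (measurableq_comp mtau mf). Qed.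

Lemma energy_dilates (f : T -> quat R) : measurableq f ->
  energy mu (fun x => f (tau x)) = (J%:E * energy mu f)%E.
Proof.
move=> mf; have [_ _ tE] := tauJ; apply: tE.
  by apply/measurable_EFinP; exact: measurable_normsq.
by move=> x; rewrite lee_fin normsq_ge0.
Qed.

Lemma integrableq_dilates (f : T -> quat R) : integrableq mu f ->
  integrableq mu (fun x => f (tau x)).
Proof.
move=> [mf ffin]; have [_ J0 tE] := tauJ; split; first exact: measurableq_dilates.
rewrite (tE (fun x => (absq (f x))%:E)).
- by apply: lte_mul_pinfty => //; rewrite ge0_fin_numE// integral_ge0// => x _;
    rewrite lee_fin absq_ge0.
- by apply/measurable_EFinP; exact: measurable_absq.
- by move=> x; rewrite lee_fin absq_ge0.
Qed.

Lemma Rintegral_dilates (u : T -> R) : mu.-integrable setT (EFin \o u) ->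
  \int[mu]_x u (tau x) = J * \int[mu]_x u x.
Proof.
move=> iu; have [_ J0 tE] := tauJ; have mu_ := measurable_int _ iu.
have [pfin nfin] := (integrable_pos_fin_num measurableT iu,
  integrable_neg_fin_num measurableT iu).
rewrite /Rintegral.
have -> : (\int[mu]_x (u (tau x))%:E = J%:E * \int[mu]_x (u x)%:E)%E.
  rewrite integralE [in RHS]integralE.
  rewrite muleBr//; last by rewrite fin_num_adde_defr.
  rewrite -(tE _ (measurable_funepos mu_)); last by move=> x; exact: funepos_ge0.
  rewrite -(tE _ (measurable_funeneg mu_)); last by move=> x; exact: funeneg_ge0.
  congr (_ - _)%E; apply: eq_integral => x _.
    by rewrite !funeposE.
  by rewrite !funenegE.
by rewrite fineM//; exact: (integrable_fin_num measurableT iu).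
Qed.

Lemma intq_dilates (f : T -> quat R) : integrableq mu f ->
  intq mu (fun x => f (tau x)) = J *: intq mu f.
Proof.
by move=> /integrableq_comp[? ? ? ?]; apply: quat_ext; exact: Rintegral_dilates.
Qed.

Lemma ae_dilates (P : T -> Prop) : {ae mu, forall x, P x} ->
  {ae mu, forall x, P (tau x)}.
Proof.
move=> [A [mA A0 PA]]; exists (tau @^-1` A); split.
- by rewrite -[X in measurable X]setTI; exact: mtau.
- have [_ _ tE] := tauJ.
  have mtA : measurable (tau @^-1` A).
    by rewrite -[X in measurable X]setTI; exact: mtau.
  have := tE (fun x => (\1_A x)%:E).
  rewrite [X in _ -> _ -> _ = (_ * X)%E](integral_indic mu measurableT mA).
  rewrite [X in _ -> _ -> X = _](integral_indic mu measurableT mtA).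
  rewrite !setIT A0 mule0; apply.
    by apply/measurable_EFinP; exact: measurable_indic.
  by move=> x; rewrite lee_fin.
- by move=> x /= nP; apply: PA => /= Px; exact: nP.
Qed.

End transport.
End dilations.

Section dilations_leb.
Context {R : realType}.
Local Notation R' := (measurableTypeR R).
Local Notation leb1 := (@lebesgue_measure R).

Lemma dilates_affine (c b : R) : c != 0 ->
  dilates leb1 (fun x : R' => c * x + b : R') `|c|^-1.
Proof.
move=> c0; split.
- apply: (@measurable_funD _ _ R); last exact: measurable_cst.
  exact: (@mulrl_measurable R).
- by rewrite invr_ge0.
- by move=> F mF F0; rewrite (ge0_integral_affine b c0 mF F0) normfV.
Qed.

Definition headv m (x : vec R m.+1) : R' := thead x.
Definition tailv m (x : vec R m.+1) : vec R m := [tuple of behead x].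

Lemma consv_eta m (x : vec R m.+1) : consv (headv x, tailv x) = x.
Proof. by rewrite /consv [RHS]tuple_eta; exact: val_inj. Qed.

Lemma headv_consv m a (x : vec R m) : headv (consv (a, x)) = a.
Proof. by rewrite /headv theadE. Qed.

Lemma tailv_consv m a (x : vec R m) : tailv (consv (a, x)) = x.
Proof. exact: val_inj. Qed.

Lemma measurable_headv m : measurable_fun setT (@headv m).
Proof. exact: (measurable_tnth ord0). Qed.

Lemma measurable_tailv m : measurable_fun setT (@tailv m).
Proof. exact: measurable_behead. Qed.

Lemma measurable_unconsv_eta m :
  measurable_fun setT (fun x : vec R m.+1 => (headv x, tailv x)).
Proof.
apply: measurable_fun_pair; first exact: measurable_headv.
exact: measurable_tailv.
Qed.

Lemma measurable_pair_consv d (T : measurableType d) m (u : T -> R')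
    (v : T -> vec R m) : measurable_fun setT u -> measurable_fun setT v ->
  measurable_fun setT (fun x => consv (u x, v x)).
Proof.
move=> mu mv; apply: (measurableT_comp (@measurable_consv R m)).
exact: measurable_fun_pair.
Qed.

(** Tonelli's theorem, integrating over the last coordinates first; it applies to
    the shears of the frequencies. *)
Lemma dilates_tail m (sigma : R' -> R') (tau : R' -> vec R m -> vec R m) (J J' : R) :
  dilates leb1 sigma J -> (forall a, dilates (leb R m) (tau a) J') ->
  measurable_fun setT (fun z : R' * vec R m => tau z.1 z.2) ->
  dilates (leb R m.+1)
    (fun x => consv (sigma (headv x), tau (headv x) (tailv x))) (J * J').
Proof.
move=> [ms J0 sE] tJ mt; have [_ J0' _] := tJ 0.
have mc : measurable_fun setT
    (fun x => consv (sigma (headv x), tau (headv x) (tailv x))).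
  apply: measurable_pair_consv.
    by apply: (measurableT_comp ms); exact: measurable_headv.
  exact: (measurableT_comp mt (@measurable_unconsv_eta m)).
split=> //; first exact: mulr_ge0.
move=> F mF F0; rewrite ge0_integral_leb_cons//; last exact: (measurableT_comp mF mc).
rewrite ge0_integral_leb_cons//.
have mFc : measurable_fun setT (fun z : R' * vec R m => F (consv z)).
  by apply: (measurableT_comp mF); exact: measurable_consv.
pose G (a : R') := (\int[leb R m]_x F (consv (a, x)))%E.
have mG : measurable_fun setT G.
  by apply: (@measurable_fun_fubini_tonelli_F _ _ _ _ _ (leb R m) _ mFc) => z.
have G0 a : (0 <= G a)%E by exact: integral_ge0.
transitivity (\int[leb1]_a (J'%:E * G (sigma a)))%E.
  apply: eq_integral => a _; have [_ _ tE] := tJ a.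
  rewrite -(tE (fun x => F (consv (sigma a, x)))) => //.
    by apply: eq_integral => x _; rewrite headv_consv tailv_consv.
  by apply: (measurableT_comp mFc); exact: pair1_measurable.
rewrite (sE (fun a => J'%:E * G a)%E); last 2 first.
- by apply: emeasurable_funM => //; exact: measurable_cst.
- by move=> a; rewrite mule_ge0.
by rewrite ge0_integralZl// muleA -EFinM.
Qed.

(** Tonelli's theorem, integrating over the first coordinate first; it applies to
    the shears of space. *)
Lemma dilates_head m (sigma : vec R m -> R' -> R') (tau : vec R m -> vec R m)
    (J J' : R) :
  (forall x, dilates leb1 (sigma x) J) -> dilates (leb R m) tau J' ->
  measurable_fun setT (fun z : R' * vec R m => sigma z.2 z.1) ->
  dilates (leb R m.+1)
    (fun x => consv (sigma (tailv x) (headv x), tau (tailv x))) (J' * J).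
Proof.
move=> sJ [mt J0' tE] ms; have [_ J0 _] := sJ [tuple of nseq m 0].
have mc : measurable_fun setT
    (fun x => consv (sigma (tailv x) (headv x), tau (tailv x))).
  apply: measurable_pair_consv.
    exact: (measurableT_comp ms (@measurable_unconsv_eta m)).
  exact: (measurableT_comp mt (@measurable_tailv m)).
split=> //; first exact: mulr_ge0.
move=> F mF F0; rewrite ge0_integral_leb_cons_swap//; last exact: (measurableT_comp mF mc).
rewrite ge0_integral_leb_cons_swap//.
have mFc : measurable_fun setT (fun z : R' * vec R m => F (consv z)).
  by apply: (measurableT_comp mF); exact: measurable_consv.
pose G (x : vec R m) := (\int[leb1]_a F (consv (a, x)))%E.
have mG : measurable_fun setT G.
  by apply: (@measurable_fun_fubini_tonelli_G _ _ _ _ _ leb1 _ mFc) => z.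
have G0 x : (0 <= G x)%E by exact: integral_ge0.
transitivity (\int[leb R m]_x (J%:E * G (tau x)))%E.
  apply: eq_integral => x _; have [_ _ sE] := sJ x.
  rewrite -(sE (fun a => F (consv (a, tau x)))) => //.
    by apply: eq_integral => a _; rewrite headv_consv tailv_consv.
  by apply: (measurableT_comp mFc); exact: pair2_measurable.
rewrite (tE (fun x => J%:E * G x)%E); last 2 first.
- by apply: emeasurable_funM => //; exact: measurable_cst.
- by move=> x; rewrite mule_ge0.
by rewrite ge0_integralZl// muleA -EFinM.
Qed.

Definition affinev m (c b : 'I_m -> R) (x : vec R m) : vec R m :=
  [tuple c i * tnth x i + b i | i < m].

Lemma affinevE m (c b : 'I_m.+1 -> R) (x : vec R m.+1) : affinev c b x =
  consv (c ord0 * headv x + b ord0 : R',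
    affinev (fun i => c (lift ord0 i)) (fun i => b (lift ord0 i)) (tailv x)).
Proof.
apply: eq_from_tnth => i; rewrite tnth_mktuple.
case: (unliftP ord0 i) => [j|] ->.
  by rewrite [RHS]tnthS tnth_mktuple -[in LHS](consv_eta x) [in LHS]tnthS.
by rewrite [RHS]tnth0.
Qed.

Lemma dilates_affinev m (c b : 'I_m -> R) : (forall i, c i != 0) ->
  dilates (leb R m) (affinev c b) (\prod_(i < m) `|c i|^-1).
Proof.
elim: m c b => [|m IH] c b c0.
  rewrite big_ord0 (_ : affinev c b = id); first exact: dilates_id.
  by apply/funext => x; rewrite [LHS]tuple0 [RHS]tuple0.
have -> : affinev c b = fun x => consv (c ord0 * headv x + b ord0 : R',
    affinev (fun i => c (lift ord0 i)) (fun i => b (lift ord0 i)) (tailv x)).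
  by apply/funext => x; exact: affinevE.
rewrite big_ord_recl.
have IH' := IH (fun i => c (lift ord0 i)) (fun i => b (lift ord0 i))
  (fun i => c0 (lift ord0 i)).
apply: (dilates_tail (dilates_affine (b ord0) (c0 ord0)) (fun=> IH')).
by have [mt _ _] := IH'; exact: (measurableT_comp mt).
Qed.

Lemma dilates_homothety m (c : R) (b : 'I_m -> R) : c != 0 ->
  dilates (leb R m) (affinev (fun=> c) b) (`|c| ^- m).
Proof.
move=> c0; have := dilates_affinev b (fun=> c0).
by rewrite prodr_const card_ord exprVn.
Qed.

Lemma ae_leb1_neq0 : {ae leb1, forall a : R', (a : R) != 0}.
Proof.
exists [set 0]; split=> //; first exact: lebesgue_measure_set1.
by move=> x /= /negP; rewrite negbK => /eqP.
Qed.

Lemma ae_tnth_neq0 m (i : 'I_m) : {ae leb R m, forall x, (tnth x i : R) != 0}.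
Proof.
pose A m (i : 'I_m) := [set x : vec R m | (tnth x i : R) == 0].
have mA k (j : 'I_k) : measurable (A k j).
  rewrite (_ : A k j = (fun x : vec R k => tnth x j) @^-1` [set 0 : R']); last first.
    by apply/seteqP; split => x /= /eqP.
  by rewrite -[X in measurable X]setTI; apply: measurable_tnth => //;
    exact: measurable_set1.
suff A0 : leb R m (A m i) = 0%E.
  exists (A m i); split; [exact: mA|exact: A0|].
  by move=> x /= /negP; rewrite negbK.
rewrite -(setIT (A m i)) -(integral_indic (leb R m) measurableT (mA m i)).
elim: m i => [|m IH] i; first by case: i.
have mI k (j : 'I_k) : measurable_fun setT (fun x => (\1_(A k j) x)%:E : \bar R).
  by apply/measurable_EFinP; exact: (measurable_indic (mA k j)).
have I0 k (j : 'I_k) x : (0 <= (\1_(A k j) x)%:E :> \bar R)%E by rewrite lee_fin.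
rewrite (ge0_integral_leb_cons (mI _ i) (I0 _ i)).
case: (unliftP ord0 i) => [j|] -> {i}.
  under eq_integral => a _.
    rewrite (_ : (\int[_]_x _ = 0)%E); first over.
    rewrite -[RHS](IH j); apply: eq_integral => x _; rewrite !indicE.
    by congr ((nat_of_bool _)%:R%:E); apply/idP/idP; rewrite !inE /A /= tnthS.
  by rewrite integral0.
have mc : measurable_fun setT
    (fun z : R' * vec R m => (\1_(A m.+1 ord0) (consv z))%:E : \bar R).
  by apply: (measurableT_comp (mI _ ord0)); exact: measurable_consv.
rewrite -[RHS](@integral0 _ _ _ leb1 setT); apply: ae_eq_integral => //.
  by apply: (@measurable_fun_fubini_tonelli_F _ _ _ _ _ (leb R m) _ mc).
apply: filterS ae_leb1_neq0 => a a0 _.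
rewrite -[RHS](@integral0 _ _ _ (leb R m) setT); apply: eq_integral => x _.
by rewrite indicE memNset// /A /= tnth0; apply/negP.
Qed.

End dilations_leb.

(** * The two-sided transform from the right-sided one *)

Section norms.
Context {R : realType} {m : nat}.
Local Notation L := (leb R m).
Implicit Types f : vec R m -> quat R.

Lemma normq2E f : Defs.normq 2%:E f = (energy L f `^ 2^-1)%E.
Proof.
rewrite /Defs.normq unlock /energy; congr (_ `^ _)%E; apply: eq_integral => x _.
by rewrite gee0_abs ?lee_fin ?absq_ge0// poweR_EFin powR_mulrn ?absq_ge0// absq_sqr.
Qed.

Lemma normq2_fin f : (energy L f < +oo)%E ->
  Defs.normq 2%:E f = (Num.sqrt (fine (energy L f)))%:E.
Proof.
move=> ef; have E0 : (0 <= energy L f)%E by exact: energy_ge0.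
  rewrite normq2E.
rewrite -[in LHS](fineK (_ : energy L f \is a fin_num)) ?ge0_fin_numE//.
by rewrite poweR_EFin powR12_sqrt// fine_ge0.
Qed.

Lemma normq2_lt f (e : R) : 0 < e ->
  (Defs.normq 2%:E f < e%:E)%E = (energy L f < (e ^+ 2)%:E)%E.
Proof.
move=> e0; have E0 : (0 <= energy L f)%E by exact: energy_ge0.
have [efin|] := ltP (energy L f) +oo%E; last first.
  by rewrite leye_eq => /eqP eoo; rewrite normq2E eoo poweRyr ?invr_neq0.
rewrite normq2_fin// -[in RHS](fineK (_ : energy L f \is a fin_num)) ?ge0_fin_numE//.
rewrite !lte_fin -[X in _ < X](ger0_norm (ltW e0)) -sqrtr_sqr.
by rewrite ltr_sqrt ?exprn_gt0.
Qed.

Lemma normq2_lty f : (Defs.normq 2%:E f < +oo)%E = (energy L f < +oo)%E.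
Proof.
have [efin|] := ltP (energy L f) +oo%E; first by rewrite normq2_fin// ltry.
by rewrite leye_eq => /eqP eoo; rewrite normq2E eoo poweRyr ?invr_neq0.
Qed.

Lemma inL2E f : inL 2%:E f <-> finite_energy L f.
Proof. by rewrite /inL normq2_lty. Qed.

Lemma inL1E f : inL 1%:E f <-> integrableq L f.
Proof.
rewrite /inL /Defs.normq Lnorm1 /integrableq.
under eq_integral do rewrite gee0_abs ?lee_fin ?absq_ge0//.
by [].
Qed.

Lemma norm2_sqr f : finite_energy L f -> norm2 f ^+ 2 = fine (energy L f).
Proof.
move=> [mf ef]; rewrite /norm2 normq2_fin//= sqr_sqrtr//.
by rewrite fine_ge0// energy_ge0.
Qed.

Lemma normq2_cvgP (F : nat -> vec R m -> quat R) f :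
  (Defs.normq 2%:E (fun z => F k z - f z)%R @[k --> \oo] --> 0)%E <-> energy_cvg L F f.
Proof.
split=> h; (apply: cvge0_from_near_le => [k|e e0]).
- exact: energy_ge0.
- have se0 : 0 < Num.sqrt e by rewrite sqrtr_gt0.
  apply: filterS (cvge0_near_lt se0 h) => k.
  by rewrite normq2_lt// sqr_sqrtr ?(ltW e0)// => /ltW.
- exact: Lnorm_ge0.
- apply: filterS (cvge0_near_lt (exprn_gt0 2 e0) h) => k ek.
  by apply: ltW; rewrite normq2_lt.
Qed.

End norms.

Section reflections.
Context {R : realType}.

(** The reflection [(u, v) -> (- u, v)]. *)
Definition flipv n : vec R (n + n) -> vec R (n + n) :=
  affinev (fun i : 'I_(n + n) => if (i < n)%N then -1 else 1) (fun=> 0).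

Lemma dilates_flipv n : dilates (leb R (n + n)) (@flipv n) 1.
Proof.
have := @dilates_affinev R (n + n) (fun i => if (i < n)%N then -1 else 1) (fun=> 0) _.
rewrite big1 => [|i _]; last by case: ifP => _; rewrite ?normrN normr1 invr1.
by apply=> i; case: ifP => _; rewrite ?oppr_eq0 oner_eq0.
Qed.

Lemma flipvK n : involutive (@flipv n).
Proof.
move=> z; apply: eq_from_tnth => i; rewrite !tnth_mktuple !addr0.
by case: ifP => _; rewrite ?mulN1r ?opprK// !mul1r.
Qed.

Lemma dotv_split n (w z : vec R (n + n)) :
  dotv w z = dotv (fstv w) (fstv z) + dotv (sndv w) (sndv z).
Proof.
rewrite /dotv big_split_ord/=; congr (_ + _);
by apply: eq_bigr => i _; rewrite !tnth_mktuple.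
Qed.

Lemma fstv_flipv n (w : vec R (n + n)) : fstv (flipv w) = oppv (fstv w).
Proof.
apply: eq_from_tnth => i; rewrite !tnth_mktuple /= ltn_ord.
by rewrite mulN1r addr0.
Qed.

Lemma sndv_flipv n (w : vec R (n + n)) : sndv (flipv w) = sndv w.
Proof.
apply: eq_from_tnth => i; rewrite !tnth_mktuple /= ltnNge leq_addr/=.
by rewrite mul1r addr0.
Qed.

Lemma dotvC m (w z : vec R m) : dotv w z = dotv z w.
Proof. by apply: eq_bigr => i _; rewrite mulrC. Qed.

Lemma dotv_oppl m (w z : vec R m) : dotv (oppv w) z = - dotv w z.
Proof.
by rewrite /dotv -sumrN; apply: eq_bigr => i _; rewrite tnth_mktuple mulNr.
Qed.

Lemma dotv_oppr m (w z : vec R m) : dotv w (oppv z) = - dotv w z.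
Proof. by rewrite dotvC dotv_oppl dotvC. Qed.

Lemma oppvE m : @oppv R m = affinev (fun=> -1) (fun=> 0).
Proof.
apply/funext => x; apply: eq_from_tnth => i.
by rewrite !tnth_mktuple mulN1r addr0.
Qed.

Lemma dilates_oppv m : dilates (leb R m) (@oppv R m) 1.
Proof.
have := @dilates_homothety R m (-1) (fun=> 0).
by rewrite oppr_eq0 oner_eq0 normrN normr1 expr1n invr1 oppvE; exact.
Qed.

End reflections.

Section two_sided.
Context {R : realType} {n : nat}.
Local Notation L := (leb R (n + n)).
Local Notation ui := (unit_i R).
Local Notation uj := (unit_j R).
Implicit Types f g : vec R (n + n) -> quat R.

(** This combination turns the right-sided transform of a function into its
    two-sided one. *)
Definition twosided g (w : vec R (n + n)) : quat R :=
  2^-1 *: ((g (flipv w) + ui * g (flipv w) * uj) + (g w - ui * g w * uj)).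

(** If [r = q + i q j] then [i r = - r j], so that [e^(- a i) r = r e^(a j)], while
    [r = q - i q j] satisfies [i r = r j], so that [e^(- a i) r = r e^(- a j)]: on
    each half of [q] the left factor moves to the right. *)
Lemma expq_sandwich (a b : R) q : expq ui (- a) * q * expq uj (- b) =
  2^-1 *: ((q * chj (- a + b) + ui * (q * chj (- a + b)) * uj) +
           (q * chj (a + b) - ui * (q * chj (a + b)) * uj)).
Proof.
rewrite /chj /expq opprD opprK [in - (a + b)]opprD !cosD !sinD !cosN !sinN.
move: (cos a) (sin a) (cos b) (sin b) => ca sa cb sb.
by apply: quat_ext => /=; field.
Qed.

Lemma qft_integral_twosided f w : integrableq L f ->
  qft_integral f w = twosided (rfourier f) w.
Proof.
move=> fi; have i1 := integrableq_charj (flipv w) fi.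
have i2 := integrableq_charj w fi.
have j1 := integrableqMr uj (integrableqM ui i1).
have j2 := integrableqMr uj (integrableqM ui i2).
rewrite /twosided !rfourierE.
rewrite -(intqM ui i1) -(intqM ui i2) -(intqMr uj (integrableqM ui i1)).
rewrite -(intqMr uj (integrableqM ui i2)) -(intqD i1 j1) -(intqB i2 j2).
rewrite -(intqD (integrableqD i1 j1) (integrableqB i2 j2)).
rewrite -[X in _ *: X]mul1r scaleqAl.
rewrite -intqM; last exact: (integrableqD (integrableqD i1 j1) (integrableqB i2 j2)).
apply: eq_intq => z; rewrite -scaleqAl mul1r !charq_jE.
have -> : 2 * pi * dotv (flipv w) z =
    - (2 * pi * dotv (fstv w) (fstv z)) + 2 * pi * dotv (sndv w) (sndv z).
  by rewrite dotv_split fstv_flipv sndv_flipv dotv_oppl -mulrN -mulrDr.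
rewrite [dotv w z]dotv_split (mulrDr (2 * pi)).
exact: expq_sandwich.
Qed.

Lemma measurableq_twosided g : measurableq g -> measurableq (twosided g).
Proof.
move=> mg; have mgf := measurableq_dilates (@dilates_flipv R n) mg.
have s (h : vec R (n + n) -> quat R) : measurableq h ->
    measurableq (fun w => ui * h w * uj).
  move=> mh; apply: measurableqM; last exact: measurableq_cst.
  by apply: measurableqM => //; exact: measurableq_cst.
apply: measurableqZ; first exact: measurable_cst.
exact: (measurableqD (measurableqD mgf (s _ mgf)) (measurableqB mg (s _ mg))).
Qed.

Lemma normsq_twosided g w :
  normsq (twosided g w) <= 2 * normsq (g (flipv w)) + 2 * normsq (g w).
Proof.
have s q : normsq (ui * q * uj) = normsq q.
  by rewrite !normsqM /normsq /= !expr0n /= !expr1n !add0r !addr0 mul1r mulr1.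
have h1 := normsqDle (g (flipv w) + ui * g (flipv w) * uj) (g w - ui * g w * uj).
have h2 := normsqDle (g (flipv w)) (ui * g (flipv w) * uj).
have h3 := normsqBle (g w) (ui * g w * uj).
rewrite s in h2; rewrite s in h3.
rewrite /twosided normsqZ; clear -h1 h2 h3; lra.
Qed.

Lemma twosidedB g h w :
  twosided g w - twosided h w = twosided (fun x => g x - h x) w.
Proof.
rewrite /twosided -scalerBr; congr (_ *: _).
rewrite !mulrBr !mulrBl !opprD !opprK.
move: (g (flipv w)) (h (flipv w)) (g w) (h w) => a b c d.
by apply: quat_ext => /=; ring.
Qed.

Lemma energy_twosided g : measurableq g ->
  (energy L (twosided g) <= 4%:E * energy L g)%E.
Proof.
move=> mg; have mgf := measurableq_dilates (@dilates_flipv R n) mg.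
have m1 := measurable_normsq mgf; have m2 := measurable_normsq mg.
have N1 w : 0 <= 2 * normsq (g (flipv w)) by rewrite mulr_ge0// normsq_ge0.
have N2 w : 0 <= 2 * normsq (g w) by rewrite mulr_ge0// normsq_ge0.
have M1 : measurable_fun setT (fun w => 2 * normsq (g (flipv w))).
  by apply: measurable_funM => //; exact: measurable_cst.
have M2 : measurable_fun setT (fun w => 2 * normsq (g w)).
  by apply: measurable_funM => //; exact: measurable_cst.
apply: (@le_trans _ _
    (\int[L]_w (2 * normsq (g (flipv w)) + 2 * normsq (g w))%:E)%E).
  apply: le_integral_EFin => //.
  - by apply: measurable_normsq; exact: measurableq_twosided.
  - exact: measurable_funD.
  - by move=> w; exact: normsq_ge0.
  - by move=> w; exact: normsq_twosided.
rewrite ge0_integralD_EFin//.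
rewrite (ge0_integralZ_EFin L m1 (fun w => normsq_ge0 _) (ler0n _ 2)).
rewrite (ge0_integralZ_EFin L m2 (fun w => normsq_ge0 _) (ler0n _ 2)).
rewrite -[X in (2%:E * X + _)%E]/(energy L (fun w => g (flipv w))).
rewrite (energy_dilates (@dilates_flipv R n) mg) mul1e.
rewrite -[X in (_ + 2%:E * X)%E]/(energy L g) -ge0_muleDl ?lee_fin//.
by rewrite -EFinD -natrD.
Qed.

Lemma finite_energy_twosided g : finite_energy L g -> finite_energy L (twosided g).
Proof.
move=> [mg eg]; split; first exact: measurableq_twosided.
apply: le_lt_trans (energy_twosided mg) _.
by apply: lte_mul_pinfty => //; rewrite ge0_fin_numE// energy_ge0.
Qed.

Lemma energy_cvg_twosided F f : (forall k, measurableq (F k)) -> measurableq f ->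
  energy_cvg L F f -> energy_cvg L (fun k => twosided (F k)) (twosided f).
Proof.
move=> mF mf /(cvge0Z 4); apply: cvge0_le => k; first exact: energy_ge0.
apply: le_trans (energy_twosided (measurableqB (mF k) mf)).
rewrite le_eqVlt; apply/orP; left; apply/eqP.
by congr energy; apply/funext => w; exact: twosidedB.
Qed.

Lemma is_qft_twosided f g : L2_rfourier f g -> is_qft f (twosided g).
Proof.
move=> [ef eg [F [iF Ff Fg]]]; split.
  by apply/inL2E; exact: finite_energy_twosided.
exists F; split.
- by move=> k; have [? ?] := iF k; split; [apply/inL1E|apply/inL2E].
- by apply/normq2_cvgP.
- apply/normq2_cvgP.
  rewrite (_ : (fun k => qft_integral (F k)) =
      (fun k => twosided (rfourier (F k)))); last first.
    apply/funext => k; apply/funext => w.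
    by have [? _] := iF k; exact: qft_integral_twosided.
  apply: energy_cvg_twosided => //.
    by move=> k; apply: measurableq_rfourier; have [_ []] := iF k.
  by case: eg.
Qed.

(** Approximants of [f] serve for both transforms, since the right-sided one is an
    isometry and [twosided] is bounded. *)
Lemma is_qft_unique f g G : L2_rfourier f g -> is_qft f G ->
  {ae L, forall w, G w = twosided g w}.
Proof.
move=> fg [/inL2E eG [F [iF /normq2_cvgP Ff /normq2_cvgP FG]]].
have [_ eg _] := fg; have [[mg _] [mG _]] := (eg, eG).
have iF1 k : integrableq L (F k) by apply/inL1E; have [] := iF k.
have iF2 k : finite_energy L (F k) by apply/inL2E; have [] := iF k.
have mr k : measurableq (rfourier (F k)).
  by apply: measurableq_rfourier; have [] := iF2 k.
have Fg : energy_cvg L (fun k => rfourier (F k)) g.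
  rewrite /energy_cvg (_ : (fun k => _) = (fun k => energy L (fun x => F k x - f x)))//.
  apply/funext => k.
  exact: (L2_rfourier_isometry (L2_rfourierB (L2_rfourier_integrable (iF1 k) (iF2 k)) fg)).
have FQ := energy_cvg_twosided mr mg Fg.
have mQ := measurableq_twosided mg.
have FG' : energy_cvg L (fun k => twosided (rfourier (F k))) G.
  rewrite /energy_cvg; move: FG; rewrite /energy_cvg.
  rewrite (_ : (fun k => energy L (fun x => qft_integral (F k) x - G x)) =
    (fun k => energy L (fun x => twosided (rfourier (F k)) x - G x)))//.
  apply/funext => k; congr energy; apply/funext => w; congr (_ - _).
  exact: qft_integral_twosided.
have E0 : energy L (fun w => G w - twosided g w) = 0%E.
  apply/eqP; rewrite eq_le energy_ge0 andbT; apply/lee_addgt0Pr => e e0.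
  have e4 : 0 < e / 4 by rewrite divr_gt0.
  have := filterI (cvge0_near_lt e4 FQ) (cvge0_near_lt e4 FG').
  case=> N _ /(_ N (leqnn N))[a b]; rewrite add0e.
  have mT := measurableq_twosided (mr N).
  have := energyB_le L (measurableqB mT mQ) (measurableqB mT mG).
  rewrite (_ : (fun x => _ - _ - _) = (fun w => G w - twosided g w)); last first.
    apply/funext => w.
    by rewrite opprB addrC addrA subrK.
  move=> /le_trans; apply.
  apply: (@le_trans _ _ (2%:E * (e / 4)%:E + 2%:E * (e / 4)%:E)%E).
    by apply: leeD; apply: lee_wpmul2l => //; exact: ltW.
  by rewrite -!EFinM -EFinD lee_fin; lra.
apply: filterS (energy_eq0 (measurableqB mG mQ) E0) => w /eqP.
by rewrite subr_eq0 => /eqP.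
Qed.

Lemma qft_twosided f g : L2_rfourier f g ->
  measurableq (qft f) /\ {ae L, forall w, qft f w = twosided g w}.
Proof.
move=> fg; have q : is_qft f (qft f).
  by apply: (@xgetPex _ (fun=> 0) [set g | is_qft f g]); exists (twosided g);
    exact: is_qft_twosided.
split; last exact: (is_qft_unique fg q).
by have [/inL2E[]] := q.
Qed.

End two_sided.

(** * The window and its admissibility constant *)

Section symmetric_window.
Context {R : realType} {n : nat}.
Local Notation m := (n.+1 + n.+1)%N.
Local Notation L := (leb R m).
Local Notation ui := (unit_i R).
Local Notation uj := (unit_j R).
Variables (psi p : vec R m -> quat R).
Hypothesis psip : L2_rfourier psi p.
Hypothesis psi_comm : {ae L, forall w, forall t : vec R n.+1,
  qft psi w * charq uj (sndv w) t = charq uj (sndv w) t * qft psi w}.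
Hypothesis psi_j : {ae L, forall w, forall t : vec R n.+1,
  qft (fun x => uj * psi x) w * charq uj (sndv w) t
  = uj * charq uj (sndv w) t * qft psi w}.

Let halves_sum (q : quat R) :
  2^-1 *: ((q + ui * q * uj) + (q - ui * q * uj)) = q.
Proof. by apply: quat_ext; rewrite /=; field. Qed.

Let mp : measurableq p. Proof. by case: psip => _ []. Qed.

Let Qp : {ae L, forall w, qft psi w = twosided p w}.
Proof. exact: (qft_twosided psip).2. Qed.

Lemma chj_pi2 : chj (pi / 2 : R) = - uj.
Proof.
rewrite chjE cos_pihalf sin_pihalf.
by apply: quat_ext; rewrite /= ?oppr0.
Qed.

Let twosided_comm : {ae L, forall w, twosided p w * uj = uj * twosided p w}.
Proof.
have ae0 := @ae_tnth_neq0 R m (rshift n.+1 ord0).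
apply: filterS2 (filterI Qp psi_comm) ae0 => w [Qw comm] v0; rewrite -Qw.
set v : R := tnth w (rshift n.+1 ord0) in v0.
(* For this [t] the character takes the value [- j] at [w]. *)
pose t : vec R n.+1 := [tuple if i == ord0 then (4 * v)^-1 : R else 0 | i < n.+1].
have dt : dotv (sndv w) t = 4^-1.
  rewrite /dotv (bigD1 ord0)//= !tnth_mktuple eqxx big1 => [|i /negPf i0].
    by rewrite addr0 -/v invfM mulrCA divff// mulr1.
  by rewrite [tnth t i]tnth_mktuple i0 mulr0.
have := comm t; rewrite charq_jE dt.
have -> : 2 * pi * 4^-1 = pi / 2 :> R.
  by move: (pi : R) => x; field.
by rewrite chj_pi2 mulrN mulNr => /oppr_inj.
Qed.

Let charq0 (w : vec R m) : charq uj (sndv w) [tuple of nseq n.+1 0] = 1.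
Proof.
rewrite charq_jE (_ : dotv _ _ = 0) ?mulr0 ?chj0//.
by apply: big1 => i _; rewrite tnth_nseq mulr0.
Qed.

(** At [t = 0] the hypothesis gives [qft (j psi) = j qft psi], whereas
    [twosided (j p)] is [j] times the reflection of [twosided p]. *)
Let twosided_even : {ae L, forall w, twosided p (flipv w) = twosided p w}.
Proof.
have jQ := (qft_twosided (L2_rfourierM uj psip)).2.
apply: filterS (ae_dilates (@dilates_flipv R n.+1) (filterI jQ (filterI Qp psi_j))).
move=> w [jE [qE /(_ [tuple of nseq n.+1 0])]].
rewrite charq0 !mulr1 jE qE => h.
have jp : twosided (fun x => uj * p x) (flipv w) = uj * twosided p w.
  rewrite /twosided flipvK; move: (p w) (p (flipv w)) => a b.
  by apply: quat_ext; rewrite /=; ring.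
move: h; rewrite jp => /(congr1 (fun q => - uj * q)); rewrite !mulrA.
have -> : - uj * uj = 1 by apply: quat_ext; rewrite /=; ring.
by rewrite !mul1r.
Qed.

(** The two halves of [twosided] lie in the two eigenspaces of [q -> i q j], so
    that each of them is even. *)
Let p_flip : {ae L, forall w, p (flipv w) = p w}.
Proof.
apply: filterS twosided_even => w.
rewrite /twosided flipvK; move: (p w) (p (flipv w)) => a b [h1 h2 h3 h4].
by apply: quat_ext; move: h1 h2 h3 h4 => /=; lra.
Qed.

(** The transform of the window is symmetric in the first half of the
    frequencies and takes its values in the plane spanned by [1] and [j]. *)
Lemma window_transform : {ae L, forall w, p (flipv w) = p w /\ p w * uj = uj * p w}.
Proof.
apply: filterS2 p_flip twosided_comm => w pw; rewrite /twosided pw.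
set q := p w.
by rewrite halves_sum.
Qed.

(** [psi] and its conjugate by [j] have the same transform. *)
Lemma window_comm : {ae L, forall x, psi x * uj = uj * psi x}.
Proof.
have cj (theta : R) : (- uj) * chj theta = chj theta * (- uj).
  by apply: quat_ext; rewrite chjE /=; ring.
have h := L2_rfourierMr cj (L2_rfourierM uj psip).
have jj : uj * (- uj) = 1 by apply: quat_ext; rewrite /=; ring.
have pp : {ae L, forall w, uj * p w * (- uj) = p w}.
  by apply: filterS window_transform => w [_ <-]; rewrite -mulrA jj mulr1.
apply: filterS (L2_rfourier_inj h psip pp) => x E.
rewrite -[in LHS]E -mulrA (_ : - uj * uj = 1) ?mulr1//.
by apply: quat_ext; rewrite /=; ring.
Qed.

(** Such a [q] lies in the plane spanned by [1] and [j]; conjugation by [i] fixes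
    [1] and negates [j]. *)
Lemma conjq_comm_j (q : quat R) : q * uj = uj * q -> ui * q * (- ui) = conjq q.
Proof.
move=> [h1 h2 h3 h4]; apply: quat_ext => /=; move: h1 h2 h3 h4 => /=; lra.
Qed.

(** Conjugation by [i] turns the transform of [psi] into that of its adjoint. *)
Lemma window_starq : L2_rfourier (starq psi) (fun w => conjq (p w)).
Proof.
have [[mpsi _] _ _] := psip.
have i2 : (- ui) * ui = 1 by apply: quat_ext; rewrite /=; ring.
have ni : normsq (- ui) = 1 by rewrite /normsq /=; ring.
have ni' : normsq ui = 1 by rewrite /normsq /=; ring.
have mi (h : vec R m -> quat R) : measurableq h ->
    measurableq (fun x => ui * h x * (- ui)).
  move=> mh; apply: measurableqM; last exact: measurableq_cst.
  by apply: measurableqM => //; exact: measurableq_cst.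
have tr := @L2_rfourier_transfer R m
  (fun h x => ui * h (oppv x) * (- ui)) (fun h w => ui * h w * (- ui)) 1 1 psi p.
have : L2_rfourier (fun x => ui * psi (oppv x) * (- ui)) (fun w => ui * p w * (- ui)).
  apply: tr => //.
  - by move=> h mh; apply: mi; exact: (measurableq_dilates (@dilates_oppv R m)).
  - by move=> h h' x; rewrite mulrBr mulrBl.
  - by move=> h h' x; rewrite mulrBr mulrBl.
  - move=> h mh; have mho := measurableq_dilates (@dilates_oppv R m) mh.
    rewrite energyMr; last by apply: measurableqM => //; exact: measurableq_cst.
    rewrite energyM// ni ni' !mul1e.
    by rewrite (energy_dilates (@dilates_oppv R m) mh) mul1e.
  - move=> h mh; rewrite energyMr; last first.
      by apply: measurableqM => //; exact: measurableq_cst.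
    by rewrite energyM// ni ni' !mul1e.
  - move=> h hi; apply: integrableqMr; apply: integrableqM.
    exact: (integrableq_dilates (@dilates_oppv R m) hi).
  - move=> h w hi _.
    have hic := integrableq_charj w hi.
    rewrite !rfourierE -(intqM ui hic) -(intqMr (- ui) (integrableqM ui hic)).
    rewrite -[RHS]scale1r.
    rewrite -(intq_dilates (@dilates_oppv R m)
      (integrableqMr (- ui) (integrableqM ui hic))).
    apply: eq_intq => x; rewrite -!mulrA; congr (_ * (_ * _)).
    rewrite !charq_jE dotv_oppr (mulrN (2 * pi)).
    by apply: quat_ext; rewrite !chjE cosN sinN /=; ring.
apply: L2_rfourier_ae.
- by apply: measurableq_conj; exact: (measurableq_dilates (@dilates_oppv R m) mpsi).
- exact: measurableq_conj.
- apply: filterS (ae_dilates (@dilates_oppv R m) window_comm) => x.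
  exact: conjq_comm_j.
- by apply: filterS window_transform => w [_]; exact: conjq_comm_j.
Qed.

(** The transform of [psi^*] inherits the symmetry of [p], so that its two-sided
    and right-sided versions coincide. *)
Lemma admissibility_constantE : admissibility_constant psi =
  (\int[L]_l (normsq (p l) / `|headv l : R| ^+ m)%:E)%E.
Proof.
have [mq qE] := qft_twosided window_starq.
have mh : measurable_fun setT (fun l : vec R m => (`|headv l : R| ^+ m)^-1).
  rewrite (_ : (fun l => _) = (@powR R ^~ (-1))
      \o (fun x : R => `|x| ^+ m) \o (@headv R m.-1)); last first.
    by apply/funext => z /=; rewrite powR_inv1.
  apply: measurableT_comp; last exact: measurable_headv.
  apply: measurableT_comp; first exact: measurable_powR.
  by apply: measurable_funX; exact: normr_measurable.
apply: ae_eq_integral => //.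
- apply/measurable_EFinP; apply: measurable_funM; last exact: mh.
  by under eq_fun do rewrite absq_sqr; exact: measurable_normsq.
- apply/measurable_EFinP; apply: measurable_funM; last exact: mh.
  exact: measurable_normsq.
- apply: filterS2 qE window_transform => l -> [pl _] _.
  rewrite absq_sqr; congr (_ / _)%:E; rewrite /twosided pl.
  set q := conjq (p l).
  rewrite halves_sum.
  exact: normsq_conj.
Qed.

End symmetric_window.

(** * Dilations and shears in space and in frequency *)

Section parameters.
Context {R : realType} {k : nat}.
Local Notation R' := (measurableTypeR R).
Local Notation leb1 := (@lebesgue_measure R).
Local Notation L := (leb R k.+1).
Local Notation uj := (unit_j R).

(** The entry of the dilation matrix on the last [k] coordinates. *)
Definition kappa (a : R) : R := Num.sg a * `|a| `^ (k.+1%:R^-1).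
Definition amplitude (a : R) : R := `|a| `^ ((2 * k.+1)%:R^-1 - 1).
(** The modulus of the determinant of the dilation matrix. *)
Definition jacobian (a : R) : R := `|kappa a| ^+ k * `|a|.

Lemma kappa_neq0 (a : R) : a != 0 -> kappa a != 0.
Proof.
move=> a0; rewrite /kappa mulf_neq0 ?sgr_eq0// powR_eq0 normr_eq0 (negPf a0).
by [].
Qed.

Lemma jacobian_gt0 (a : R) : a != 0 -> 0 < jacobian a.
Proof.
move=> a0; rewrite /jacobian mulr_gt0 ?exprn_gt0 ?normr_gt0//.
exact: kappa_neq0.
Qed.

Lemma amplitude_jacobian (a : R) : a != 0 -> amplitude a ^+ 2 * jacobian a = 1.
Proof.
move=> a0; have a1 : 0 < `|a| by rewrite normr_gt0.
have K0 : k.+1%:R != 0 :> R by rewrite pnatr_eq0.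
rewrite /amplitude /jacobian /kappa normrM normr_sg a0 mul1r.
rewrite [`|_ `^ _|]ger0_norm ?powR_ge0//.
rewrite -[X in _ * (_ * X)]powRr1 ?ltW// -!powR_mulrn ?powR_ge0//.
rewrite -!powRrM -!powRD ?(gt_eqF a1) ?implybT//.
rewrite (_ : _ + _ = 0) ?powRr0//.
rewrite natrM -natr1 in K0 *.
by move: (k%:R : R) K0 => K K0; field; rewrite K0.
Qed.

(** The coordinates of [A_a^-1 S_s^-1 y]. *)
Definition inv_shear a (s : vec R k) (y : vec R k.+1) : vec R k.+1 :=
  consv (a^-1 * headv y + - (a^-1 * dotv s (tailv y)) : R',
         affinev (fun=> (kappa a)^-1) (fun=> 0) (tailv y)).

(** The coordinates of [A_a^T S_s^T xi]; the summand [0] gives it the form of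
    [dilates_affine]. *)
Definition freq_shear a (s : vec R k) (xi : vec R k.+1) : vec R k.+1 :=
  consv (a * headv xi + 0 : R',
    affinev (fun=> kappa a) (fun i => kappa a * (tnth s i * headv xi)) (tailv xi)).

Lemma dotv_affinev (x y : vec R k) c b c' b' : dotv (affinev c b x) (affinev c' b' y) =
  \sum_i (c i * (tnth x i : R) + b i) * (c' i * (tnth y i : R) + b' i).
Proof. by apply: eq_bigr => i _; rewrite !tnth_mktuple. Qed.

(** [freq_shear a s] is the transpose of the inverse of [inv_shear a s]. *)
Lemma dotv_freq_shear (a : R) s xi y : a != 0 ->
  dotv (freq_shear a s xi) (inv_shear a s y) = dotv xi y.
Proof.
move=> a0; have K0 := kappa_neq0 a0.
rewrite -{2}(consv_eta xi) -{2}(consv_eta y) /freq_shear /inv_shear !dotv_consv.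
rewrite dotv_affinev.
have -> : \sum_i (kappa a * (tnth (tailv xi) i : R) + kappa a * (tnth s i * headv xi)) *
    ((kappa a)^-1 * (tnth (tailv y) i : R) + 0) =
    dotv (tailv xi) (tailv y) + headv xi * dotv s (tailv y).
  rewrite /dotv big_distrr -big_split/=; apply: eq_bigr => i _.
  move: (kappa a) K0 (tnth (tailv xi) i : R) (tnth s i : R) (tnth (tailv y) i : R)
    (headv xi : R) => K K0 u v w z.
  by field.
set A := dotv s _; set B := dotv _ _; move: (headv xi : R) (headv y : R) => u v.
by clear -a0; move: A B => A B; field.
Qed.

Lemma dilates_inv_shear (a : R) s : a != 0 -> dilates L (inv_shear a s) (jacobian a).
Proof.
move=> a0; have ai0 : a^-1 != 0 by rewrite invr_eq0.
have K0 : (kappa a)^-1 != 0 by rewrite invr_eq0 kappa_neq0.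
have := dilates_head (sigma := fun (x : vec R k) (u : R') =>
  a^-1 * u + - (a^-1 * dotv s x) : R')
  (fun x => dilates_affine _ ai0) (dilates_homothety (fun=> 0) K0).
rewrite /jacobian !normfV exprVn !invrK; apply.
apply: measurable_funD; first exact: measurable_funM.
apply: measurable_funN; apply: measurable_funM => //.
by apply: measurable_dotv => //; exact: measurable_cst.
Qed.

Lemma dilates_freq_shear (a : R) s : a != 0 ->
  dilates L (freq_shear a s) (jacobian a)^-1.
Proof.
move=> a0; have K0 := kappa_neq0 a0.
have := dilates_tail (tau := fun (u : R') => affinev (fun=> kappa a)
  (fun i => kappa a * (tnth s i * u))) (dilates_affine 0 a0)
  (fun u => dilates_homothety _ K0).
rewrite /jacobian invfM mulrC; apply.
apply/measurable_fun_tnthP => i.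
rewrite (_ : _ \o _ = fun z : R' * vec R k =>
  kappa a * tnth z.2 i + kappa a * (tnth s i * z.1)); last first.
  by apply/funext => z /=; rewrite tnth_mktuple.
apply: measurable_funD; apply: measurable_funM => //.
  exact: (measurableT_comp (measurable_tnth i)).
by apply: measurable_funM => //; exact: measurable_cst.
Qed.

Definition dilated a s (h : vec R k.+1 -> quat R) (x : vec R k.+1) : quat R :=
  amplitude a *: h (inv_shear a s x).

Definition freq_dilated a s (g : vec R k.+1 -> quat R) (xi : vec R k.+1) : quat R :=
  (amplitude a * jacobian a) *: g (freq_shear a s xi).

Lemma energyZ d (T : measurableType d) (mu : {measure set T -> \bar R}) (c : R)
  (f : T -> quat R) : measurableq f ->
  energy mu (fun x => c *: f x) = ((c ^+ 2)%:E * energy mu f)%E.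
Proof.
move=> mf; rewrite /energy -ge0_integralZ_EFin ?sqr_ge0//.
- by apply: eq_integral => x _; rewrite normsqZ.
- exact: measurable_normsq.
- by move=> x; exact: normsq_ge0.
Qed.

Lemma scaleqE (c : R) (q : quat R) : c *: q = (c *: (1 : quat R)) * q.
Proof. by rewrite -scaleqAl mul1r. Qed.

Lemma L2_rfourier_dilated (a : R) s h g : a != 0 -> L2_rfourier h g ->
  L2_rfourier (dilated a s h) (freq_dilated a s g).
Proof.
move=> a0; have dI := dilates_inv_shear s a0; have dF := dilates_freq_shear s a0.
have J0 := jacobian_gt0 a0; have AJ := amplitude_jacobian a0.
apply: (@L2_rfourier_transfer _ _ (dilated a s) (freq_dilated a s) 1 1) => //.
- move=> f mf; apply: measurableqZ; first exact: measurable_cst.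
  exact: (measurableq_dilates dI).
- move=> f mf; apply: measurableqZ; first exact: measurable_cst.
  exact: (measurableq_dilates dF).
- by move=> f f' x; rewrite /dilated scalerBr.
- by move=> f f' x; rewrite /freq_dilated scalerBr.
- move=> f mf; rewrite /dilated (energyZ _ _ (measurableq_dilates dI mf)).
  by rewrite (energy_dilates dI mf) muleA -EFinM AJ.
- move=> f mf; rewrite /freq_dilated (energyZ _ _ (measurableq_dilates dF mf)).
  rewrite (energy_dilates dF mf) muleA -EFinM.
  congr (_%:E * _)%E; rewrite -AJ; clear -J0; move: (jacobian a) J0 => J J0.
  by field; rewrite gt_eqF.
- move=> f fi; rewrite /dilated; under eq_fun do rewrite scaleqE.
  by apply: integrableqM; exact: (integrableq_dilates dI).
- move=> f w fi _; have fic := integrableq_charj (freq_shear a s w) fi.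
  rewrite /freq_dilated (mulrC (amplitude a)) -scalerA rfourierE [in RHS]rfourierE.
  rewrite (scaleqE (amplitude a)) -(intqM _ fic).
  rewrite -(intq_dilates dI (integrableqM _ fic)).
  apply: eq_intq => x; rewrite /dilated !charq_jE dotv_freq_shear//.
  by rewrite mulrA -scaleqE.
Qed.

Lemma subvE (x t : vec R k.+1) : subv x t = affinev (fun=> 1) (fun i => - (tnth t i : R)) x.
Proof. by apply: eq_from_tnth => i; rewrite !tnth_mktuple mul1r. Qed.

Lemma dilates_subv (t : vec R k.+1) : dilates L (fun x => subv x t) 1.
Proof.
under eq_fun do rewrite subvE.
have := dilates_homothety (fun i => - (tnth t i : R)) (oner_neq0 R).
by rewrite normr1 expr1n invr1.
Qed.

Lemma L2_rfourier_translate t h g : L2_rfourier h g ->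
  L2_rfourier (fun x => h (subv x t)) (fun xi : vec R k.+1 => g xi * charq uj xi t).
Proof.
have dS := dilates_subv t.
have mc : measurableq (fun xi : vec R k.+1 => charq uj xi t).
  by apply: (@measurableq_charj _ _ _ _ id (fun=> t)) => //; exact: measurable_cst.
apply: (@L2_rfourier_transfer _ _ (fun h x => h (subv x t))
  (fun g (xi : vec R k.+1) => g xi * charq uj xi t) 1 1) => //.
- by move=> f mf; exact: (measurableq_dilates dS).
- by move=> f mf; exact: measurableqM.
- by move=> f f' x; rewrite mulrBl.
- by move=> f mf; rewrite (energy_dilates dS).
- move=> f mf; rewrite mul1e; apply: eq_integral => x _.
  by rewrite normsqM charq_jE normsq_chj mulr1.
- by move=> f fi; exact: (integrableq_dilates dS).
- move=> f w fi _; have fic := integrableq_charj w fi.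
  rewrite !rfourierE -(intqMr _ fic).
  rewrite -[RHS]scale1r -(intq_dilates dS (integrableqMr _ fic)).
  apply: eq_intq => x; rewrite -mulrA !charq_jE -chjD; congr (_ * chj _).
  rewrite -mulrDr; congr (_ * _); rewrite /dotv -big_split/=.
  by apply: eq_bigr => i _; rewrite tnth_mktuple -mulrDr subrK.
Qed.

End parameters.

Arguments kappa {R} k a.
Arguments amplitude {R} k a.
Arguments jacobian {R} k a.

Section measurable_parameters.
Context {R : realType} {k : nat}.
Local Notation R' := (measurableTypeR R).

Lemma measurable_invr : measurable_fun [set: R'] (fun x : R' => (x : R)^-1).
Proof.
rewrite (_ : (fun x => _) = fun x : R' => (x : R) * ((x : R) ^+ 2) `^ (-1)).
  apply: measurable_funM => //; apply: (measurableT_comp (@measurable_powR R _)).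
  exact: measurable_funX.
apply/funext => x; rewrite powR_inv1 ?sqr_ge0//.
have [->|x0] := eqVneq (x : R) 0; first by rewrite invr0 mul0r.
by rewrite expr2 invfM mulrA divff// mul1r.
Qed.

Lemma measurable_normr : measurable_fun [set: R'] (fun x : R' => `|x : R|).
Proof. exact: normr_measurable. Qed.

Lemma measurable_kappa : measurable_fun [set: R'] (fun a : R' => @kappa R k a).
Proof.
rewrite (_ : (fun a => _) = fun a : R' =>
    (a : R) * `|a : R|^-1 * `|a : R| `^ (k.+1%:R^-1)).
  apply: measurable_funM.
    apply: measurable_funM => //.
    exact: (measurableT_comp measurable_invr measurable_normr).
  exact: (measurableT_comp (@measurable_powR R _) measurable_normr).
apply/funext => a; congr (_ * _).
have [->|a0] := eqVneq (a : R) 0; first by rewrite sgr0 mul0r.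
by rewrite -[X in X / _]mulr_sg_norm mulfK// normr_eq0.
Qed.

Lemma measurable_amplitude : measurable_fun [set: R'] (fun a : R' => @amplitude R k a).
Proof. exact: (measurableT_comp (@measurable_powR R _) measurable_normr). Qed.

Lemma measurable_jacobian : measurable_fun [set: R'] (fun a : R' => @jacobian R k a).
Proof.
apply: measurable_funM; last exact: measurable_normr.
by apply: measurable_funX; exact: (measurableT_comp measurable_normr measurable_kappa).
Qed.

Section joint.
Context d (T : measurableType d) (a : T -> R') (s : T -> vec R k)
  (x : T -> vec R k.+1).
Hypothesis ma : measurable_fun setT a.
Hypothesis ms : measurable_fun setT s.
Hypothesis mx : measurable_fun setT x.

Let mhx : measurable_fun setT (fun t => headv (x t)).
Proof. exact: (measurableT_comp (@measurable_headv R k) mx). Qed.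
Let mtx : measurable_fun setT (fun t => tailv (x t)).
Proof. exact: (measurableT_comp (@measurable_tailv R k) mx). Qed.

Lemma measurable_inv_shear : measurable_fun setT (fun t => inv_shear (a t) (s t) (x t)).
Proof.
have mi := measurableT_comp measurable_invr ma.
apply: measurable_pair_consv.
  apply: measurable_funD; first exact: measurable_funM.
  by apply: measurable_funN; apply: measurable_funM => //; exact: measurable_dotv.
apply/measurable_fun_tnthP => i.
rewrite (_ : _ \o _ = fun t => (kappa k (a t))^-1 * tnth (tailv (x t)) i + 0); last first.
  by apply/funext => t /=; rewrite tnth_mktuple.
apply: measurable_funD => //; apply: measurable_funM.
  exact: (measurableT_comp measurable_invr (measurableT_comp measurable_kappa ma)).
exact: (measurableT_comp (measurable_tnth i) mtx).
Qed.

Lemma measurable_freq_shear : measurable_fun setT (fun t => freq_shear (a t) (s t) (x t)).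
Proof.
have mk := measurableT_comp measurable_kappa ma.
apply: measurable_pair_consv.
  by apply: measurable_funD => //; exact: measurable_funM.
apply/measurable_fun_tnthP => i.
rewrite (_ : _ \o _ = fun t => kappa k (a t) * tnth (tailv (x t)) i +
    kappa k (a t) * (tnth (s t) i * headv (x t))); last first.
  by apply/funext => t /=; rewrite tnth_mktuple.
apply: measurable_funD; apply: measurable_funM => //.
  exact: (measurableT_comp (measurable_tnth i) mtx).
apply: measurable_funM => //.
exact: (measurableT_comp (measurable_tnth i) ms).
Qed.

Lemma measurable_subv (y : T -> vec R k.+1) : measurable_fun setT y ->
  measurable_fun setT (fun t => subv (x t) (y t)).
Proof.
move=> my; apply/measurable_fun_tnthP => i.
rewrite (_ : _ \o _ = fun t => tnth (x t) i - tnth (y t) i :> R); last first.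
  by apply/funext => t /=; rewrite tnth_mktuple.
apply: measurable_funB; first exact: (measurableT_comp (measurable_tnth i) mx).
exact: (measurableT_comp (measurable_tnth i) my).
Qed.

End joint.
End measurable_parameters.

Lemma weights_identity (R : realFieldType) (k : nat) (N u v K A : R) :
  u != 0 -> v != 0 -> K != 0 -> A ^+ 2 * (`|K| ^+ k * `|u|) = 1 ->
  (`|u| ^+ k.+2)^-1 * (N * (A * (`|K| ^+ k * `|u|)) ^+ 2) * `|K * v| ^- k =
  N * `|v| * (`|u * v| ^+ k.+1)^-1.
Proof.
rewrite !normrM !exprMn !exprS -!normr_gt0 => u0 v0 K0.
have {}K0 : 0 < `|K| ^+ k by rewrite exprn_gt0.
have uk0 : 0 < `|u| ^+ k by rewrite exprn_gt0.
have vk0 : 0 < `|v| ^+ k by rewrite exprn_gt0.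
move: (`|K| ^+ k) (`|u| ^+ k) (`|v| ^+ k) `|u| `|v| K0 uk0 vk0 u0 v0.
move=> {}K U V {}u {}v K0 U0 V0 u0 v0 AJ.
have KN : K != 0 by rewrite gt_eqF.
have uN : u != 0 by rewrite gt_eqF.
rewrite !expr0 !mulr1 in AJ *.
have -> : A * A = (K * u)^-1.
  apply: (mulIf (_ : K * u != 0)); first by rewrite mulf_neq0.
  by rewrite mulVf ?mulf_neq0.
by field; rewrite KN uN !gt_eqF.
Qed.

Lemma weighted_energy d (T : measurableType d) (R : realType)
    (mu : {measure set T -> \bar R}) (c : R) (q : T -> quat R) :
  measurableq q -> 0 <= c ->
  (\int[mu]_x (c * normsq (q x))%:E = c%:E * energy mu q)%E.
Proof.
move=> mq c0; apply: ge0_integralZ_EFin => //; first exact: measurable_normsq.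
by move=> x; exact: normsq_ge0.
Qed.

Lemma ae_imply d (T : measurableType d) (R : realType)
    (mu : {measure set T -> \bar R}) (P Q : T -> Prop) :
  {ae mu, forall x, P x} -> (forall x, P x -> Q x) -> {ae mu, forall x, Q x}.
Proof. by move=> aeP PQ; apply: filterS aeP. Qed.

(** * The total energy of the shearlet coefficients *)

Section transform.
Context {R : realType} {k : nat}.
Local Notation R' := (measurableTypeR R).
Local Notation leb1 := (@lebesgue_measure R).
Local Notation L := (leb R k.+1).
Local Notation uj := (unit_j R).
Variables (psi p f g : vec R k.+1 -> quat R).
Hypothesis psip : L2_rfourier psi p.
Hypothesis fg : L2_rfourier f g.
Hypothesis pj : {ae L, forall w, p w * uj = uj * p w}.

(** The shearlet coefficient, with the shearlet expressed in coordinates. *)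
Definition coefficient (a : R) (s : vec R k) (t : vec R k.+1) : quat R :=
  innerq L f (fun x => dilated a s psi (subv x t)).

Let mpsi : measurableq psi. Proof. by case: psip => -[]. Qed.
Let mp : measurableq p. Proof. by case: psip => _ []. Qed.
Let mf : measurableq f. Proof. by case: fg => -[]. Qed.
Let mg : measurableq g. Proof. by case: fg => _ []. Qed.

Let multiplier (a : R) (s : vec R k) (xi : vec R k.+1) : quat R :=
  g xi * conjq (freq_dilated a s p xi).

Let chj_comm (q : quat R) theta : q * uj = uj * q -> q * chj theta = chj theta * q.
Proof.
move=> [h1 h2 h3 h4]; rewrite chjE.
have e1 : qim_i q = 0 by move: h1 h2 h3 h4 => /=; lra.
have e2 : qim_k q = 0 by move: h1 h2 h3 h4 => /=; lra.
by apply: quat_ext; rewrite /= e1 e2; ring.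
Qed.

(** Parseval's identity; the translation by [t] has become a character, which
    commutes with the values of the transform of the window. *)
Lemma coefficient_fourier (a : R) s t : a != 0 ->
  coefficient a s t = rfourier (multiplier a s) (oppv t).
Proof.
move=> a0; have dp := L2_rfourier_dilated s a0 psip.
have tp := L2_rfourier_translate t dp.
rewrite /coefficient (parseval fg tp) rfourierE.
have mdp : measurableq (freq_dilated a s p) by case: dp => _ [].
have mtp : measurableq (fun xi : vec R k.+1 => freq_dilated a s p xi * charq uj xi t).
  by case: tp => _ [].
apply: ae_eq_intq.
- by apply: measurableqM => //; exact: measurableq_conj.
- apply: measurableqM.
    by apply: measurableqM => //; exact: measurableq_conj.
  by apply: (@measurableq_charj _ _ _ _ (fun=> oppv t) id) => //; exact: measurable_cst.
- apply: filterS (ae_dilates (dilates_freq_shear s a0) pj) => xi pxi.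
  rewrite /multiplier -[RHS]mulrA conjqM; congr (_ * _).
  have -> : charq uj (oppv t) xi = conjq (charq uj xi t).
    by rewrite !charq_jE -chjN dotv_oppl dotvC mulrN.
  rewrite -!conjqM; congr conjq; rewrite charq_jE /freq_dilated.
  by rewrite -scaleqAl -scaleqAr (chj_comm _ pxi).
Qed.

Notation params := (R' * vec R k)%type.
Definition leb_affine : {sigma_finite_measure set params -> \bar R} :=
  sigma_finite_prod leb1 (leb R k).

Lemma measurable_coefficient : measurableq
  (fun z : params * vec R k.+1 => coefficient z.1.1 z.1.2 z.2).
Proof.
apply: (@measurableq_intq _ _ _ _ _ L (fun z : (params * vec R k.+1) * vec R k.+1 =>
  f z.2 * conjq (dilated z.1.1.1 z.1.1.2 psi (subv z.2 z.1.2)))).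
have m1 : measurable_fun setT
    (fun z : (params * vec R k.+1) * vec R k.+1 => z.1.1).
  exact: (measurableT_comp measurable_fst measurable_fst).
have ma := measurableT_comp measurable_fst m1.
have ms := measurableT_comp measurable_snd m1.
have mt : measurable_fun setT
    (fun z : (params * vec R k.+1) * vec R k.+1 => z.1.2).
  exact: (measurableT_comp measurable_snd measurable_fst).
apply: measurableqM; first exact: (measurableq_comp measurable_snd mf).
apply: measurableq_conj; apply: measurableqZ.
  exact: (measurableT_comp (@measurable_amplitude R k) ma).
apply: (measurableq_comp _ mpsi); apply: measurable_inv_shear => //.
by apply: measurable_subv.
Qed.

Definition haar_weight (a : R) : R := (`|a| ^+ k.+2)^-1.

Lemma haar_weight_ge0 a : 0 <= haar_weight a.
Proof. by rewrite invr_ge0 exprn_ge0. Qed.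

Lemma measurable_haar_weight : measurable_fun [set: R'] (fun a : R' => haar_weight a).
Proof.
apply: (measurableT_comp measurable_invr).
by apply: measurable_funX; exact: measurable_normr.
Qed.

Let T (z : params * vec R k.+1) := haar_weight z.1.1 * normsq (multiplier z.1.1 z.1.2 z.2).

Let T0 z : 0 <= T z.
Proof. by rewrite mulr_ge0 ?normsq_ge0 ?haar_weight_ge0. Qed.

Let m11 : measurable_fun setT (fun z : params * vec R k.+1 => z.1.1).
Proof. exact: (measurableT_comp measurable_fst measurable_fst). Qed.

Let m12 : measurable_fun setT (fun z : params * vec R k.+1 => z.1.2).
Proof. exact: (measurableT_comp measurable_snd measurable_fst). Qed.

Let mw : measurable_fun setT (fun z : params * vec R k.+1 => haar_weight z.1.1).
Proof. exact: (measurableT_comp measurable_haar_weight m11). Qed.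

Let mT : measurable_fun setT T.
Proof.
apply: measurable_funM; first exact: mw.
apply: measurable_normsq; apply: measurableqM.
  exact: (measurableq_comp measurable_snd mg).
apply: measurableq_conj; apply: measurableqZ.
  apply: measurable_funM.
    exact: (measurableT_comp (@measurable_amplitude R k) m11).
  exact: (measurableT_comp (@measurable_jacobian R k) m11).
by apply: (measurableq_comp _ mp); apply: measurable_freq_shear.
Qed.

Definition admissibility_integral :=
  (\int[L]_l (normsq (p l) / `|headv l : R| ^+ k.+1)%:E)%E.

Let C := admissibility_integral.

Let mnp : measurable_fun setT (fun z : R' * vec R k => normsq (p (consv z))).
Proof.
by apply: measurable_normsq; apply: (measurableq_comp _ mp); exact: measurable_consv.
Qed.

Let slice (u : R') : \bar R := (\int[leb R k]_x (normsq (p (consv (u, x))))%:E)%E.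

Let mslice : measurable_fun setT slice.
Proof.
by apply: (@measurable_integral1 _ _ _ _ _ (leb R k) _ mnp) => z; exact: normsq_ge0.
Qed.

Let slice0 u : (0 <= slice u)%E.
Proof. by apply: integral_ge0 => x _; rewrite lee_fin normsq_ge0. Qed.

Let weight (u : R') : R := (`|u : R| ^+ k.+1)^-1.

Let mweight : measurable_fun setT weight.
Proof.
apply: (measurableT_comp measurable_invr).
by apply: measurable_funX; exact: measurable_normr.
Qed.

Let weight0 u : 0 <= weight u. Proof. by rewrite invr_ge0 exprn_ge0. Qed.

Let CE : C = (\int[leb1]_u ((weight u)%:E * slice u))%E.
Proof.
rewrite /C /admissibility_integral ge0_integral_leb_cons.
- apply: eq_integral => u _; rewrite /slice -ge0_integralZl ?lee_fin ?weight0//.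
  + by apply: eq_integral => x _; rewrite headv_consv mulrC EFinM.
  + by apply/measurable_EFinP; apply: (measurableT_comp mnp); exact: pair1_measurable.
  + by move=> x _; rewrite lee_fin normsq_ge0.
- apply/measurable_EFinP; apply: measurable_funM; first exact: measurable_normsq.
  exact: (measurableT_comp mweight (@measurable_headv R k)).
- by move=> z; rewrite lee_fin mulr_ge0 ?normsq_ge0// invr_ge0 exprn_ge0.
Qed.

(** For fixed [a] and [xi], the map [s -> A_a^T S_s^T xi] moves the last
    frequencies by a translation after a homothety of ratio [kappa a * xi_1]. *)
Let shear_integral (a : R') (xi : vec R k.+1) : (headv xi : R) != 0 ->
  (\int[leb R k]_s (T ((a, s), xi))%:E = (normsq (g xi))%:E *
   (`|headv xi : R|%:E * ((weight (headv xi * a + 0)%R)%:E * slice (headv xi * a + 0)%R)))%E.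
Proof.
move=> xi0; have [a0|a0] := eqVneq (a : R) 0.
  have wa : haar_weight a = 0 by rewrite /haar_weight a0 normr0 expr0n invr0.
  have we : weight (headv xi * a + 0) = 0.
    by rewrite /weight a0 mulr0 addr0 normr0 expr0n invr0.
  rewrite we mul0e !mule0 -[RHS](@integral0 _ _ _ (leb R k) setT).
  by apply: eq_integral => s _; rewrite /T /= wa mul0r.
have K0 := kappa_neq0 (k := k) a0.
have c0 : kappa k a * headv xi != 0 by rewrite mulf_neq0.
have [_ _ dE] := dilates_homothety (fun i => kappa k a * tnth (tailv xi) i) c0.
set W := haar_weight a * (normsq (g xi) * (amplitude k a * jacobian k a) ^+ 2).
have W0 : 0 <= W.
  by rewrite mulr_ge0 ?haar_weight_ge0// mulr_ge0 ?normsq_ge0 ?sqr_ge0.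
transitivity (\int[leb R k]_s (W * normsq (p (consv (a * headv xi + 0 : R',
    affinev (fun=> kappa k a * headv xi) (fun i => kappa k a * tnth (tailv xi) i) s))))%:E)%E.
  apply: eq_integral => s _; congr EFin.
  have <- : freq_shear a s xi = consv (a * headv xi + 0 : R',
      affinev (fun=> kappa k a * headv xi) (fun i => kappa k a * tnth (tailv xi) i) s).
    congr (consv (_, _)); apply: eq_from_tnth => i; rewrite !tnth_mktuple.
    move: (tnth (tailv xi) i : R) (tnth s i : R) (headv xi : R) => u v z.
    by ring.
  by rewrite /T /= /multiplier normsqM normsq_conj normsqZ /W -!mulrA.
have mu : measurable_fun setT (fun x => normsq (p (consv (a * headv xi + 0 : R', x)))).
  by apply: (measurableT_comp mnp); exact: pair1_measurable.
have N0 x : 0 <= normsq (p (consv (a * headv xi + 0 : R', x))) by exact: normsq_ge0.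
have [mtau _ _] := dilates_homothety (fun i => kappa k a * tnth (tailv xi) i) c0.
rewrite (ge0_integralZ_EFin (leb R k) (measurableT_comp mu mtau) (fun s => N0 _) W0).
rewrite (dE (fun x => (normsq (p (consv (a * headv xi + 0 : R', x))))%:E)); last 2 first.
- exact/measurable_EFinP.
- by move=> x; rewrite lee_fin.
rewrite -[X in (_ * (_ * X))%E]/(slice (a * headv xi + 0 : R')).
rewrite [(headv xi : R) * a]mulrC !muleA -!EFinM; congr (_%:E * _)%E.
rewrite /W /weight /haar_weight addr0.
exact: (weights_identity _ a0 xi0 K0 (amplitude_jacobian (k := k) a0)).
Qed.

(** Rescaling [a] by [xi_1] removes the dependence on [xi] of the integral over
    the dilations and shears. *)
Let affine_integral (xi : vec R k.+1) : (headv xi : R) != 0 ->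
  (\int[leb_affine]_z (T (z, xi))%:E = C * (normsq (g xi))%:E)%E.
Proof.
move=> xi0; have [mtau _ dE] := dilates_affine 0 xi0.
have mTxi : measurable_fun setT (fun z : params => (T (z, xi))%:E).
  by apply/measurable_EFinP; apply: (measurableT_comp mT); exact: pair2_measurable.
rewrite [LHS](@fubini_tonelli1 _ _ _ _ _ leb1 (leb R k) _ mTxi); last first.
  by move=> z; rewrite lee_fin.
rewrite /fubini_F.
pose G (u : R') := ((weight u)%:E * slice u)%E.
have mG : measurable_fun setT G.
  by apply: emeasurable_funM => //; exact/measurable_EFinP.
have G0 u : (0 <= G u)%E by rewrite mule_ge0 ?lee_fin ?weight0.
have mGt : measurable_fun setT (fun a : R' => G (headv xi * a + 0 : R')).
  exact: (measurableT_comp mG mtau).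
transitivity (\int[leb1]_a ((normsq (g xi))%:E *
    (`|headv xi : R|%:E * G (headv xi * a + 0)%R)))%E.
  by apply: eq_integral => a _; exact: shear_integral.
rewrite ge0_integralZl ?lee_fin ?normsq_ge0//; last 2 first.
- by apply: emeasurable_funM => //; exact: measurable_cst.
- by move=> a _; rewrite mule_ge0.
rewrite ge0_integralZl ?lee_fin// (dE G mG G0) [X in (_ * X)%E]muleA -EFinM.
by rewrite mulfV ?normr_eq0// mul1e CE muleC.
Qed.

Lemma total_multiplier_energy :
  (\int[leb_affine]_z \int[L]_xi (T (z, xi))%:E = C * energy L f)%E.
Proof.
rewrite (tonelli_EFin leb_affine L mT T0) -(L2_rfourier_isometry fg).
have mn := measurable_normsq mg.
have C0 : (0 <= C)%E by rewrite CE integral_ge0// => u _; rewrite mule_ge0 ?lee_fin ?weight0.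
rewrite /energy -ge0_integralZl//; last 2 first.
- exact/measurable_EFinP.
- by move=> xi _; rewrite lee_fin normsq_ge0.
apply: ae_eq_integral => //.
- exact: (measurable_integral2 leb_affine mT T0).
- by apply: emeasurable_funM; [exact: measurable_cst|exact/measurable_EFinP].
- have h := @ae_tnth_neq0 R k.+1 ord0.
  exact: (ae_imply h (fun xi xi0 _ => affine_integral xi0)).
Qed.

Hypothesis Cfin : (C < +oo)%E.

(** By [total_multiplier_energy] the multiplier has finite energy for almost every
    [(a, s)], which allows Plancherel's identity in [t]. *)
Lemma total_coefficient_energy :
  (\int[leb_affine]_z \int[L]_t
     (haar_weight z.1 * normsq (coefficient z.1 z.2 t))%:E = C * energy L f)%E.
Proof.
rewrite -total_multiplier_energy.
have [ef _ _] := fg.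
have C0 : (0 <= C)%E by rewrite CE integral_ge0// => u _; rewrite mule_ge0 ?lee_fin ?weight0.
have tot : (\int[leb_affine]_z \int[L]_xi (T (z, xi))%:E < +oo)%E.
  rewrite total_multiplier_energy; have [_ efin] := ef.
  by rewrite lte_mul_pinfty// ge0_fin_numE.
have mS : measurable_fun setT (fun z : params * vec R k.+1 =>
    haar_weight z.1.1 * normsq (coefficient z.1.1 z.1.2 z.2)).
  by apply: measurable_funM => //; exact: (measurable_normsq measurable_coefficient).
have S0 (z : params * vec R k.+1) :
    0 <= haar_weight z.1.1 * normsq (coefficient z.1.1 z.1.2 z.2).
  by rewrite mulr_ge0 ?haar_weight_ge0 ?normsq_ge0.
apply: ae_eq_integral => //.
- exact: (measurable_integral1 L mS S0).
- exact: (measurable_integral1 L mT T0).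
apply: (ae_imply (ae_integral_lty1 mT T0 tot)) => -[a s] Tfin _.
rewrite [(a, s).1]/= [(a, s).2]/=.
have [a0|a0] := eqVneq (a : R) 0.
  apply: eq_integral => x _; rewrite /T /haar_weight /= a0 normr0.
  by rewrite expr0n invr0 !mul0r.
have w0 : 0 < haar_weight a by rewrite invr_gt0 exprn_gt0// normr_gt0.
have dp := L2_rfourier_dilated s a0 psip; have [_ edp _] := dp.
have [_ eg _] := fg.
have mi : integrableq L (multiplier a s) by exact: integrableq_inner.
have [mm _] := mi.
have TE : (\int[L]_xi (T ((a, s), xi))%:E =
    (haar_weight a)%:E * energy L (multiplier a s))%E.
  exact: (weighted_energy L mm (haar_weight_ge0 a)).
have me : finite_energy L (multiplier a s).
  split=> //; rewrite ltey; apply/eqP => eoo; move: Tfin.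
  by rewrite TE eoo gt0_muley.
rewrite TE -(plancherel mi me).
have mc : measurableq (coefficient a s).
  exact: (measurableq_comp (@pair1_measurable _ _ _ _ (a, s)) measurable_coefficient).
have E := energy_dilates (@dilates_oppv R k.+1) (measurableq_rfourier mm).
have F : energy L (coefficient a s) = energy L (rfourier (multiplier a s)).
  apply: (etrans _ (etrans E (mul1e _))).
  by apply: eq_integral => t _; rewrite (coefficient_fourier s t a0).
exact: (etrans (weighted_energy L mc (haar_weight_ge0 a))
  (congr1 (fun e => (haar_weight a)%:E * e)%E F)).
Qed.

End transform.

(** * Densities and comparison of integrals *)

Section density.
Context d (T : measurableType d) (R : realType).
Context (mu nu : {measure set T -> \bar R}) (w : T -> R).
Hypothesis mw : measurable_fun setT w.
Hypothesis w0 : forall x, 0 <= w x.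
Hypothesis muE : forall A, measurable A -> mu A = (\int[nu]_(x in A) (w x)%:E)%E.

Local Open Scope ereal_scope.
Import HBNNSimple.

Let density_indic A : measurable A ->
  \int[mu]_x (\1_A x)%:E = \int[nu]_x ((w x)%:E * (\1_A x)%:E).
Proof.
move=> mA; rewrite integral_indic// setIT muE// integral_mkcond.
apply: eq_integral => x _; rewrite patchE indicE.
by case: ifPn => xA; rewrite ?mule1 ?mule0.
Qed.

Let mwE : measurable_fun setT (fun x => (w x)%:E).
Proof. exact/measurable_EFinP. Qed.

Let density_nnsfun (h : {nnsfun T >-> R}) :
  \int[mu]_x (h x)%:E = \int[nu]_x ((w x)%:E * (h x)%:E).
Proof.
under [LHS]eq_integral do rewrite fimfunE -fsumEFin//.
rewrite [LHS]ge0_integral_fsum//; last 2 first.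
  - by move=> r; exact/measurable_EFinP/measurableT_comp.
  - by move=> n x _; rewrite EFinM nnfun_muleindic_ge0.
under [RHS]eq_integral.
  move=> x xD; rewrite fimfunE -fsumEFin// ge0_mule_fsumr; last first.
    by move=> r; rewrite EFinM nnfun_muleindic_ge0.
  over.
rewrite [RHS]ge0_integral_fsum//; last 2 first.
  - move=> r; apply: emeasurable_funM => //.
    by apply/measurable_EFinP; do 2 apply/measurableT_comp => //.
  - by move=> n x _; rewrite mule_ge0 ?lee_fin// -lee_fin EFinM nnfun_muleindic_ge0.
apply: eq_fsbigr => r _.
have [r0|r0] := ltP r 0%R.
  rewrite preimage_nnfun0//.
  by rewrite !integral0_eq// => x _; rewrite indic0 mulr0 ?mule0.
have mr : measurable (h @^-1` [set r]) by [].
under eq_integral do rewrite EFinM.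
under [RHS]eq_integral do rewrite EFinM muleCA.
have mI : measurable_fun setT (fun x => (\1_(h @^-1` [set r]) x)%:E : \bar R).
  by apply/measurable_EFinP; exact: measurable_indic.
rewrite ge0_integralZl//.
rewrite density_indic// ge0_integralZl//.
- exact: emeasurable_funM.
- by move=> x _; rewrite mule_ge0 ?lee_fin.
Qed.

(** Simple functions, then monotone convergence. *)
Lemma ge0_integral_density (f : T -> \bar R) : measurable_fun setT f ->
  (forall x, 0 <= f x) -> \int[mu]_x f x = \int[nu]_x ((w x)%:E * f x).
Proof.
move=> mf f0; pose f_ := nnsfun_approx measurableT mf.
have mf_ n : measurable_fun setT (fun x => (f_ n x)%:E) by exact/measurable_EFinP.
have f_0 n x : 0 <= (f_ n x)%:E by rewrite lee_fin.
have f_nd x a b : (a <= b)%N -> (f_ a x)%:E <= (f_ b x)%:E.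
  by move=> ab; rewrite lee_fin; exact/lefP/nd_nnsfun_approx.
have f_cvg x : (f_ n x)%:E @[n --> \oo] --> f x.
  by apply: cvg_nnsfun_approx => //; move=> y _; exact: f0.
transitivity (limn (fun n => \int[mu]_x (f_ n x)%:E)).
  rewrite -monotone_convergence//=.
  - by apply: eq_integral => x _; apply/esym/cvg_lim.
  - by move=> x _ a b; exact: f_nd.
transitivity (limn (fun n => \int[nu]_x ((w x)%:E * (f_ n x)%:E))).
  by congr (limn _); apply/funext => n; exact: density_nnsfun.
rewrite -monotone_convergence//=.
- by apply: eq_integral => x _; apply/cvg_lim => //; exact: cvgeZl.
- by move=> n; exact: emeasurable_funM.
- by move=> n x _; rewrite mule_ge0 ?lee_fin.
- by move=> x _ a b ab; apply: lee_wpmul2l; rewrite ?lee_fin//; exact: f_nd.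
Qed.

End density.

(** The positive and the negative parts are compared separately, so that the
    integral of [f] may be infinite. *)
Lemma le_integral_total d (T : measurableType d) (R : realType)
    (mu : {measure set T -> \bar R}) (D : set T) (f g : T -> \bar R) :
  measurable D -> measurable_fun D f -> measurable_fun D g ->
  (forall x, D x -> f x <= g x)%E ->
  (\int[mu]_(x in D) f x <= \int[mu]_(x in D) g x)%E.
Proof.
move=> mD mf mg fg; rewrite integralE [leRHS]integralE; apply: leeB.
- apply: ge0_le_integral => //; try exact: measurable_funepos.
  move=> x Dx; rewrite !funeposE ge_max le_max fg//=.
  by rewrite le_max lexx orbT.
- apply: ge0_le_integral => //; try exact: measurable_funeneg.
  by move=> x Dx; rewrite !funenegE ge_max le_max leeN2 fg//= le_max lexx orbT.
Qed.

Section entropy_bound.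
Context {R : realType}.

(** By monotonicity of the logarithm; for [P = 0] both sides vanish. *)
Lemma ln_mul_le (P K : R) : 0 <= P -> P <= K -> ln P * P <= ln K * P.
Proof.
rewrite le_eqVlt => /predU1P[<- _|P0 PK]; first by rewrite !mulr0.
by rewrite ler_pM2r// ler_ln// posrE// (lt_le_trans P0).
Qed.

End entropy_bound.

(** * Shearlets in coordinates *)

Section matrices.
Context {R : realType} {n' : nat}.
Local Notation n := n'.+1.
Local Notation k := (n + n).-1.

Lemma mulmxvK (A : 'M[R]_(n + n)) (x y : vec R (n + n)) : A \in unitmx ->
  mulmxv A x = y -> mulmxv (invmx A) y = x.
Proof.
move=> uA <-; apply: eq_from_tnth => i; rewrite tnth_mktuple.
have -> : \col_j (tnth (mulmxv A x) j : R) = A *m \col_j (tnth x j : R).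
  by apply/colP => j; rewrite mxE tnth_mktuple.
by rewrite mulKmx// mxE.
Qed.

Lemma dilation_mx_unit (a : R) : a != 0 -> dilation_mx n' a \in unitmx.
Proof.
move=> a0; rewrite unitmxE.
have -> : \det (dilation_mx n' a) = a ^+ 1 * kappa k a ^+ k.
  apply: (etrans (@det_ublock R 1 k a%:M 0 _)).
  by rewrite !det_scalar.
by rewrite unitfE mulf_neq0// expf_neq0// kappa_neq0.
Qed.

Lemma shear_mx_unit (s : vec R k) : shear_mx s \in unitmx.
Proof.
rewrite unitmxE.
have -> : \det (shear_mx s) = 1; last exact: unitr1.
apply: (etrans (@det_ublock R 1 k 1%:M _ 1%:M)).
by rewrite !det1 mulr1.
Qed.

End matrices.

Lemma mulmxv_block (R : realType) k (b11 : 'M[R]_1) (b12 : 'M[R]_(1, k))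
    (b21 : 'M[R]_(k, 1)) (b22 : 'M[R]_k) (u : measurableTypeR R) (x : vec R k) :
  mulmxv (@block_mx R 1 k 1 k b11 b12 b21 b22 : 'M[R]_(k.+1)) (consv (u, x)) =
  consv ((b11 0 0 * u + (\sum_j b12 0 j * (tnth x j : R)) : measurableTypeR R),
    [tuple (b21 i 0 * u + (\sum_j b22 i j * (tnth x j : R)) : measurableTypeR R) | i < k]).
Proof.
have rE (j : 'I_k) : lift ord0 j = rshift 1 j by apply: val_inj.
have lE : ord0 = lshift k (ord0 : 'I_1) by apply: val_inj.
pose B := block_mx b11 b12 b21 b22.
have e11 : B ord0 ord0 = b11 0 0 by rewrite lE /B block_mxEul.
have e12 j : B ord0 (lift ord0 j) = b12 0 j by rewrite rE lE /B block_mxEur.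
have e21 (i : 'I_k) : B (lift ord0 i) ord0 = b21 i 0 by rewrite rE lE /B block_mxEdl.
have e22 (i j : 'I_k) : B (lift ord0 i) (lift ord0 j) = b22 i j.
  by rewrite !rE /B block_mxEdr.
apply: eq_from_tnth => i; rewrite tnth_mktuple mxE big_ord_recl.
rewrite [X in _ * X + _]mxE [X in _ * X + _]tnth0.
under eq_bigr do rewrite [X in _ * X]mxE [X in _ * X]tnthS.
case: (unliftP ord0 i) => [i'|] ->.
  rewrite [RHS]tnthS [RHS]tnth_mktuple; congr (_ * _ + _); first exact: e21.
  by apply: eq_bigr => j _; congr (_ * _); exact: e22.
rewrite [RHS]tnth0; congr (_ * _ + _); first exact: e11.
by apply: eq_bigr => j _; congr (_ * _); exact: e12.
Qed.

Section shearlets_explicit.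
Context {R : realType} {n' : nat}.
Local Notation n := n'.+1.
Local Notation k := (n + n).-1.
Local Notation R' := (measurableTypeR R).
Local Notation L := (leb R (n + n)).
Implicit Types (psi f : vec R (n + n) -> quat R) (t : vec R (n + n)).

Lemma mulmxv_inv_shear (a : R) (s : vec R k) (y : vec R (n + n)) : a != 0 ->
  mulmxv (invmx (dilation_mx n' a)) (mulmxv (invmx (shear_mx s)) y) =
  @inv_shear R k a s y.
Proof.
move=> a0; have K0 := kappa_neq0 (k := k) a0.
pose z : vec R k.+1 := consv ((headv y : R) - dotv s (tailv y) : R', @tailv R k y).
have -> : mulmxv (invmx (shear_mx s)) y = z.
  apply: mulmxvK; first exact: shear_mx_unit.
  apply: (etrans (mulmxv_block _ _ _ _ _ _)); rewrite -[RHS](@consv_eta R k).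
  congr (consv (_, _)).
    rewrite mxE mul1r; under eq_bigr do rewrite mxE.
    by rewrite -/(dotv _ _) subrK.
  apply: eq_from_tnth => i; rewrite tnth_mktuple mxE mul0r add0r.
  rewrite (bigD1 i)//= mxE eqxx mul1r big1 ?addr0// => j ji.
  by rewrite mxE eq_sym (negPf ji) mul0r.
apply: mulmxvK; first exact: dilation_mx_unit.
apply: (etrans (mulmxv_block _ _ _ _ _ _)); rewrite /z; congr (consv (_, _)).
  rewrite mxE eqxx mulr1n big1 ?addr0; last by move=> j _; rewrite mxE mul0r.
  by move: (dotv _ _) (headv y : R) => u v; field.
apply: eq_from_tnth => i; rewrite tnth_mktuple mxE mul0r add0r.
rewrite (bigD1 i)//= mxE eqxx mulr1n big1 ?addr0; last first.
  by move=> j ji; rewrite mxE eq_sym (negPf ji) mul0r.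
by rewrite tnth_mktuple addr0 mulrA -/(kappa k a) mulfV// mul1r.
Qed.

Lemma shearletE psi (a : R) s t x : a != 0 ->
  shearlet psi a s t x = @dilated R k a s psi (subv x t).
Proof.
move=> a0; rewrite /shearlet mulmxv_inv_shear// /dilated /amplitude.
congr (_ `^ ((_)%:R^-1 - 1) *: _).
by rewrite -[k.+1]/(n + n)%N addnn -muln2 mulnCA mulnC.
Qed.

Lemma shearlet_transformE psi f (a : R) s t : a != 0 ->
  shearlet_transform psi f a s t = @coefficient R k psi f a s t.
Proof.
move=> a0; rewrite /shearlet_transform /coefficient /innerq.
by apply: eq_intq => x; rewrite shearletE.
Qed.

End shearlets_explicit.

(** * The entropy inequality *)

Section shearlet_coefficients.
Context {R : realType} {n' : nat}.
Local Notation n := n'.+1.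
Local Notation k := (n + n).-1.
Local Notation R' := (measurableTypeR R).
Local Notation L := (leb R (n + n)).
Local Notation uj := (unit_j R).
Local Notation params := (R' * vec R k * vec R (n + n))%type.
Variables (psi p f g : vec R (n + n) -> quat R).
Hypothesis psip : L2_rfourier psi p.
Hypothesis fg : L2_rfourier f g.
Hypothesis pj : {ae L, forall w, p w * uj = uj * p w}.

Let P (z : params) : R := normsq (@coefficient R k psi f z.1.1 z.1.2 z.2).

Let P0 z : 0 <= P z. Proof. exact: normsq_ge0. Qed.

Let mP : measurable_fun setT P.
Proof. exact: (measurable_normsq (measurable_coefficient psip fg)). Qed.

(** The Cauchy-Schwarz inequality, as the shearlets have the energy of [psi]. *)
Lemma coefficient_le (a : R) s t : a != 0 ->
  normsq (@coefficient R k psi f a s t) <=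
  fine (energy L f) * fine (energy L psi).
Proof.
move=> a0; have [ef _ _] := fg; have [[mpsi _] _ _] := psip.
have tp := L2_rfourier_translate t (L2_rfourier_dilated s a0 psip).
have [etp _ _] := tp.
have -> : energy L psi = energy L (fun x => @dilated R k a s psi (subv x t)).
  have dI := dilates_inv_shear (k := k) s a0.
  have md := measurableq_dilates dI mpsi.
  have mdd : measurableq (@dilated R k a s psi).
    by apply: measurableqZ => //; exact: measurable_cst.
  rewrite (energy_dilates (dilates_subv t) mdd) mul1e /dilated (energyZ _ _ md).
  rewrite (energy_dilates dI mpsi) muleA -EFinM amplitude_jacobian//.
  by rewrite mul1e.
exact: cauchy_schwarz.
Qed.

Let D := [set z : params | (z.1.1 : R) != 0].

Lemma measurable_nonzero_scale : measurable D.
Proof.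
rewrite (_ : D = ~` ((fun z : params => z.1.1) @^-1` [set 0 : R'])); last first.
  by apply/seteqP; split => z /= /eqP.
apply: measurableC; rewrite -[X in measurable X]setTI.
have m : measurable_fun setT (fun z : params => z.1.1).
  exact: (measurableT_comp measurable_fst measurable_fst).
by apply: m => //; exact: measurable_set1.
Qed.

Let C := @admissibility_integral R k p.
Hypothesis Cfin : (C < +oo)%E.

Lemma total_energy :
  (\int[@shearlet_measure R n']_(z in D) (P z)%:E = C * energy L f)%E.
Proof.
rewrite integral_mkcond.
have mPD : measurable_fun setT ((fun z => (P z)%:E) \_ D : params -> \bar R).
  apply/(measurable_restrictT _ measurable_nonzero_scale).
  by apply: measurable_funTS; exact/measurable_EFinP.
have PD0 z : (0 <= ((fun z => (P z)%:E) \_ D) z)%E.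
  by rewrite patchE; case: ifP => _; rewrite ?lee_fin.
rewrite (@ge0_integral_density _ _ _ (@shearlet_measure R n') (leb_params R n')
  _ (@measurable_mu_density R n') (@mu_density_ge0 R n') (fun A mA => erefl) _ mPD PD0).
rewrite -(total_coefficient_energy psip fg pj Cfin).
pose S (z : params) := haar_weight (k := k) z.1.1 * P z.
have mS : measurable_fun setT (fun z : params => (S z)%:E).
  apply/measurable_EFinP; apply: measurable_funM => //.
  apply: (measurableT_comp (measurable_haar_weight (k := k))).
  exact: (measurableT_comp measurable_fst measurable_fst).
transitivity (\int[leb_params R n']_z (S z)%:E)%E.
  apply: eq_integral => z _; rewrite patchE /S EFinM; case: ifPn => // zD.
  have z0 : (z.1.1 : R) = 0.
    by apply/eqP; apply/negPn; apply: contra zD => z0; rewrite inE.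
  by rewrite mule0 /haar_weight z0 normr0 expr0n invr0 mul0e.
rewrite [LHS](@fubini_tonelli1 _ _ _ _ _ (@leb_affine R k) L _ mS)//.
by move=> z; rewrite lee_fin mulr_ge0 ?P0 ?haar_weight_ge0.
Qed.

Lemma entropy_lower_bound :
  (C * (fine (energy L f) *
     ln (1 / (fine (energy L f) * fine (energy L psi))))%:E <=
   entropy (fun a s t => absq (shearlet_transform psi f a s t) ^+ 2)%R)%E.
Proof.
set K := fine (energy L f) * fine (energy L psi).
have [ef _ _] := fg; have [epsi _ _] := psip.
have mD := measurable_nonzero_scale.
have C0 : (0 <= C)%E.
  apply: integral_ge0 => l _; rewrite lee_fin.
  by rewrite mulr_ge0 ?normsq_ge0// invr_ge0 exprn_ge0.
have mPD : measurable_fun D P by exact: measurable_funTS.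
have tot := total_energy.
have Cf : C \is a fin_num by rewrite ge0_fin_numE.
have Ef := energy_fin ef.
have PI : (@shearlet_measure R n').-integrable D (fun z => (P z)%:E).
  apply/integrableP; split; first exact/measurable_EFinP.
  under eq_integral do rewrite gee0_abs ?lee_fin//.
  by rewrite tot ltey_eq fin_numM.
have KE : ln (1 / K) = - ln K.
  have : 0 <= K by rewrite mulr_ge0 ?fine_ge0 ?energy_ge0.
  rewrite le_eqVlt => /predU1P[<-|K0]; last by rewrite div1r lnV.
  by rewrite invr0 mulr0 ln0// oppr0.
rewrite /entropy KE mulrN EFinN muleN leeN2.
have -> : (C * (fine (energy L f) * ln K)%:E =
    \int[@shearlet_measure R n']_(z in D) ((ln K)%:E * (P z)%:E))%E.
  rewrite integralZl// tot mulrC EFinM fineK// muleCA.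
  by [].
have -> : (\int[@shearlet_measure R n']_(z in D)
    (ln (absq (shearlet_transform psi f z.1.1 z.1.2 z.2) ^+ 2) *
     absq (shearlet_transform psi f z.1.1 z.1.2 z.2) ^+ 2)%:E =
    \int[@shearlet_measure R n']_(z in D) (ln (P z) * P z)%:E)%E.
  apply: eq_integral => z; rewrite inE => z0.
  by rewrite shearlet_transformE// absq_sqr.
apply: le_integral_total => //.
- apply/measurable_EFinP; apply: measurable_funM => //.
  by apply: measurable_funTS; exact: (measurableT_comp (@measurable_ln R) mP).
- by apply: emeasurable_funM; [exact: measurable_cst|exact/measurable_EFinP].
- move=> z z0; rewrite -EFinM lee_fin; apply: ln_mul_le => //.
  exact: coefficient_le.
Qed.

End shearlet_coefficients.

Theorem theorem11 (R : realType) (n : nat)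
    (psi : vec R (n.+1 + n.+1) -> quat R)
    (psi_admissible : admissible psi)
    (psi_neq0 : ~ {ae leb R (n.+1 + n.+1), forall x, psi x = 0})
    (psi_comm : {ae leb R (n.+1 + n.+1), forall w, forall t : vec R n.+1,
      qft psi w * charq (unit_j R) (sndv w) t
      = charq (unit_j R) (sndv w) t * qft psi w})
    (psi_j : {ae leb R (n.+1 + n.+1), forall w, forall t : vec R n.+1,
      qft (fun x => unit_j R * psi x) w * charq (unit_j R) (sndv w) t
      = unit_j R * charq (unit_j R) (sndv w) t * qft psi w})
    (f : vec R (n.+1 + n.+1) -> quat R)
    (f_L2 : inL 2%:E f)
    (f_neq0 : ~ {ae leb R (n.+1 + n.+1), forall x, f x = 0}) :
  (admissibility_constant psi *
     (norm2 f ^+ 2 * ln (1 / (norm2 f ^+ 2 * norm2 psi ^+ 2)))%:E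
   <= entropy (fun a s t => absq (shearlet_transform psi f a s t) ^+ 2)%R)%E.
Proof.
have [/inL2E epsi] := psi_admissible; move/inL2E in f_L2.
have [p psip] := L2_rfourier_exists epsi.
have [g fg] := L2_rfourier_exists f_L2.
have CE := admissibility_constantE psip psi_comm psi_j.
rewrite !norm2_sqr// CE => Cfin.
apply: (entropy_lower_bound psip fg _ Cfin).
by apply: filterS (window_transform psip psi_comm psi_j) => w [].
Qed.
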